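(* Let $\mathbb{F}$ be a field with $\operatorname{char}(\mathbb{F})=0$, let $\mathcal{A}$ be a prime PI algebra over $\mathbb{F}$ with involution $*$ of the first kind, let $f\in\mathbb{F}\langle\bar X,\bar X^*\rangle$, and let $\mathcal{L}:=\operatorname{span} f(\mathcal{A})$. Write $\mathrm{Sym}$ and $\mathrm{Skew}$ for the sets of symmetric and skew-symmetric polynomials in $\mathbb{F}\langle\bar X,\bar X^*\rangle$. If $\dim_{\widetilde{\mathcal{Z}}}\widetilde{\mathcal{A}}\neq 1,4,16$, then exactly one of the following eight possibilities holds: (i) $f\in\mathrm{Id}(\mathcal{A})$; in this case $\widetilde{\mathcal{L}}=0$; (ii) $f\in\mathrm{Cen}(\mathcal{A})$; in this case $\widetilde{\mathcal{L}}=\widetilde{\mathcal{Z}}$; (iii) $f\in\mathrm{Skew}+\mathrm{Id}(\mathcal{A})$ and $f\notin\mathrm{Id}(\mathcal{A})$; in this case $\widetilde{\mathcal{L}}=\widetilde{\mathcal{K}}$; (iv) $f\in\mathrm{Skew}+\mathrm{Cen}(\mathcal{A})$ and $f\notin\mathrm{Cen}(\mathcal{A})$; in this case $\widetilde{\mathcal{L}}=\widetilde{\mathcal{Z}}+\widetilde{\mathcal{K}}$; (v) $f\in\mathrm{Sym}+\mathrm{Id}(\mathcal{A})$, $f\notin\mathrm{Id}(\mathcal{A})$ and $f$ is cyclically equivalent to an element of $\mathrm{Id}(\mathcal{A})$; in this case $\widetilde{\mathcal{L}}=[\widetilde{\mathcal{S}},\widetilde{\mathcal{K}}]$; (vi)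 $f\in\mathrm{Sym}+\mathrm{Id}(\mathcal{A})$, $f\notin\mathrm{Cen}(\mathcal{A})$ and $f$ is not cyclically equivalent to an element of $\mathrm{Id}(\mathcal{A})$; in this case $\widetilde{\mathcal{L}}=\widetilde{\mathcal{S}}$; (vii) $f\notin\mathrm{Sym}+\mathrm{Id}(\mathcal{A})$, $f\notin\mathrm{Skew}+\mathrm{Id}(\mathcal{A})$, and $f+f^*$ is cyclically equivalent to an element of $\mathrm{Id}(\mathcal{A})$; in this case $\widetilde{\mathcal{L}}=[\widetilde{\mathcal{A}},\widetilde{\mathcal{A}}]$; (viii) $f\notin\mathrm{Sym}+\mathrm{Id}(\mathcal{A})$, $f\notin\mathrm{Skew}+\mathrm{Id}(\mathcal{A})$, $f\notin\mathrm{Skew}+\mathrm{Cen}(\mathcal{A})$ and $f+f^*$ is not cyclically equivalent to an element of $\mathrm{Id}(\mathcal{A})$; in this case $\widetilde{\mathcal{L}}=\widetilde{\mathcal{A}}$.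
   Context: An involution on an $\mathbb{F}$-algebra $\mathcal{A}$ is an additive map $*$ with $(ab)^*=b^*a^*$, $a^{**}=a$, $(\lambda a)^*=\lambda^*a^*$, where $\mathbb{F}$ carries an involution; it is of the first kind if it fixes the center $\mathcal{Z}$ of $\mathcal{A}$ pointwise (in the present setting this forces the involution on $\mathbb{F}$ to be trivial). $\mathcal{S}=\{a\in\mathcal{A}:a^*=a\}$, $\mathcal{K}=\{a\in\mathcal{A}:a^*=-a\}$. $\mathbb{F}\langle\bar X,\bar X^*\rangle$ is the free $*$-algebra over $\mathbb{F}$ on $\bar X=\{X_1,X_2,\ldots\}$, i.e. all polynomials in noncommuting variables $X_i,X_j^*$, with its canonical involution; symmetric means $p^*=p$, skew-symmetric means $p^*=-p$. For $f=f(X_1,\ldots,X_n,X_1^*,\ldots,X_n^* )$, $f(\mathcal{A})=\{f(a_1,\ldots,a_n,a_1^*,\ldots,a_n^* ):a_i\in\mathcal{A}\}$ and $\operatorname{span}$ is the $\mathbb{F}$-linear span. $\mathrm{Id}(\mathcal{A})$ is the set of all $f\in\mathbb{F}\langle\bar X,\bar X^*\rangle$ with $f(\mathcal{A})=\{0\}$; $\mathrm{Cen}(\mathcal{A})$ is the set of all central polynomials, i.e. $f\in\mathbb{F}\langle\bar X,\bar X^*\rangle$ with $f\notin\mathrm{Id}(\mathcal{A})$ and $f(\mathcal{A})\subseteq\mathcal{Z}$. For sets $P,Q$ of polynomials, $P+Q=\{p+q:p\in P,q\in Q\}$. Polynomials $f,g\in\mathbb{F}\langle\bar X,\bar X^*\rangle$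 are cyclically equivalent if $f-g$ is a sum of commutators $pq-qp$ with $p,q\in\mathbb{F}\langle\bar X,\bar X^*\rangle$. Algebras are associative and not necessarily unital; if $\mathcal{A}$ has no identity element, all polynomials considered are understood to have zero constant term. An algebra is prime if the product of any two of its nonzero ideals is nonzero; it is PI if it satisfies a nonzero polynomial identity from the free algebra $\mathbb{F}\langle X_1,X_2,\ldots\rangle$. For a prime PI algebra $\mathcal{A}$ the center $\mathcal{Z}$ is nonzero; $\widetilde{\mathcal{Z}}$ denotes its field of fractions, and the central closure $\widetilde{\mathcal{A}}$ is the central localization consisting of elements $z^{-1}a$ ($a\in\mathcal{A}$, $0\neq z\in\mathcal{Z}$), a finite dimensional central simple algebra over $\widetilde{\mathcal{Z}}$. For $\mathcal{V}\subseteq\mathcal{A}$, $\widetilde{\mathcal{V}}$ denotes the $\widetilde{\mathcal{Z}}$-linear span of $\mathcal{V}$ in $\widetilde{\mathcal{A}}$. $[\mathcal{U},\mathcal{V}]$ is the linear span of all commutators $uv-vu$, $u\in\mathcal{U}$, $v\in\mathcal{V}$. *)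

(* Defs.v *)
From HB Require Import structures.
From mathcomp Require Import all_boot all_order all_algebra finmap.
From mathcomp Require Import boolp classical_sets.
From mathcomp Require Import monalg.

Set Implicit Arguments.
Unset Strict Implicit.
Unset Printing Implicit Defensive.

Import GRing.Theory.

Local Open Scope ring_scope.
Local Open Scope classical_set_scope.

(* Associative, not necessarily unital algebras; MathComp's algType is unital. *)
HB.mixin Record Lmodule_isNonUnitalAlgebra (F : fieldType) A
    of GRing.Lmodule F A := {
  amul : A -> A -> A;
  amulA : associative amul;
  amulDl : left_distributive amul +%R;
  amulDr : right_distributive amul +%R;
  amulZl : forall (c : F) (a b : A), amul (c *: a) b = c *: amul a b;
  amulZr : forall (c : F) (a b : A), amul a (c *: b) = c *: amul a b
}.

#[short(type="nuAlgType")]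
HB.structure Definition NonUnitalAlgebra (F : fieldType) :=
  { A of GRing.Lmodule F A & Lmodule_isNonUnitalAlgebra F A }.

Declare Scope nualg_scope.
Delimit Scope nualg_scope with nu.
Notation "a * b" := (amul a b) : nualg_scope.

Section LinearSpan.
Variables (R : nzRingType) (V : lmodType R).

Definition lspan (S : set V) : set V := [set x |
  exists n (c : 'I_n -> R) (v : 'I_n -> V),
    (forall i, S (v i)) /\ x = \sum_i c i *: v i].

Definition has_dim (n : nat) : Prop :=
  exists b : 'I_n -> V, forall x, exists! c : 'rV[R]_n, x = \sum_i c 0 i *: b i.

End LinearSpan.

Section Algebras.
Variables (F : fieldType) (A : nuAlgType F).

Definition is_one (e : A) : Prop :=
  forall a, (e * a)%nu = a /\ (a * e)%nu = a.

(* The identity element of A if there is one, and 0 otherwise. *)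
Definition one_or_zero : A := xget 0 [set e | is_one e].

Definition center : set A := [set z | forall a, (z * a)%nu = (a * z)%nu].

Definition is_ideal (I : set A) : Prop :=
  [/\ I 0,
      forall a b, I a -> I b -> I (a + b),
      forall (c : F) a, I a -> I (c *: a)
    & forall a b, I a -> I (b * a)%nu /\ I (a * b)%nu].

Definition ideal_mul (I J : set A) : set A :=
  lspan [set (a * b)%nu | a in I & b in J].

Definition is_prime : Prop := forall I J : set A,
  is_ideal I -> is_ideal J -> I <> [set 0] -> J <> [set 0] ->
  ideal_mul I J <> [set 0].

End Algebras.

Section Polynomials.
Variables (F : fieldType) (A : nuAlgType F) (I : choiceType).

Definition word_eval (a : I -> A) (w : seq I) : A :=
  if w is i :: s then foldl (fun x j => (x * a j)%nu) (a i) s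
  else one_or_zero A.

Definition poly_eval (a : I -> A) (g : {malg F[{fmonom I}]}) : A :=
  \sum_(w <- msupp g) g@_w *: word_eval a w.

(* If A has no identity element, only polynomials with zero constant term are
   considered: the value poly_eval assigns to constants is then meaningless. *)
Definition admissible (g : {malg F[{fmonom I}]}) : Prop :=
  (exists e : A, is_one e) \/ g@_mone = 0.

End Polynomials.

Definition is_PI (F : fieldType) (A : nuAlgType F) : Prop :=
  exists g : {malg F[{fmonom nat}]},
    [/\ g <> 0, admissible A g & forall a : nat -> A, poly_eval a g = 0].

(* The letter (i, false) is X_i and the letter (i, true) is X_i^*. *)
Notation starPoly F := {malg F[{fmonom (nat * bool)%type}]}.

Section FreeStarAlgebra.
Variables (F : fieldType) (sigma : F -> F).

Definition word_star (w : {fmonom (nat * bool)%type}) :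
    {fmonom (nat * bool)%type} :=
  FMonom (rev [seq (x.1, ~~ x.2) | x <- w]).

Definition poly_star (g : starPoly F) : starPoly F :=
  \sum_(w <- msupp g) << sigma g@_w *g word_star w >>.

Definition Sym : set (starPoly F) := [set g | poly_star g = g].

Definition Skew : set (starPoly F) := [set g | poly_star g = - g].

Definition cyc_equiv (g h : starPoly F) : Prop :=
  exists n (p q : 'I_n -> starPoly F),
    g - h = \sum_i (p i * q i - q i * p i).

End FreeStarAlgebra.

Section AlgebrasWithInvolution.
Variables (F : fieldType) (A : nuAlgType F) (star : A -> A).

Record is_involution (sigma : F -> F) : Prop := IsInvolution {
  starD : {morph star : a b / a + b};
  starM : forall a b, star (a * b)%nu = (star b * star a)%nu;
  starK : involutive star;
  starZ : forall (c : F) a, star (c *: a) = sigma c *: star a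
}.

Definition first_kind : Prop := forall z, center z -> star z = z.

Definition symmetric_elts : set A := [set a | star a = a].

Definition skew_elts : set A := [set a | star a = - a].

Definition star_eval (a : nat -> A) (g : starPoly F) : A :=
  poly_eval (fun x => if x.2 then star (a x.1) else a x.1) g.

Definition values (g : starPoly F) : set A := range (star_eval ^~ g).

Definition Id : set (starPoly F) :=
  [set g | admissible A g /\ values g = [set 0]].

Definition Cen : set (starPoly F) :=
  [set g | [/\ admissible A g, ~ Id g & values g `<=` @center F A]].

End AlgebrasWithInvolution.

Definition add_set (V : zmodType) (P Q : set V) : set V :=
  [set p + q | p in P & q in Q].

Section CentralClosure.
Variables (F : fieldType) (A : nuAlgType F).
Variables (Zt : fieldType) (At : algType Zt) (iota : {additive A -> At}).

(* iota exhibits At as the central localization of A, and Zt as the field of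
   fractions of the center of A, embedded by j. The center of a non-unital A
   need not be a unital ring, so that {fraction _} does not apply to it. The
   values of j outside of the center are irrelevant. *)
Definition is_central_closure : Prop := exists j : A -> Zt,
  [/\ injective iota,
      forall a b, iota (a * b)%nu = iota a * iota b,
      forall z, center z -> iota z = (j z)%:A,
      forall k : Zt, exists z y,
        [/\ center z, z <> 0, center y & k = (j z)^-1 * j y]
    & forall b : At, exists z a,
        [/\ center z, z <> 0 & b = (j z)^-1 *: iota a]].

Definition tilde (V : set A) : set At := lspan (iota @` V).

Definition comm_span (U V : set At) : set At :=
  lspan [set u * v - v * u | u in U & v in V].

End CentralClosure.

(* Each pair is a possibility together with what holds "in this case". *)
Definition exactly_one_of (cs : seq (Prop * Prop)) : Prop :=
  (exists! i, (nth (False, True) cs i).1) /\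
  (forall i, (nth (False, True) cs i).1 -> (nth (False, True) cs i).2).

(* Main.v *)
From Stdlib Require Import Ncring Ncring_tac.
From HB Require Import structures.
From mathcomp Require Import all_boot all_order all_algebra all_fingroup finmap.
From mathcomp Require Import boolp.
From mathcomp Require Import monalg.
Require Import Defs.

Set Implicit Arguments.
Unset Strict Implicit.
Unset Printing Implicit Defensive.

Import GRing.Theory.

Local Open Scope ring_scope.

(** Let [B] be the central closure, with the extended involution, let [S] and [K]
    be its sets of symmetric and of skew elements, and let [L] be the span of
    the values of [f]. Substituting [a + t [a, l]] for [a] is compatible with
    the involution when [l] is skew, and the part of [f(a + t [a, l])] that is
    linear in [t] is [[f(a), l]]; so [L] is stable under commutation with [K]
    ([span_invariant]).

    If the dimension of [B] is not 1, 4 or 16, then [B] is the direct sum of the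
    scalars, of [[S, K]] and of [K], and every subspace that is stable under
    commutation with [K] is the sum of some of these three summands
    ([invariant_dec]). This leaves eight subspaces, and each of the conditions on
    [f] tells which summands occur in [L]. For the symmetric, skew and central
    polynomials this is a matter of taking halves of [f + f^*] and [f - f^*].
    For cyclic equivalence it follows from the trace [tau]: as [tau] vanishes on
    [[S, K]] and on [K] but not on 1, the scalars occur in [L] unless
    [tau (f(a)) = 0] for all [a], and this happens precisely when [f + f^*] is
    cyclically equivalent to an identity. Indeed, if [tau (f(a)) = 0], then the
    cyclic derivatives of [f] are identities because the trace form is
    nondegenerate, and they determine [f + f^*] up to cyclic equivalence by
    Euler's formula for homogeneous polynomials ([trace_zero_cyclic]).

    The stable subspaces are classified without extending the scalars. A stable
    space [M] of symmetric or of skew elements generates a subalgebra that is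
    stable as well. If it is [B], then [M] contains [[S, K]] or [[K, K]]. If not,
    its symmetric elements are scalars ([invariant_subalgebra]); then [M] is 0 or
    consists of scalars, or the subalgebra is a quaternion algebra and so is its
    commutant, whence [B] has dimension 16 ([skew_lie_ideal]). An arbitrary
    stable space is split into its symmetric and skew parts by the Casimir
    operator of [K], which acts by different constants on the two parts
    ([casimir]).

    That [B] has finite dimension, and a trace form, is derived from the
    polynomial identity. By the theorem of Regev, the number of multilinear words
    of length [n] that are independent on [B] grows only exponentially in [n], so
    that products of [n] elementary operators [x |-> sum_k a_k x b_k] are
    linearly dependent for large [n]; density of the ideals of a prime ring then
    bounds the rank of [B] over its extended centroid ([PI_finite_rank]). The
    coordinates on [B] and the trace of its regular representation are themselves
    elementary operators ([finite_rank_coordinates]), and this is what makes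
    duality arguments possible. *)

(** * Identities in noncommutative rings *)

#[local] Instance nzring_ops (R : nzRingType) :
  @Ring_ops R 0 1 +%R *%R (fun x y => x - y) -%R eq := {}.

#[local] Instance nzring_ring (R : nzRingType) :
  Ncring.Ring (Ro := nzring_ops R).
Proof.
constructor; try (by move=> *; subst); rewrite /=.
- exact: RelationClasses.eq_equivalence.
- by move=> x y -> ? ? ->.
- by move=> x y -> ? ? ->.
- by move=> x y -> ? ? ->.
- by move=> x y ->.
- exact: add0r.
- exact: addrC.
- exact: addrA.
- exact: mul1r.
- exact: mulr1.
- exact: mulrA.
- by move=> x y z; exact: mulrDl.
- by move=> x y z; exact: mulrDr.
- by move=> x; exact: addrN.
Qed.

Ltac ncring := rewrite ?expr2; non_commutative_ring.

(** * Elementary operators *)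

Section ElementaryOperators.
Variable B : nzRingType.
Implicit Types (s : seq (B * B)) (T P : B -> B).

Definition eop s (x : B) : B := \sum_(p <- s) p.1 * x * p.2.

Definition elementary T := exists s, forall x, T x = eop s x.

Definition flip s : seq (B * B) := [seq (p.2, p.1) | p <- s].

Lemma eop_cat s1 s2 x : eop (s1 ++ s2) x = eop s1 x + eop s2 x.
Proof. by rewrite /eop big_cat. Qed.

Lemma eop_elementary s : elementary (eop s).
Proof. by exists s. Qed.

Lemma eopD s x y : eop s (x + y) = eop s x + eop s y.
Proof.
by rewrite /eop -big_split; apply: eq_bigr => p _; rewrite mulrDr mulrDl.
Qed.

Lemma eop0 s : eop s 0 = 0.
Proof. by rewrite /eop big1 // => p _; rewrite mulr0 mul0r. Qed.

Lemma elementaryD T x y : elementary T -> T (x + y) = T x + T y.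
Proof. by case=> s E; rewrite !E eopD. Qed.

Lemma elementary_at0 T : elementary T -> T 0 = 0.
Proof. by case=> s E; rewrite !E eop0. Qed.

Lemma elementary_sum T I r (P : pred I) (F : I -> B) : elementary T ->
  T (\sum_(i <- r | P i) F i) = \sum_(i <- r | P i) T (F i).
Proof.
move=> eT; apply: (big_morph T); last exact: elementary_at0.
by move=> x y; rewrite elementaryD.
Qed.

Lemma elementary_id : elementary id.
Proof. by exists [:: (1, 1)] => x; rewrite /eop big_seq1 mul1r mulr1. Qed.

Lemma elementary_zero : elementary (fun=> 0).
Proof. by exists [::] => x; rewrite /eop big_nil. Qed.

Lemma elementary_comp T P : elementary T -> elementary P ->
  elementary (fun x => T (P x)).
Proof.
move=> [s ET] [s' EP].
exists [seq (p.1 * q.1, q.2 * p.2) | p <- s, q <- s'] => x.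
rewrite ET EP /eop big_allpairs_dep; apply: eq_bigr => p _.
rewrite mulr_sumr mulr_suml; apply: eq_bigr => q _ /=.
by rewrite !mulrA.
Qed.

Lemma elementary_add T P : elementary T -> elementary P ->
  elementary (fun x => T x + P x).
Proof. by move=> [s ET] [s' EP]; exists (s ++ s') => x; rewrite eop_cat ET EP. Qed.

Lemma elementary_mul a b : elementary (fun x => a * x * b).
Proof. by exists [:: (a, b)] => x; rewrite /eop big_seq1. Qed.

Lemma elementary_mulr b T : elementary T -> elementary (fun x => T x * b).
Proof.
move=> eT; have [s E] := elementary_comp (elementary_mul 1 b) eT.
by exists s => x; rewrite -E mul1r.
Qed.

Lemma elementary_mull a T : elementary T -> elementary (fun x => a * T x).
Proof.
move=> eT; have [s E] := elementary_comp (elementary_mul a 1) eT.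
by exists s => x; rewrite -E mulr1.
Qed.

Lemma elementary_opp T : elementary T -> elementary (fun x => - T x).
Proof.
move=> eT; have [s E] := elementary_mull (- 1) eT.
by exists s => x; rewrite -E mulN1r.
Qed.

Lemma elementary_sub T P : elementary T -> elementary P ->
  elementary (fun x => T x - P x).
Proof. by move=> eT eP; apply: elementary_add => //; apply: elementary_opp. Qed.

Lemma elementary_bigsum (I : eqType) (r : seq I) (Q : pred I) (F : I -> B -> B) :
  (forall i, Q i -> elementary (F i)) ->
  elementary (fun x => \sum_(i <- r | Q i) F i x).
Proof.
move=> eF; elim: r => [|i r [s E]].
  by exists [::] => x; rewrite /eop !big_nil.
have [Qi|Qi] := boolP (Q i); last first.
  by exists s => x; rewrite big_cons (negPf Qi).
have [s' E'] := eF _ Qi.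
by exists (s' ++ s) => x; rewrite big_cons Qi eop_cat E E'.
Qed.

End ElementaryOperators.

(** * Elementary operators of prime rings *)

Section PrimeRing.
Variable B : nzRingType.
Hypothesis prime_B : forall x y : B, (forall r, x * r * y = 0) -> x = 0 \/ y = 0.
Implicit Types T P Q : B -> B.

Lemma prime_neq0 (x y : B) : x <> 0 -> y <> 0 -> exists r, x * r * y <> 0.
Proof.
move=> x0 y0; apply: contrapT => /forallNP h.
by case: (@prime_B x y) => // r; apply: contrapT; apply: h.
Qed.

(** Nonzero ideals of a prime ring intersect, so finitely many nonzero elements
    have a common nonzero multiple. *)
Lemma common_multiple (I : eqType) (r : seq I) (w : I -> B) :
  (forall i, i \in r -> w i <> 0) ->
  exists2 u : B, u <> 0 &
    forall i, i \in r -> exists2 P, elementary P & P (w i) = u.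
Proof.
elim: r => [|i r IHr] w0.
  by exists 1 => //; apply/eqP/oner_neq0.
have [|u u0 Pu] := IHr; first by move=> j jr; apply: w0; rewrite inE jr orbT.
have [t t0] := prime_neq0 (w0 i (mem_head _ _)) u0.
exists (w i * t * u) => // j; rewrite inE => /orP[/eqP->|/Pu[P eP <-]].
  by exists (fun x => 1 * x * (t * u)); [exact: elementary_mul|rewrite mul1r mulrA].
by exists (fun x => w i * t * P x) => //; apply: elementary_mull.
Qed.

(** [in_closure b S x] says that [x] depends linearly, over the extended
    centroid, on the [b i] with [i] in [S]; phrasing this with elementary
    operators makes it unnecessary to construct the extended centroid. *)
Definition in_closure (I : finType) (b : I -> B) (S : {set I}) (x : B) :=
  forall Q, elementary Q -> (forall i, i \in S -> Q (b i) = 0) -> Q x = 0.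

(** A minimal spanning subfamily has a dual basis of elementary operators; the
    common value [u] plays the role of the scalar 1. *)
Definition dual_basis (I : finType) (b : I -> B) (S : {set I})
    (T : I -> B -> B) (u : B) :=
  [/\ u <> 0, forall i, i \in S -> elementary (T i)
    & forall i j, i \in S -> j \in S -> T i (b j) = if i == j then u else 0].

Lemma dual_basis_exists (I : finType) (b : I -> B) :
  exists S (T : I -> B -> B) u, dual_basis b S T u /\ forall k, in_closure b S (b k).
Proof.
pose span (S : {set I}) := `[< forall k, in_closure b S (b k) >].
have [|S /minsetP[/asboolP spanS minS]] := @ex_minset _ span.
  by exists [set: I]; apply/asboolP => k Q _; apply; rewrite inE.
have /choice[Q PQ] : forall i, exists Q, i \in S ->
    [/\ elementary Q, Q (b i) <> 0 & forall j, j \in S -> i != j -> Q (b j) = 0].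
  move=> i; have [iS|] := boolP (i \in S); last by exists id.
  have nspan : ~ span (S :\ i).
    move=> /minS /(_ (subD1set _ _)) /setP /(_ i).
    by rewrite !inE eqxx iS.
  have [k /existsNP[Q hQ]] : exists k, ~ in_closure b (S :\ i) (b k).
    by apply: contrapT => /forallNP h; apply: nspan; apply/asboolP => k;
      apply: contrapT; apply: h.
  move: hQ => /not_implyP[eQ /not_implyP[Q0 Qk]].
  have QS j : j \in S -> i != j -> Q (b j) = 0.
    by move=> jS ij; apply: Q0; rewrite !inE eq_sym ij.
  exists Q => _; split => // Qi; apply: Qk.
  apply: (spanS k Q eQ) => j jS.
  by have [<-//|ij] := eqVneq i j; apply: QS.
have [|u u0 Pu] := @common_multiple _ (enum S) (fun i => Q i (b i)).
  by move=> i; rewrite mem_enum => /PQ[].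
have /choice[P PP] : forall i, exists P, i \in S ->
    elementary P /\ P (Q i (b i)) = u.
  move=> i; have [iS|] := boolP (i \in S); last by exists id.
  by have [|P eP E] := Pu i; [rewrite mem_enum|exists P].
exists S, (fun i x => P i (Q i x)), u; split => //; split => //.
  move=> i iS; have [eP _] := PP i iS; have [eQ _ _] := PQ i iS.
  exact: elementary_comp.
move=> i j iS jS; have [eP Pi] := PP i iS; have [eQ Qi0 Qij] := PQ i iS.
have [<-//|ij] := eqVneq i j.
by rewrite Qij // elementary_at0.
Qed.

Section DualBasis.
Variables (I : finType) (b : I -> B) (S : {set I}) (T : I -> B -> B) (u : B).
Hypothesis dbT : dual_basis b S T u.

Let eT i : i \in S -> elementary (T i). Proof. by case: dbT => _ h _; apply: h. Qed.
Let Tb i j : i \in S -> j \in S -> T i (b j) = if i == j then u else 0.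
Proof. by case: dbT => _ _; apply. Qed.

Lemma sum_dual (F : I -> B) j : j \in S ->
  (forall i, i \in S -> i != j -> F i = 0) -> \sum_(i in S) F i = F j.
Proof.
move=> jS F0; rewrite (bigD1 j) //= big1 ?addr0 // => i /andP[iS ij].
exact: F0.
Qed.

(** The three relations below express that [x] is the sum of the [lam_i b_i]
    with [T i x = lam_i u]. Both sides are elementary in [x], so it is enough to
    compare them at the [b j]. *)
Lemma dual_expansion_l P x r : elementary P -> in_closure b S x ->
  u * r * P x = \sum_(i in S) T i x * r * P (b i).
Proof.
move=> eP /(_ (fun x => u * r * P x - \sum_(i in S) T i x * r * P (b i))) h.
apply/eqP; rewrite -subr_eq0; apply/eqP/h.
  apply: elementary_sub; first exact: elementary_mull.
  apply: elementary_bigsum => i iS.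
  by apply: elementary_mulr; apply: elementary_mulr; apply: eT.
move=> j jS; rewrite (sum_dual jS) ?Tb ?eqxx ?subrr // => i iS ij.
by rewrite Tb // (negPf ij) !mul0r.
Qed.

Lemma dual_expansion_r P x r : elementary P -> in_closure b S x ->
  P x * r * u = \sum_(i in S) P (b i) * r * T i x.
Proof.
move=> eP /(_ (fun x => P x * r * u - \sum_(i in S) P (b i) * r * T i x)) h.
apply/eqP; rewrite -subr_eq0; apply/eqP/h.
  apply: elementary_sub; first by apply: elementary_mulr; apply: elementary_mulr.
  apply: elementary_bigsum => i iS.
  by apply: elementary_mull; apply: eT.
move=> j jS; rewrite (sum_dual jS) ?Tb ?eqxx ?subrr // => i iS ij.
by rewrite Tb // (negPf ij) !mulr0.
Qed.

Lemma dual_scalar i P x r : i \in S -> elementary P -> in_closure b S x ->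
  T i x * r * P u = u * r * P (T i x).
Proof.
move=> iS eP /(_ (fun x => T i x * r * P u - u * r * P (T i x))) h.
apply/eqP; rewrite -subr_eq0; apply/eqP/h.
  apply: elementary_sub.
    by apply: elementary_mulr; apply: elementary_mulr; apply: eT.
  by apply: elementary_mull; apply: elementary_comp => //; apply: eT.
move=> j jS; rewrite Tb //; case: eqP => _; first exact: subrr.
by rewrite elementary_at0 // !mul0r mulr0 subrr.
Qed.

End DualBasis.

Definition is_ideal_of (J : B -> Prop) :=
  J 0 /\ (forall x y, J x -> J y -> J (x + y)) /\
  (forall a x c, J x -> J (a * x * c)).

Lemma ideal_eop (J : B -> Prop) P x : is_ideal_of J -> elementary P ->
  J x -> J (P x).
Proof.
move=> [J0 [JD JM]] [s E] Jx; rewrite E /eop.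
by elim/big_ind: _ => // p _; apply: JM.
Qed.

(** Ideals are dense. Writing the operator as the sum of the [a_k x b_k], the
    coefficients along a dual basis of the [b_k] are operators
    [x |-> sum_k a_k x T_i(b_k)], which kill the ideal as well; and since the
    [T_i(b_k)] are multiples of the same [u], such an operator is determined by
    its restriction to the ideal. *)
Lemma eop_vanish_ideal (J : B -> Prop) j s : is_ideal_of J -> J j -> j <> 0 ->
  (forall x, J x -> eop s x = 0) -> forall x, eop s x = 0.
Proof.
move=> idJ Jj j0 sJ x; have [J0 [JD JM]] := idJ.
pose a (k : 'I_(size s)) := (nth (0, 0) s k).1.
pose b (k : 'I_(size s)) := (nth (0, 0) s k).2.
have sE y : eop s y = \sum_k a k * y * b k.
  by rewrite /eop (big_nth (0, 0)) big_mkord.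
have [S [T [u [dbT bS]]]] := dual_basis_exists b.
have [u0 eT _] := dbT.
pose A i y := \sum_k a k * y * T i (b k).
have AJ i y : i \in S -> J y -> A i y = 0.
  move=> iS Jy; have [si E] := eT i iS.
  have -> : A i y = \sum_(p <- si) eop s (y * p.1) * p.2.
    rewrite /A; under eq_bigr do rewrite E /eop mulr_sumr.
    rewrite exchange_big; apply: eq_bigr => p _; rewrite sE mulr_suml.
    by apply: eq_bigr => k _; rewrite !mulrA.
  rewrite big1 // => p _; rewrite sJ ?mul0r //.
  by rewrite -[y * _]mul1r mulrA; apply: JM.
have A0 i y : i \in S -> A i y = 0.
  move=> iS; have [z z0] := prime_neq0 j0 u0.
  (* [T_i(b_k) r P(u) = u r P(T_i(b_k))] with [P] the multiplication by [j z] *)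
  have AP r : A i y * r * (j * z * u) = 0.
    have <- : A i (y * u * r * j * z) = 0 by apply: AJ => //; apply: JM.
    rewrite /A !mulr_suml; apply: eq_bigr => k _.
    have := @dual_scalar _ _ _ _ _ dbT i (fun x => j * z * x) (b k) r iS
      (elementary_mull _ (@elementary_id B)) (bS k).
    by rewrite -!mulrA => ->.
  by have [//|] := prime_B AP.
have [|//|/u0[]] := @prime_B (eop s x) u.
move=> r; rewrite sE !mulr_suml.
transitivity (\sum_(i in S) A i (x * b i * r)); last by rewrite big1 // => i /A0.
rewrite /A exchange_big; apply: eq_bigr => k _ /=.
have := @dual_expansion_r _ _ _ _ _ dbT id (b k) r (@elementary_id B) (bS k).
rewrite -!mulrA => ->; rewrite !mulr_sumr.
by apply: eq_bigr => i _; rewrite !mulrA.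
Qed.

(** * Prime rings of finite rank *)

Section FiniteRank.
Variables (I : finType) (b : I -> B) (S : {set I}) (T : I -> B -> B) (u : B).
Hypothesis dbT : dual_basis b S T u.
Hypothesis full : forall x, in_closure b S x.

Let u0 : u <> 0. Proof. by case: dbT. Qed.
Let eT i : i \in S -> elementary (T i). Proof. by case: dbT => _ h _; apply: h. Qed.
Let Tb i j : i \in S -> j \in S -> T i (b j) = if i == j then u else 0.
Proof. by case: dbT => _ _; apply. Qed.

Let cancel_u x y : (forall r, u * r * x = u * r * y) -> x = y.
Proof.
move=> h; apply/eqP; rewrite -subr_eq0; apply/eqP.
have [|//|//] := @prime_B u (x - y).
by move=> r; rewrite mulrBr h subrr.
Qed.

Let id_elementary := @elementary_id B.

(** Ratios to [u] of the coordinates behave as elements of a commutative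
    field: here, they commute with each other. *)
Lemma coord_comm i j x y r : i \in S -> j \in S ->
  T i y * r * T j x = T j x * r * T i y.
Proof.
move=> iS jS; apply: cancel_u => s.
have hi := @dual_scalar _ _ _ _ _ dbT i id y r iS id_elementary (full y).
have hj := @dual_scalar _ _ _ _ _ dbT j id x s jS id_elementary (full x).
have <- := @dual_scalar _ _ _ _ _ dbT j (fun z => T i y * r * z) x s jS
  (elementary_mull _ id_elementary) (full x).
by rewrite hi !mulrA hj.
Qed.

(** Up to the factor [u], the trace of the left multiplication by [a]. *)
Definition rtrace a := \sum_(i in S) T i (a * b i).

Lemma rtrace_elementary : elementary rtrace.
Proof.
apply: elementary_bigsum => i iS; apply: elementary_comp; first exact: eT.
exact: elementary_mulr.
Qed.

Lemma rtraceC x y : rtrace (x * y) = rtrace (y * x).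
Proof.
have E z t r : u * r * rtrace (z * t) =
    \sum_(i in S) \sum_(j in S) T j (t * b i) * r * T i (z * b j).
  rewrite mulr_sumr; apply: eq_bigr => i iS; rewrite -(mulrA z).
  have e : elementary (fun y => T i (z * y)).
    by apply: elementary_comp; [exact: eT|apply: elementary_mull].
  exact: (@dual_expansion_l _ _ _ _ _ dbT _ (t * b i) r e (full _)).
apply: cancel_u => r; rewrite !E exchange_big /=.
by apply: eq_bigr => j jS; apply: eq_bigr => i iS; apply: coord_comm.
Qed.

(** The operators [x |-> sum_k a_k x b_k] and [x |-> sum_k b_k x a_k] vanish
    together, since both correspond to the same tensor. *)
Lemma eop_flip_eq0 (s : seq (B * B)) : (forall x, eop s x = 0) -> forall x, eop (flip s) x = 0.
Proof.
move=> s0 x.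
have A0 i y : i \in S -> \sum_(p <- s) p.1 * y * T i p.2 = 0.
  move=> iS; have [si E] := eT iS.
  transitivity (\sum_(q <- si) eop s (y * q.1) * q.2).
    under eq_bigr do rewrite E /eop mulr_sumr.
    rewrite exchange_big; apply: eq_bigr => q _; rewrite mulr_suml.
    by apply: eq_bigr => p _; rewrite !mulrA.
  by rewrite big1 // => q _; rewrite s0 mul0r.
have G0 i y : i \in S -> \sum_(p <- s) T i p.2 * y * p.1 = 0.
  move=> iS; have [|//|//] := @prime_B (\sum_(p <- s) T i p.2 * y * p.1) u.
  move=> r; transitivity (u * y * \sum_(p <- s) p.1 * r * T i p.2); last first.
    by rewrite A0 ?mulr0.
  rewrite !mulr_suml mulr_sumr; apply: eq_bigr => p _.
  have := @dual_scalar _ _ _ _ _ dbT i (fun z => p.1 * r * z) p.2 y iS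
    (elementary_mull _ id_elementary) (full _).
  by rewrite !mulrA.
apply: cancel_u => r; rewrite mulr0 /eop /flip big_map /= mulr_sumr.
transitivity (\sum_(i in S) \sum_(p <- s) T i p.2 * (r * b i * x) * p.1).
  rewrite exchange_big; apply: eq_bigr => p _.
  have := @dual_expansion_l _ _ _ _ _ dbT id p.2 r id_elementary (full _).
  by rewrite !mulrA => ->; rewrite -mulrA !mulr_suml; apply: eq_bigr => i _; rewrite !mulrA.
by rewrite big1 // => i iS; rewrite G0.
Qed.

Hypothesis torsion_free : forall n (x : B), x *+ n.+1 = 0 -> x = 0.

Lemma rtrace1 : rtrace 1 <> 0.
Proof.
rewrite /rtrace (eq_bigr (fun=> u)) => [|i iS]; last by rewrite mul1r Tb ?eqxx.
rewrite sumr_const; case: (posnP #|S|) => [S0|/prednK <- /torsion_free//].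
case/eqP: (@oner_neq0 B); apply: (full _ id_elementary) => i.
by rewrite (cards0_eq S0) inE.
Qed.

(** The flipped trace operator has central values because the trace is
    symmetric, and it cannot kill a nonzero ideal. *)
Lemma ideal_meets_center (J : B -> Prop) j : is_ideal_of J -> J j -> j <> 0 ->
  exists z, [/\ J z, z <> 0 & forall x, z * x = x * z].
Proof.
move=> idJ Jj j0; have [s E] := rtrace_elementary.
have central y x : eop (flip s) y * x = x * eop (flip s) y.
  pose s1 := [seq (p.1 * x, p.2) | p <- s] ++ [seq (- p.1, x * p.2) | p <- s].
  have s10 z : eop s1 z = 0.
    rewrite eop_cat /eop !big_map /=.
    transitivity (rtrace (x * z) - rtrace (z * x)).
      rewrite !E /eop; congr (_ + _); rewrite ?raddf_sum; apply: eq_bigr => p _ /=;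
        by rewrite ?mulNr !mulrA.
    by rewrite rtraceC subrr.
  have := eop_flip_eq0 s10 y.
  rewrite /flip map_cat eop_cat /eop -!map_comp !big_map /= => /eqP.
  rewrite addr_eq0 => /eqP h.
  rewrite mulr_suml mulr_sumr; under eq_bigr do rewrite -mulrA; rewrite h.
  by rewrite -sumrN; apply: eq_bigr => p _; rewrite mulrN opprK !mulrA.
have [y [Jy y0]] : exists y, J y /\ eop (flip s) y <> 0.
  apply: contrapT => /forallNP h; apply: rtrace1; rewrite E.
  have -> : s = flip (flip s).
    by rewrite /flip -map_comp -[LHS]map_id; apply: eq_map; case.
  apply: eop_flip_eq0; apply: (eop_vanish_ideal idJ Jj j0) => x Jx.
  by apply: contrapT => x0; apply: (h x).
exists (eop (flip s) y); split => //; apply: ideal_eop => //.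
exact: eop_elementary.
Qed.

End FiniteRank.
End PrimeRing.

(** * From finite rank to finite dimension *)

Section FiniteRankAlgebra.
Variables (k : fieldType) (B : algType k).
Hypothesis prime_B : forall x y : B, (forall r, x * r * y = 0) -> x = 0 \/ y = 0.
Hypothesis torsion_free : forall n (x : B), x *+ n.+1 = 0 -> x = 0.
Hypothesis center_B : forall z : B, (forall x, z * x = x * z) -> exists c : k, z = c%:A.
Variables (I : finType) (b : I -> B).
Hypothesis finite_rank : forall x, in_closure b [set: I] x.

Lemma elementaryZ (T : B -> B) c x : elementary T -> T (c *: x) = c *: T x.
Proof.
case=> s E; rewrite !E /eop scaler_sumr; apply: eq_bigr => p _.
by rewrite -scalerAr -scalerAl.
Qed.

Let full_dual_basis : exists S (T : I -> B -> B) u,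
  dual_basis b S T u /\ forall x, in_closure b S x.
Proof.
have [S [T [u [dbT bS]]]] := dual_basis_exists prime_B b.
exists S, T, u; split => // x Q eQ QS.
by apply: finite_rank => // i _; apply: bS.
Qed.

(** The ideal generated by [w] contains a nonzero central element, which is an
    invertible scalar. *)
Lemma finite_rank_simple (w : B) : w <> 0 -> exists2 P, elementary P & P w = 1.
Proof.
move=> w0; have [S [T [u [dbT full]]]] := full_dual_basis.
pose J x := exists2 P, elementary P & P w = x.
have idJ : is_ideal_of J.
  split; first by exists (fun=> 0); first exact: elementary_zero.
  split=> [x y [P eP <-] [Q eQ <-]|a x c [P eP <-]].
    by exists (fun z => P z + Q z); first exact: elementary_add.
  exists (fun z => a * P z * c) => //.
  by apply: elementary_mulr; apply: elementary_mull.
have Jw : J w by exists id; first exact: elementary_id.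
have [z [[P eP Pz] z0 /center_B[c cz]]] :=
  ideal_meets_center prime_B dbT full torsion_free idJ Jw w0.
have c0 : c != 0 by apply/eqP => c0; apply: z0; rewrite cz c0 scale0r.
exists (fun x => (c^-1)%:A * P x); first exact: elementary_mull.
by rewrite Pz cz mulr_algl scalerA mulVf // scale1r.
Qed.

(** Over a central simple algebra the coordinates are scalars. The second part
    is the trace of the regular representation, which is thus an elementary
    operator. *)
Lemma finite_rank_coordinates :
  (exists (v : I -> B) (lam : I -> B -> k),
     (forall i, elementary (fun x => (lam i x)%:A)) /\
     forall x, x = \sum_i lam i x *: v i) /\
  (exists (s : seq (B * B)) (tau : B -> k),
     [/\ forall x, eop s x = (tau x)%:A, forall x y, tau (x * y) = tau (y * x)
       & tau 1 <> 0]).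
Proof.
have [S [T [u [dbT full]]]] := full_dual_basis; have [u0 eT Tb] := dbT.
have [P eP Pu] := finite_rank_simple u0.
have coord i x : i \in S -> exists c : k, T i x = c *: u /\ P (T i x) = c%:A.
  move=> iS.
  have E r : T i x * r = u * r * P (T i x).
    by have := dual_scalar dbT r iS eP (full x); rewrite Pu mulr1.
  have [|c Ec] := @center_B (P (T i x)).
    move=> y; have [|//|/eqP] := @prime_B u (P (T i x) * y - y * P (T i x)).
      by move=> r; rewrite mulrBr [X in X - _]mulrA -E [X in _ - X]mulrA -(mulrA u) -E
           mulrA subrr.
    by rewrite subr_eq0 => /eqP.
  by exists c; split => //; have := E 1; rewrite !mulr1 Ec mulr_algr.
have /choice[lam0 lamP] : forall ix : I * B, exists c : k, ix.1 \in S ->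
    T ix.1 ix.2 = c *: u /\ P (T ix.1 ix.2) = c%:A.
  move=> [i x]; have [iS|] := boolP (i \in S); last by exists 0.
  by have [c Ec] := coord i x iS; exists c.
pose lam i x := if i \in S then lam0 (i, x) else 0.
have TE i x : i \in S -> T i x = lam i x *: u.
  by move=> iS; rewrite /lam iS; case: (lamP (i, x) iS).
have PE i x : i \in S -> (lam i x)%:A = P (T i x).
  by move=> iS; rewrite /lam iS; case: (lamP (i, x) iS).
split.
  exists b, lam; split=> [i|x].
    have [iS|/negPf iS] := boolP (i \in S); last first.
      by exists [::] => x; rewrite /lam iS scale0r /eop big_nil.
    have [s E] := elementary_comp eP (eT i iS).
    by exists s => x; rewrite PE ?E.
  apply/eqP; rewrite -subr_eq0; apply/eqP.
  have [|//|//] := @prime_B u (x - \sum_i lam i x *: b i).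
  move=> r; rewrite mulrBr.
  have -> := dual_expansion_l dbT r (@elementary_id B) (full x).
  rewrite mulr_sumr big_mkcond -sumrB big1 // => i _ /=.
  have [iS|/negPf iS] := boolP (i \in S).
    by rewrite TE // -!scalerAl -scalerAr subrr.
  by rewrite /lam iS scale0r mulr0 subrr.
have [s E] := elementary_comp eP (rtrace_elementary dbT).
pose tau x := \sum_(i in S) lam i (x * b i).
have tauE x : (tau x)%:A = P (rtrace b S T x).
  rewrite elementary_sum // /tau scaler_suml.
  by apply: eq_bigr => i iS; rewrite PE.
have algI (c d : k) : c%:A = d%:A :> B -> c = d.
  move/eqP; rewrite -subr_eq0 -scalerBl scaler_eq0 oner_eq0 orbF subr_eq0.
  by move/eqP.
exists s, tau; split=> [x|x y|tau1]; first by rewrite -E tauE.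
  by apply: algI; rewrite !tauE (rtraceC prime_B dbT full).
apply: (rtrace1 dbT full torsion_free).
have -> : rtrace b S T 1 = tau 1 *: u; last by rewrite tau1 scale0r.
by rewrite /tau scaler_suml; apply: eq_bigr => i iS; rewrite TE.
Qed.
End FiniteRankAlgebra.

(** * Permutations without long decreasing subsequences *)

Section GoodPermutations.
Variable n : nat.
Implicit Types (s t : 'S_n) (A : {set 'I_n}) (p q : 'I_n).

Definition decreasing_on s A :=
  [forall x in A, forall y in A, (x < y)%N ==> (s y < s x)%N].

Definition no_decreasing d s := [forall A, decreasing_on s A ==> (#|A| < d)%N].

Definition chains_to s p : {set {set 'I_n}} :=
  [set A | [&& decreasing_on s A, p \in A & [forall x in A, (x <= p)%N]]].

(** The length of the longest decreasing subsequence that ends at position [p].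
    The labels of the positions and of the values determine the permutation
    because it increases on each set of positions with a given label. *)
Definition dec_label s p := \max_(A in chains_to s p) #|A|.

Lemma dec_label_lt s p q : (p < q)%N -> (s q < s p)%N ->
  (dec_label s p < dec_label s q)%N.
Proof.
move=> pq sqp; rewrite /dec_label.
have [|A] := @eq_bigmax_cond _ (mem (chains_to s p)) (fun A => #|A|).
  apply/card_gt0P; exists [set p]; rewrite !inE eqxx /=; apply/andP; split.
    by apply/forall_inP => x /set1P->; apply/forall_inP => y /set1P->; rewrite ltnn.
  by apply/forall_inP => x /set1P->.
rewrite inE => /and3P[decA pA /forall_inP leA] ->.
have qA : q \notin A by apply/negP => /leA; rewrite leqNgt pq.
have -> : #|A|.+1 = #|q |: A| by rewrite cardsU1 qA.
apply: (@leq_bigmax_cond _ _ (fun A => #|A|)).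
rewrite inE setU11 /=; apply/andP; split; last first.
  apply/forall_inP => x /setU1P[->//|/leA xp].
  exact: leq_trans xp (ltnW pq).
apply/forall_inP => x /setU1P[->|xA]; apply/forall_inP => y /setU1P[->|yA];
  apply/implyP => xy.
- by rewrite ltnn in xy.
- by have := leq_ltn_trans (leA _ yA) pq; rewrite ltnNge ltnW.
- have [->//|xp] := eqVneq x p; have := leA _ xA; rewrite leq_eqVlt.
  rewrite (inj_eq val_inj) (negPf xp) => /= ltxp; apply: ltn_trans sqp _.
  by move/forall_inP/(_ _ xA)/forall_inP/(_ _ pA)/implyP: decA; apply.
- by move/forall_inP/(_ _ xA)/forall_inP/(_ _ yA)/implyP: decA; apply.
Qed.

Lemma dec_label_inj s t : dec_label s =1 dec_label t ->
  (forall v, dec_label s (s^-1%g v) = dec_label t (t^-1%g v)) -> s = t.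
Proof.
move=> pos lval; apply/permP => p.
have [m] := ubnP (nat_of_ord p); elim: m => // m IHm in p *; rewrite ltnS => lepm.
have step s1 s2 : dec_label s1 =1 dec_label s2 ->
    (forall v, dec_label s1 (s1^-1%g v) = dec_label s2 (s2^-1%g v)) ->
    (forall q, (q < p)%N -> s1 q = s2 q) -> (s1 p <= s2 p)%N.
  move=> pos' val' eqs; set q := (s1^-1)%g (s2 p).
  have sq : s1 q = s2 p by rewrite permKV.
  have lq : dec_label s1 q = dec_label s1 p by rewrite val' permK pos'.
  case: (ltngtP q p) => [qp|pq|/val_inj qp].
  - have := eqs _ qp; rewrite sq => /perm_inj qp'.
    by move: qp; rewrite qp' ltnn.
  - rewrite -sq leqNgt; apply/negP => /(dec_label_lt pq).
    by rewrite lq ltnn.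
  - by rewrite -sq qp.
apply/val_inj/eqP; rewrite eqn_leq !step // => q qp.
- by apply/esym/IHm/(leq_trans qp).
- by apply/IHm/(leq_trans qp).
Qed.

(** Such a permutation is determined by two functions on [n] points, the labels
    of the positions and those of the values, which are at most [d]. *)
Lemma card_no_decreasing d :
  (#|[set s | no_decreasing d s]| <= (d.+1 ^ n) ^ 2)%N.
Proof.
pose F s : {ffun 'I_n -> 'I_d.+1} * {ffun 'I_n -> 'I_d.+1} :=
  ([ffun p => inord (dec_label s p)], [ffun v => inord (dec_label s (s^-1%g v))]).
have lab s p : no_decreasing d s -> (dec_label s p < d.+1)%N.
  move=> /forallP good; rewrite ltnS; apply/bigmax_leqP => A; rewrite inE => /and3P[decA _ _].
  by apply: ltnW; have /implyP := good A; apply.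
rewrite -(@card_in_imset _ _ F).
  apply: leq_trans (max_card _) _.
  by rewrite card_prod !card_ffun !card_ord -mulnn.
move=> s t; rewrite !inE => gs gt [/ffunP E1 /ffunP E2].
apply: dec_label_inj => v.
  by have := E1 v; rewrite !ffunE => /(congr1 val); rewrite /= !inordK ?lab.
by have := E2 v; rewrite !ffunE => /(congr1 val); rewrite /= !inordK ?lab.
Qed.

End GoodPermutations.

Lemma expn_lt_fact c : exists n, (c ^ n < n`!)%N.
Proof.
case: c => [|c]; first by exists 1%N.
pose N := (c.+1 ^ 2)%N; exists (N + N)%N.
have h m : (N.+1 ^ m * N`! <= (N + m)`!)%N.
  elim: m => [|m IHm]; first by rewrite mul1n addn0.
  rewrite addnS factS expnS -mulnA leq_mul // ltnS leq_addr //.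
apply: leq_trans (h N); rewrite addnn -mul2n expnM -/N.
rewrite -[X in (X < _)%N]muln1; apply: leq_trans (leq_mul (leqnn _) (fact_gt0 N)).
by rewrite !muln1 ltn_exp2r // expn_gt0.
Qed.

(** * Straightening of multilinear words *)

Section Words.
Variables (k : fieldType) (B : algType k) (n : nat).
Implicit Types (w : seq 'I_n) (a : 'I_n -> B).

Definition wval a w : B := \prod_(i <- w) a i.

Definition word (s : 'S_n) : seq 'I_n := [seq s i | i <- enum 'I_n].

Fixpoint lexlt (v w : seq 'I_n) := match v, w with
  | i :: v', j :: w' => (i < j)%N || (i == j) && lexlt v' w'
  | _, _ => false
  end.

Lemma lexlt_irr w : lexlt w w = false.
Proof. by elim: w => //= i w ->; rewrite ltnn andbF. Qed.

Lemma lexlt_trans : transitive lexlt.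
Proof.
elim=> [|j v IHv] [|i u] [|l w] //= /orP[ij|/andP[/eqP-> uv]].
  case/orP => [jl|/andP[/eqP<- _]]; first by rewrite (ltn_trans ij jl).
  by rewrite ij.
by case/orP => [->//|/andP[/eqP<- vw]]; rewrite eqxx (IHv u) // orbT.
Qed.

Lemma lexlt_cat2l u v w : lexlt (u ++ v) (u ++ w) = lexlt v w.
Proof. by elim: u => //= i u ->; rewrite ltnn eqxx. Qed.

Lemma size_word s : size (word s) = n.
Proof. by rewrite size_map -cardE card_ord. Qed.

Lemma word_uniq s : uniq (word s).
Proof. by rewrite map_inj_uniq ?enum_uniq //; apply: perm_inj. Qed.

Lemma wordP w : uniq w -> size w = n -> exists s, w = word s.
Proof.
move=> Uw sw; pose f (i : 'I_n) := nth i w i.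
have finj : injective f.
  move=> i j; rewrite /f (set_nth_default j) ?sw // => /eqP.
  by rewrite nth_uniq ?sw // => /eqP/val_inj.
exists (perm finj); case E: w => [|i0 w0].
  by apply/esym/nilP; rewrite /nilp size_word -sw E.
rewrite -E; apply: (@eq_from_nth _ i0) => [|i]; first by rewrite size_word.
rewrite sw => lt_in; rewrite (nth_map (Ordinal lt_in)) -?cardE ?card_ord //.
rewrite permE /f (nth_ord_enum _ (Ordinal lt_in)).
by apply: set_nth_default; rewrite sw.
Qed.

Lemma word_perm_eq s w : perm_eq w (word s) -> exists t, w = word t.
Proof.
move=> pw; apply: wordP; first by rewrite (perm_uniq pw) word_uniq.
by rewrite (perm_size pw) size_word.
Qed.

Lemma wval_cat a v w : wval a (v ++ w) = wval a v * wval a w.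
Proof. by rewrite /wval big_cat. Qed.

Lemma wval_flatten a (ws : seq (seq 'I_n)) :
  wval a (flatten ws) = \prod_(w <- ws) wval a w.
Proof.
elim: ws => [|w ws IHws]; first by rewrite /wval !big_nil.
by rewrite big_cons -IHws -wval_cat.
Qed.

End Words.

Lemma subseq_blocks (T : eqType) (t s : seq T) : subseq t s ->
  exists s0 (r : seq (seq T)), size r = size t /\
    s = s0 ++ flatten [seq x.1 :: x.2 | x <- zip t r].
Proof.
elim: s t => [|y s IHs] [|x t] //=; try by exists [::], [::].
  by move=> _; exists (y :: s), [::]; rewrite /= cats0.
case: eqP => [<-|_] /IHs[s0 [r [sr ->]]]; last first.
  by exists (y :: s0), r.
by exists [::], (s0 :: r); rewrite /= sr.
Qed.

(** Permuting blocks whose first letters decrease makes a word smaller. *)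
Lemma lexlt_flatten n d (h : 'I_d -> 'I_n) (g : 'I_d -> seq 'I_n) (U L : seq 'I_d) :
  (forall i j : 'I_d, (i < j)%N -> (h j < h i)%N) ->
  sorted (relpre val ltn) L -> perm_eq U L -> U != L ->
  lexlt (flatten [seq h i :: g i | i <- U]) (flatten [seq h i :: g i | i <- L]).
Proof.
move=> hdec; elim: L U => [|x L IHL] U.
  by move=> _ /perm_size/size0nil->.
case: U => [|y U]; first by move=> _ /perm_size.
rewrite /= path_sortedE; last by move=> j i l; apply: ltn_trans.
case/andP => ltL sL; have [-> | yx] := eqVneq y x.
  rewrite perm_cons => pU; rewrite eqseq_cons eqxx /= => UL.
  rewrite eqxx ltnn /= lexlt_cat2l; exact: IHL.
move=> /perm_mem /(_ y); rewrite mem_head inE (negPf yx) /= => /esym yL _.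
by rewrite hdec //; apply: (allP ltL).
Qed.

(** Straightening: in an algebra that satisfies a multilinear identity of
    degree [d], a multilinear word with a decreasing subsequence of length [d]
    is a combination of smaller words, because the identity can be applied to
    the blocks that start at the letters of the subsequence. *)
Section Straightening.
Variables (k : fieldType) (B : algType k) (d : nat) (c : 'S_d -> k).
Hypothesis c1 : c 1%g = 1.
Hypothesis ident_B : forall y : 'I_d -> B, \sum_s c s *: \prod_(i < d) y (s i) = 0.
Variable n : nat.

Lemma long_decreasing (s : 'S_n) : ~~ no_decreasing d s ->
  exists2 t : seq 'I_n, subseq t (word s) &
    size t = d /\ sorted (fun x y : 'I_n => y < x)%N t.
Proof.
move/forallPn => [A]; rewrite negb_imply -leqNgt => /andP[/forall_inP decA leA].
have enumA : subseq (enum A) (enum 'I_n).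
  have -> : enum A = [seq i <- enum 'I_n | i \in A].
    by rewrite /enum_mem -filter_predI; apply: eq_filter => i; rewrite /= andbT.
  exact: filter_subseq.
exists (take d [seq s i | i <- enum A]).
  apply: subseq_trans (take_subseq _ _) _.
  exact: map_subseq.
rewrite size_takel ?size_map -?cardE //; split => //.
apply: (subseq_sorted _ (take_subseq _ _)); first by move=> y x z yx zy; apply: ltn_trans zy yx.
rewrite sorted_map; apply: (@sub_in_sorted _ (mem A) (relpre val ltn)).
- move=> x y xA yA; have /forall_inP/(_ y yA)/implyP := decA x xA; exact.
- by apply/allP => x; rewrite mem_enum.
apply: (@subseq_sorted _ _ _ (enum A) (enum 'I_n)); last first.
- by rewrite -sorted_map val_enum_ord iota_ltn_sorted.
- exact: enumA.
by move=> j i l; apply: ltn_trans.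
Qed.

Lemma straighten (s : 'S_n) : exists g : 'S_n -> k,
  (forall t, g t != 0 -> no_decreasing d t) /\
  forall a : 'I_n -> B, wval a (word s) = \sum_t g t *: wval a (word t).
Proof.
(* induction on the number of smaller permutation words *)
have [m] := ubnP #|[set t : 'S_n | lexlt (word t) (word s)]|.
elim: m s => // m IHm s; rewrite ltnS => lem.
have [good|/long_decreasing[u subu [su sortu]]] := boolP (no_decreasing d s).
  exists (fun t => (t == s)%:R); split=> [t|a].
    by have [->|_] := eqVneq t s; rewrite ?eqxx.
  rewrite (bigD1 s) //= eqxx scale1r big1 ?addr0 // => t /negPf->.
  by rewrite scale0r.
(* the word is [s0] followed by [d] blocks that start at the letters of [u] *)
have [s0 [r [sr Ew]]] := subseq_blocks subu.
have [d0|d_gt0] := posnP d.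
  exists (fun=> 0); split=> [t|a]; first by rewrite eqxx.
  rewrite big1 => [|t _]; last by rewrite scale0r.
  have one0 : 1 = 0 :> B.
    rewrite -[RHS](ident_B (fun=> 0)) (big_pred1 1%g) => [|t].
      by rewrite c1 scale1r big1 // => -[i lti]; rewrite d0 in lti.
    by apply/esym/eqP/permP => -[i lti]; exfalso; rewrite d0 in lti.
  by rewrite -[LHS]mul1r one0 mul0r.
have [i0 Eu] : exists i0, exists u', u = i0 :: u'.
  by case: u su {subu sortu Ew sr} => [d0|i u _]; [rewrite -d0 in d_gt0|exists i, u].
pose h (i : 'I_d) := nth i0 u i.
pose g (i : 'I_d) := nth [::] r i.
pose f i := h i :: g i.
have Ezip : [seq x.1 :: x.2 | x <- zip u r] = [seq f i | i <- enum 'I_d].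
  have sz : size (zip u r) = d by rewrite size_zip sr minnn.
  apply: (@eq_from_nth _ [::]) => [|i].
    by rewrite size_map sz size_map size_enum_ord.
  rewrite size_map sz => lti; rewrite (nth_map (i0, [::])) ?sz //.
  rewrite (nth_map (Ordinal lti)) ?size_enum_ord // nth_zip ?sr //=.
  by rewrite (nth_ord_enum _ (Ordinal lti)).
have hdec (i j : 'I_d) : (i < j)%N -> (h j < h i)%N.
  move=> ij; apply: (sorted_ltn_nth _ i0 sortu) => //; rewrite ?inE ?su //.
  by move=> x y z yx zy; apply: ltn_trans zy yx.
pose ws (p : 'S_d) := s0 ++ flatten [seq f i | i <- [seq p i | i <- enum 'I_d]].
have ws1 : word s = ws 1%g.
  by rewrite Ew Ezip /ws (eq_map (g := id)) ?map_id // => i; rewrite perm1.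
have pm (p : 'S_d) : perm_eq [seq p i | i <- enum 'I_d] (enum 'I_d).
  apply: uniq_perm; rewrite ?(map_inj_uniq perm_inj) ?enum_uniq //.
  move=> i; rewrite mem_enum inE -[i](permKV p) map_f //.
  by rewrite mem_enum.
have /choice[tw Etw] : forall p : 'S_d, exists t : 'S_n, ws p = word t.
  move=> p; apply: (@word_perm_eq _ s).
  rewrite Ew Ezip perm_cat2l; apply: perm_flatten; exact: perm_map.
have smaller (p : 'S_d) : p != 1%g -> lexlt (word (tw p)) (word s).
  move=> p1; rewrite -Etw Ew Ezip lexlt_cat2l; apply: lexlt_flatten => //.
    by rewrite -sorted_map val_enum_ord iota_ltn_sorted.
  apply: contraNneq p1 => E; apply/eqP/permP => i; rewrite perm1.
  have := congr1 (fun l => nth i l i) E.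
  rewrite (nth_map i) -?cardE ?card_ord // nth_ord_enum.
  by [].
have /choice[G PG] : forall p : 'S_d, exists g : 'S_n -> k, p != 1%g ->
    (forall t, g t != 0 -> no_decreasing d t) /\
    forall a : 'I_n -> B, wval a (word (tw p)) = \sum_t g t *: wval a (word t).
  move=> p; have [->|p1] := eqVneq p 1%g; first by exists (fun=> 0).
  have [|g' Pg] := IHm (tw p); last by exists g'.
  apply: leq_trans lem; apply: proper_card; apply/properP; split.
    apply/subsetP => t; rewrite !inE => lt; exact: lexlt_trans lt (smaller p p1).
  by exists (tw p); rewrite !inE ?smaller ?lexlt_irr.
exists (fun t => \sum_(p | p != 1%g) - c p * G p t); split=> [t|a].
  apply: contraNT => bad; rewrite big1 // => p p1.
  have [/(_ t) h1 _] := PG p p1; have [->|/h1 good] := eqVneq (G p t) 0.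
    by rewrite mulr0.
  by rewrite good in bad.
have wE p : wval a (ws p) = wval a s0 * \prod_(i < d) wval a (f (p i)).
  by rewrite wval_cat wval_flatten 2!big_map enumT [index_enum _]unlock.
have := ident_B (fun i => wval a (f i)); rewrite (bigD1 1%g) //= c1 scale1r.
move/(congr1 (fun y => wval a s0 * y)); rewrite mulrDr -wE -ws1 mulr0 => /eqP.
rewrite addr_eq0 => /eqP->; rewrite mulr_sumr -sumrN.
under [RHS]eq_bigr do rewrite scaler_suml.
rewrite exchange_big /=; apply: eq_bigr => p p1.
have [_ Ep] := PG p p1.
rewrite -scalerAr -wE Etw Ep scaler_sumr -sumrN.
by apply: eq_bigr => t _; rewrite mulNr scaleNr scalerA.
Qed.

End Straightening.

(** * The multiplication algebra of a PI algebra *)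

Lemma underdetermined (k : fieldType) (I J : finType) (M : I -> J -> k) :
  (#|J| < #|I|)%N ->
  exists a : I -> k, (exists i, a i != 0) /\ forall j, \sum_i a i * M i j = 0.
Proof.
move=> ltJI.
pose A := \matrix_(i < #|I|, j < #|J|) M (enum_val i) (enum_val j).
have : kermx A != 0.
  rewrite -mxrank_eq0 mxrank_ker subn_eq0 -ltnNge.
  exact: leq_ltn_trans (rank_leq_col A) ltJI.
case/rowV0Pn => v vA; case/matrix0Pn => i0 [j0]; rewrite (ord1 i0) => v0.
exists (fun i => v 0 (enum_rank i)); split.
  by exists (enum_val j0); rewrite enum_valK.
move=> j; have /sub_kermxP/matrixP/(_ 0 (enum_rank j)) := vA.
rewrite !mxE => E; rewrite -[RHS]E (reindex (@enum_val I I)) /=; last first.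
  by apply: onW_bij; exists enum_rank; [exact: enum_valK|exact: enum_rankK].
by apply: eq_bigr => i _; rewrite !mxE !enum_rankK enum_valK.
Qed.

Section Multiplications.
Variables (k : fieldType) (B : algType k) (d : nat) (c : 'S_d -> k).
Hypothesis c1 : c 1%g = 1.
Hypothesis ident_B : forall y : 'I_d -> B, \sum_s c s *: \prod_(i < d) y (s i) = 0.

(** Both [B] and its opposite have fewer than [C ^ n] independent multilinear
    words of length [n], so products of the [n] multiplications
    [x |-> a_i x b_i] are dependent as soon as [n`!] exceeds [C ^ n * C ^ n]. *)
Lemma multiplications_dependent : exists n (al : 'S_n -> k) (s0 : 'S_n),
  al s0 != 0 /\ forall (a b : 'I_n -> B) x,
    \sum_s al s *: (wval a (word s) * x * wval b (rev (word s))) = 0.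
Proof.
have [n ltn] := expn_lt_fact (d.+1 ^ 4).
have /choice[g Pg] := straighten c1 ident_B (n := n).
have /choice[r Er] : forall s : 'S_n, exists t : 'S_n, rev (word s) = word t.
  by move=> s; apply: (@word_perm_eq _ s); rewrite perm_rev.
pose G := [set s : 'S_n | no_decreasing d s].
pose M (s : 'S_n) (ij : 'I_#|G| * 'I_#|G|) :=
  g s (enum_val ij.1) * g (r s) (enum_val ij.2).
have [|al [[s0 al0] alM]] := @underdetermined k _ _ M.
  rewrite card_prod card_ord card_Sn; apply: leq_ltn_trans ltn.
  apply: leq_trans (leq_mul (card_no_decreasing _ _) (card_no_decreasing _ _)) _.
  by rewrite mulnn -!expnM mulnC.
exists n, al, s0; split=> // a b x.
have gE (h : 'I_n -> B) s :
    wval h (word s) = \sum_(i < #|G|) g s (enum_val i) *: wval h (word (enum_val i)).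
  have [good ->] := Pg s; rewrite (bigID (mem G)) /= [X in _ + X]big1 ?addr0.
    by rewrite (big_enum_val (fun t => g s t *: wval h (word t))).
  move=> t; rewrite inE; have [->|/good ->//] := eqVneq (g s t) 0.
  by rewrite scale0r.
under eq_bigr => s _.
  rewrite Er (gE a) (gE b) !mulr_suml.
  under eq_bigr => i _.
    rewrite mulr_sumr; under eq_bigr => j _ do
      rewrite -scalerAr -!scalerAl scalerA (mulrC (g (r s) _)).
    over.
  rewrite pair_big scaler_sumr; over.
rewrite exchange_big big1 // => -[i j] _ /=.
under eq_bigr do rewrite scalerA.
by rewrite -scaler_suml (alM (i, j)) scale0r.
Qed.

Definition compose n (X : 'I_n -> B -> B) (w : seq 'I_n) (x : B) :=
  foldr (fun i y => X i y) x w.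

Section Slots.
Variables (n : nat).
Implicit Types (s : 'I_n -> seq (B * B)) (w : seq 'I_n).

Let upd s i t := fun j : 'I_n => if j == i then t else s j.

Let comp s w x := compose (fun i => eop (s i)) w x.

Lemma eq_compose (X Y : 'I_n -> B -> B) w x :
  (forall i, i \in w -> X i =1 Y i) -> compose X w x = compose Y w x.
Proof.
elim: w => //= i w IHw XY; rewrite XY ?mem_head // IHw // => j jw.
by apply: XY; rewrite inE jw orbT.
Qed.

Let comp_upd_notin s i t w x : i \notin w -> comp (upd s i t) w x = comp s w x.
Proof.
move=> iw; apply: eq_compose => j jw y; rewrite /upd.
by case: eqP jw iw => // -> ->.
Qed.

Let comp_slot s i p t w x : uniq w -> i \in w ->
  comp (upd s i (p :: t)) w x = comp (upd s i [:: p]) w x + comp (upd s i t) w x.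
Proof.
elim: w => [|j w IHw] /=; first by rewrite in_nil.
case/andP => jw Uw; rewrite inE => /orP[/eqP ij|iw].
  move: jw; rewrite -ij => iw; rewrite /comp /= -!/(comp _ _ _) !comp_upd_notin //.
  by rewrite /upd eqxx /eop !big_cons big_nil addr0.
have ji : j != i by apply: contraNneq jw => ->.
rewrite /comp /= -!/(comp _ _ _) IHw // /upd (negPf ji) eopD.
by [].
Qed.

Let comp_slot0 s i w x : i \in w -> comp (upd s i [::]) w x = 0.
Proof.
elim: w => [|j w IHw]; first by rewrite in_nil.
rewrite inE => /orP[/eqP<-|iw].
  by rewrite /comp /= /upd eqxx /eop big_nil.
by rewrite /comp /= -/(comp _ _ _) IHw // eop0.
Qed.

(** The dependence passes from multiplications to elementary operators, which
    are sums of multiplications: both sides are additive in each operator. *)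
Lemma compose_dependent (al : 'S_n -> k) :
  (forall (a b : 'I_n -> B) x,
     \sum_s al s *: (wval a (word s) * x * wval b (rev (word s))) = 0) ->
  forall (X : 'I_n -> B -> B) x, (forall i, elementary (X i)) ->
    \sum_s al s *: compose X (word s) x = 0.
Proof.
move=> h X x /choice[s Es].
under eq_bigr => t _ do rewrite (eq_compose _ (fun i _ => Es i)).
have mem_word i (t : 'S_n) : i \in word t.
  by rewrite -[i](permKV t) map_f // mem_enum.
suff gen (r : seq 'I_n) : forall s, (forall i, i \notin r -> size (s i) = 1%N) ->
    \sum_t al t *: comp s (word t) x = 0.
  by apply: (gen (enum 'I_n)) => i; rewrite mem_enum.
elim: r => [|i0 r IHr] {Es}s sz.
  pose a i := (nth (0, 0) (s i) 0).1; pose b i := (nth (0, 0) (s i) 0).2.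
  rewrite -[RHS](h a b x); apply: eq_bigr => t _; congr (_ *: _).
  elim: (word t) => [|i w IHw]; first by rewrite /wval !big_nil mul1r mulr1.
  rewrite /comp /= -/(comp s w x) IHw rev_cons -cats1 wval_cat /wval big_cons.
  rewrite big_seq1 /a /b; case: (s i) (sz i isT) => [|p []] //= _.
  by rewrite /eop big_seq1 !mulrA.
suff slot l : \sum_t al t *: comp (upd s i0 l) (word t) x = 0.
  rewrite -[RHS](slot (s i0)); apply: eq_bigr => t _; congr (_ *: _).
  by apply: eq_compose => i _ y; rewrite /upd; case: eqP => [->|].
elim: l => [|p l IHl].
  by rewrite big1 // => t _; rewrite comp_slot0 ?scaler0.
under eq_bigr do rewrite comp_slot ?word_uniq // scalerDr.
rewrite big_split IHl /= addr0; apply: IHr => i ir; rewrite /upd.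
by case: eqP => // /eqP ii0; apply: sz; rewrite inE negb_or ii0.
Qed.

End Slots.

Hypothesis prime_B : forall x y : B, (forall r, x * r * y = 0) -> x = 0 \/ y = 0.

(** If no finite family spanned [B], the density of ideals would give vectors
    [w_0, w_1, ...] and elementary operators [X_i] that send [w_i] to [w_(i+1)]
    and kill the earlier [w_j]. Among the products of [X_0, ..., X_(n-1)], only
    the one in increasing order does not kill [w_0], which contradicts the
    dependence. *)
Lemma PI_finite_rank : exists n (b : 'I_n -> B), forall x, in_closure b [set: 'I_n] x.
Proof.
have [n [al [s0 [al0 /compose_dependent dep]]]] := multiplications_dependent.
apply: contrapT => infinite.
pose killed (W : seq B) x := forall Q, elementary Q -> (forall w, w \in W -> Q w = 0) -> Q x = 0.
have infiniteW W : exists x, ~ killed W x.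
  apply/existsNP => full; apply: infinite.
  exists (size W), (tnth (in_tuple W)) => x Q eQ QW; apply: full => // w wW.
  by have [i ->] := seq_tnthP (wW : w \in in_tuple W); apply: QW; rewrite inE.
have step W w : ~ killed W w -> exists X, [/\ elementary X,
    forall v, v \in W -> X v = 0 & ~ killed (w :: W) (X w)].
  move=> Ww; apply: contrapT => /forallNP h.
  have [x /existsNP[Q /not_implyP[eQ /not_implyP[QW]]]] := infiniteW (w :: W).
  have [s Es] := eQ; rewrite Es; apply.
  move: Ww => /existsNP[P /not_implyP[eP /not_implyP[PW Pw]]].
  (* otherwise every operator that kills [w :: W] would kill [x] *)
  pose J y := exists P', [/\ elementary P', forall v, v \in W -> P' v = 0 & P' w = y].
  have idJ : is_ideal_of J.
    split; first by exists (fun=> 0); split=> //; apply: elementary_zero.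
    split=> [y z [Y [eY YW <-]] [Z [eZ ZW <-]]|y z t [Z [eZ ZW <-]]].
      exists (fun v => Y v + Z v); split=> [|v vW|//].
        exact: elementary_add.
      by rewrite YW // ZW // addr0.
    exists (fun v => y * Z v * t); split=> [|v vW|//].
      by apply: elementary_mulr; apply: elementary_mull.
    by rewrite ZW // mulr0 mul0r.
  apply: (eop_vanish_ideal prime_B idJ (j := P w)) => [|//|y [P' [eP' P'W <-]]].
    by exists P.
  have /not_and3P := h P'.
  rewrite -Es; case=> [//|/(_ P'W)//|/contrapT]; apply=> //.
have chain m : exists (w : nat -> B) (X : nat -> B -> B), [/\
    forall i, elementary (X i), forall i, (i < m)%N -> X i (w i) = w i.+1,
    forall i j, (j < i < m)%N -> X i (w j) = 0 &
    ~ killed [seq w i | i <- iota 0 m] (w m)].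
  elim: m => [|m [w [X [eX Xw Xkill wm]]]].
    have [x x0] := infiniteW [::].
    exists (fun=> x), (fun=> id); split => // [i|i j]; first exact: elementary_id.
    by rewrite ltn0 andbF.
  have [Y [eY Ykill Yw]] := step _ _ wm.
  exists (fun i => if i == m.+1 then Y (w m) else w i), (fun i => if i == m then Y else X i).
  split => [i|i|i j|].
  - by case: eqP.
  - rewrite ltnS leq_eqVlt => /orP[/eqP->|im]; first by rewrite !eqxx (ltn_eqF (ltnSn _)).
    by rewrite eqSS (ltn_eqF im) ltn_eqF ?Xw // ltnS ltnW.
  - case/andP => ji; rewrite ltnS leq_eqVlt => /orP[/eqP im|im].
      rewrite im eqxx ltn_eqF; last by rewrite ltnS -im ltnW.
      by apply: Ykill; rewrite map_f // mem_iota -im.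
    rewrite (ltn_eqF im) ltn_eqF ?Xkill ?ji //.
    exact: ltn_trans ji (leqW im).
  - rewrite eqxx => wm'; apply: Yw => Q eQ Qw; apply: wm' => // v /mapP[i].
    rewrite mem_iota add0n ltnS => /andP[_ im] ->; rewrite ltn_eqF //.
    apply: Qw; move: im; rewrite leq_eqVlt inE => /orP[/eqP->|im].
      by rewrite eqxx.
    by apply/orP; right; rewrite map_f // mem_iota.
have [w [X [eX Xw Xkill wn]]] := chain n.
have run l : uniq l -> forall m, all (fun i => m <= i < n)%N l ->
    foldl (fun y i => X i y) (w m) l = if l == iota m (size l) then w (m + size l)%N else 0.
  elim: l => [|i l IHl] /=; first by move=> _ m _; rewrite addn0.
  case/andP => il Ul m /andP[/andP[mi lin] /allP ml]; rewrite eqseq_cons.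
  have X0 l' : foldl (fun y i => X i y) 0 l' = 0.
    by elim: l' => //= j l' {2}<-; rewrite elementary_at0.
  have [im|im] := eqVneq i m; last by rewrite Xkill ?lin ?ltn_neqAle ?mi 1?eq_sym ?im.
  rewrite /= im Xw -?im // IHl //; first by rewrite addSnnS im.
  apply/allP => j jl; have /andP[mj ->] := ml j jl; rewrite ltn_neqAle im mj.
  by rewrite !andbT; apply: contraNneq il => mj'; rewrite im mj'.
(* the renumbering that puts the term of [s0] in increasing order *)
pose h (v : 'I_n) := (n.-1 - (s0^-1)%g v)%N.
have hinj : injective h.
  move=> u v /(congr1 (fun i => n.-1 - i)%N); rewrite /h.
  have lt (i : 'I_n) : (i <= n.-1)%N.
    by rewrite -ltnS prednK // (leq_ltn_trans (leq0n i) (ltn_ord i)).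
  by rewrite !subKn ?lt // => /val_inj/perm_inj.
have hn v : (h v < n)%N.
  have n0 : (0 < n)%N := leq_ltn_trans (leq0n v) (ltn_ord v).
  by rewrite -[X in (_ < X)%N](prednK n0) ltnS leq_subr.
pose F (s : 'S_n) := [seq h v | v <- rev (word s)].
have UF s : uniq (F s) by rewrite map_inj_uniq // rev_uniq word_uniq.
have sF s : size (F s) = n by rewrite size_map size_rev size_word.
have FE s : compose (fun v => X (h v)) (word s) (w 0%N) = if F s == iota 0 n then w n else 0.
  have := run (F s) (UF s) 0%N; rewrite sF add0n => <-; last first.
    by apply/allP => i /mapP[v _ ->]; rewrite hn.
  rewrite /F /compose -[in LHS](revK (word s)).
  elim: (rev (word s)) (w 0%N) => //= v l IHl y.
  by rewrite rev_cons foldr_rcons IHl.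
have F0 : F s0 = iota 0 n.
  apply: (@eq_from_nth _ 0%N); first by rewrite sF size_iota.
  rewrite sF => i lti; have i0 := Ordinal lti.
  rewrite (nth_map i0) ?size_rev ?size_word // nth_rev ?size_word // nth_iota // add0n.
  have lt' : (n - i.+1 < n)%N by rewrite ltn_subrL (leq_ltn_trans _ lti).
  rewrite /word (nth_map i0) ?size_enum_ord // /h permK nth_enum_ord //.
  by rewrite -[in n.-1](subnKC lti) addSn /= addnK.
have := dep (fun v => X (h v)) (w 0%N) (fun v => eX _).
rewrite (bigD1 s0) //= big1 => [|s ss0].
  rewrite addr0 FE F0 eqxx => /eqP; rewrite scaler_eq0 (negPf al0) => /eqP wn0.
  by apply: wn => Q eQ _; rewrite wn0 elementary_at0.
rewrite FE -F0; case: eqP => [Fs|]; last by rewrite scaler0.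
have /(congr1 rev) := inj_map hinj Fs; rewrite !revK => /eq_in_map E.
case/eqP: ss0; apply/permP => i; apply: E; exact: mem_enum.
Qed.
End Multiplications.

(** * Bases of quaternionic extensions *)

Section Subspaces.
Variables (k : fieldType) (B : algType k).
Implicit Types (U D : B -> Prop).

Definition subspace U :=
  [/\ U 0, forall x y, U x -> U y -> U (x + y) & forall c x, U x -> U (c *: x)].

Lemma subspace0 U : subspace U -> U 0. Proof. by case. Qed.

Lemma subspaceD U x y : subspace U -> U x -> U y -> U (x + y).
Proof. by case=> _ h _; apply: h. Qed.

Lemma subspaceZ U c x : subspace U -> U x -> U (c *: x).
Proof. by case=> _ _; apply. Qed.

Lemma subspaceN U x : subspace U -> U x -> U (- x).
Proof. by move=> sU Ux; rewrite -scaleN1r; apply: subspaceZ. Qed.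

Lemma subspaceB U x y : subspace U -> U x -> U y -> U (x - y).
Proof. by move=> sU Ux Uy; apply: subspaceD => //; apply: subspaceN. Qed.

Lemma subspace_sum U (I : Type) (r : seq I) (P : pred I) (F : I -> B) :
  subspace U -> (forall i, P i -> U (F i)) -> U (\sum_(i <- r | P i) F i).
Proof.
move=> sU UF; elim/big_ind: _ => //; first exact: subspace0.
by move=> x y; apply: subspaceD.
Qed.

Definition is_scalar (x : B) := exists c : k, x = c%:A.

Definition subalgebra D := [/\ subspace D, D 1 & forall x y, D x -> D y -> D (x * y)].

Definition basis_of D n := exists b : 'I_n -> B, (forall i, D (b i)) /\
  forall x, D x -> exists! c : 'rV[k]_n, x = \sum_i c 0 i *: b i.

Lemma subspace_scalar : subspace is_scalar.
Proof.
split=> [|x y [c ->] [e ->]|c x [e ->]]; first by exists 0; rewrite scale0r.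
  by exists (c + e); rewrite scalerDl.
by exists (c * e); rewrite scalerA.
Qed.

Lemma scalar_comm x y : is_scalar x -> x * y = y * x.
Proof. by case=> c ->; rewrite mulr_algl mulr_algr. Qed.

Lemma scalar_inj (c e : k) : c%:A = e%:A :> B -> c = e.
Proof.
move=> /eqP; rewrite -subr_eq0 -scalerBl scaler_eq0 oner_eq0 orbF subr_eq0.
by move=> /eqP.
Qed.

Lemma scalar_basis D : D 1 -> (forall x, D x -> is_scalar x) -> basis_of D 1.
Proof.
move=> D1 Dk; exists (fun=> 1); split=> // x /Dk[c ->].
exists c%:M; split=> [|c']; first by rewrite big_ord1 mxE eqxx mulr1n.
by rewrite big_ord1 => /scalar_inj->; apply/rowP => i; rewrite !ord1 mxE.
Qed.

Hypothesis two_neq0 : 2%:R != 0 :> k.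

Lemma double_eq0 (x : B) : x + x = 0 -> x = 0.
Proof.
rewrite -mulr2n -scaler_nat => /eqP; rewrite scaler_eq0 (negPf two_neq0) /=.
by move/eqP.
Qed.

Lemma halfK (x : B) : 2%:R^-1 *: x + 2%:R^-1 *: x = x.
Proof. by rewrite -scalerDr -mulr2n -scaler_nat scalerA mulVf ?scale1r. Qed.

(** If [g] and [h] anticommute, conjugation by [g] splits [x] into a part that
    commutes with [g] and one that anticommutes with [g]; multiplication by [h]
    exchanges the two kinds. *)
Section Doubling.
Variables (D : B -> Prop) (g h : B) (al be : k).
Hypotheses (sD : subspace D) (Dg : forall x, D x -> D (g * x * g)).
Hypotheses (Dh : forall x, D x -> D (x * h)).
Hypotheses (al0 : al != 0) (be0 : be != 0).
Hypotheses (gg : g * g = al%:A) (hh : h * h = be%:A) (gh : g * h = - (h * g)).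

Definition commuting_part x := 2%:R^-1 *: (x + al^-1 *: (g * x * g)).

Let ggr x : g * x * g * g = al *: (g * x).
Proof. by rewrite -mulrA gg mulr_algr. Qed.

Let ggl x : g * (g * x * g) = al *: (x * g).
Proof. by rewrite !mulrA gg mulr_algl -scalerAl. Qed.

Lemma commuting_partC x : commuting_part x * g = g * commuting_part x.
Proof.
rewrite /commuting_part -scalerAl -scalerAr; congr (_ *: _).
rewrite mulrDl mulrDr -scalerAl -scalerAr ggr ggl !scalerA mulVf // !scale1r.
by rewrite addrC.
Qed.

Lemma anticommuting_partN x :
  (x - commuting_part x) * g = - (g * (x - commuting_part x)).
Proof.
have -> : x - commuting_part x = 2%:R^-1 *: (x - al^-1 *: (g * x * g)).
  rewrite /commuting_part -{1}[x]halfK scalerDr scalerBr opprD addrA.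
  by rewrite addrK.
rewrite -scalerAl -scalerAr -[RHS]scalerN; congr (_ *: _).
rewrite mulrBl mulrBr opprB -scalerAl -scalerAr ggr ggl !scalerA mulVf //.
by rewrite !scale1r.
Qed.

Lemma parts_eq0 p q : p * g = g * p -> q * g = - (g * q) -> p + q = 0 ->
  p = 0 /\ q = 0.
Proof.
move=> pg qg pq.
have p0 : p = 0.
  have : p * g + p * g = 0.
    have : (p + q) * g + g * (p + q) = 0 by rewrite pq mul0r mulr0 addr0.
    by rewrite mulrDl mulrDr qg pg addrACA addNr addr0.
  move=> /double_eq0 /(congr1 ( *%R^~ g)); rewrite mul0r -mulrA gg mulr_algr.
  by move/eqP; rewrite scaler_eq0 (negPf al0) => /eqP.
by split=> //; rewrite p0 add0r in pq.
Qed.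

Lemma doubling_dec x : D x -> exists p q,
  [/\ D p /\ p * g = g * p, D q /\ q * g = g * q & x = p + q * h].
Proof.
move=> Dx; pose p := commuting_part x; pose q := x - p.
have Dp : D p by apply: subspaceZ => //; apply: subspaceD => //;
  apply: subspaceZ => //; apply: Dg.
exists p, (be^-1 *: (q * h)); split.
- by split=> //; apply: commuting_partC.
- split; first by apply: subspaceZ => //; apply: Dh; apply: subspaceB.
  rewrite -scalerAl -scalerAr; congr (_ *: _).
  have qg : q * g = - (g * q) := anticommuting_partN x.
  have hg : h * g = - (g * h) by rewrite gh opprK.
  by rewrite -mulrA hg mulrN !mulrA qg mulNr opprK.
by rewrite -scalerAl -mulrA hh mulr_algr scalerA mulVf // scale1r /q addrC subrK.
Qed.

Lemma doubling_basis m : basis_of (fun x => D x /\ x * g = g * x) m ->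
  basis_of D (m + m).
Proof.
case=> b [Db bP].
pose b2 (i : 'I_(m + m)) := match split i with inl j => b j | inr j => b j * h end.
have sumE (c : 'rV[k]_(m + m)) : \sum_i c 0 i *: b2 i =
    \sum_i lsubmx c 0 i *: b i + (\sum_i rsubmx c 0 i *: b i) * h.
  rewrite big_split_ord /= mulr_suml; congr (_ + _); apply: eq_bigr => i _.
    by rewrite /b2 (unsplitK (inl i)) mxE.
  by rewrite /b2 (unsplitK (inr i)) mxE scalerAl.
have combC (c : 'rV[k]_m) : (\sum_i c 0 i *: b i) * g = g * \sum_i c 0 i *: b i.
  rewrite mulr_suml mulr_sumr; apply: eq_bigr => i _.
  by rewrite -scalerAl -scalerAr; have [_ ->] := Db i.
have anti y : y * g = g * y -> y * h * g = - (g * (y * h)).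
  by move=> yg; rewrite [g * (y * h)]mulrA -yg -!mulrA gh mulrN opprK.
exists b2; split=> [i|x Dx].
  by rewrite /b2; case: (split i) => j; have [Dj _] := Db j => //; apply: Dh.
have [p [q [Dp Dq xE]]] := doubling_dec Dx.
have [c [Ec uc]] := bP p Dp; have [e [Ee ue]] := bP q Dq.
exists (row_mx c e); split=> [|c']; first by rewrite sumE row_mxKl row_mxKr -Ec -Ee.
rewrite sumE => Ex; pose p' := \sum_i lsubmx c' 0 i *: b i.
pose q' := \sum_i rsubmx c' 0 i *: b i.
have [] := @parts_eq0 (p - p') ((q - q') * h).
- by rewrite mulrBl mulrBr combC; case: Dp => _ ->.
- by apply: anti; rewrite mulrBl mulrBr combC; case: Dq => _ ->.
- by rewrite mulrBl addrACA -opprD -xE Ex subrr.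
move=> /eqP; rewrite subr_eq0 => /eqP pp.
move/(congr1 ( *%R^~ h)); rewrite mul0r -mulrA hh mulr_algr => /eqP.
rewrite scaler_eq0 (negPf be0) subr_eq0 => /eqP qq.
by rewrite -[c']hsubmxK; congr row_mx; [apply: uc|apply: ue].
Qed.

End Doubling.

Section Quaternions.
Variables (D : B -> Prop) (i j : B) (al be : k).
Hypotheses (algD : subalgebra D) (Di : D i) (Dj : D j).
Hypotheses (al0 : al != 0) (be0 : be != 0).
Hypotheses (ii : i * i = al%:A) (jj : j * j = be%:A) (ij : i * j = - (j * i)).

Let Dxi x := D x /\ x * i = i * x.

Let sD : subspace D. Proof. by case: algD. Qed.
Let DM x y : D x -> D y -> D (x * y). Proof. by case: algD => _ _; apply. Qed.
Let ji : j * i = - (i * j). Proof. by rewrite ij opprK. Qed.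

Let subspace_Dxi : subspace Dxi.
Proof.
case: sD => D0 DD DZ; split=> [|x y [Dx xi] [Dy yi]|c x [Dx xi]].
- by split; rewrite ?mul0r ?mulr0.
- by split; [exact: DD|rewrite mulrDl mulrDr xi yi].
- by split; [exact: DZ|rewrite -scalerAl -scalerAr xi].
Qed.

Let Dxi_j x : Dxi x -> Dxi (j * x * j).
Proof.
move=> [Dx xi]; split; first by apply: DM => //; apply: DM.
rewrite -[LHS]mulrA ji mulrN [j * x * (i * j)]mulrA -[j * x * i]mulrA xi.
by rewrite !mulrA ji !mulNr opprK.
Qed.

Let Dxi_i x : Dxi x -> Dxi (x * i).
Proof. by move=> [Dx xi]; split; [exact: DM|rewrite [i * _]mulrA xi]. Qed.

Let D_i x : D x -> D (i * x * i).
Proof. by move=> Dx; apply: DM => //; apply: DM. Qed.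

Let D_j x : D x -> D (x * j). Proof. by move=> Dx; apply: DM. Qed.

Lemma quaternion_dec x : D x -> exists c : 'I_4 -> B,
  (forall n, [/\ D (c n), c n * i = i * c n & c n * j = j * c n]) /\
  x = c 0 + c 1 * i + (c 2 + c 3 * i) * j.
Proof.
move=> Dx; have [p [q [Dp Dq ->]]] := doubling_dec sD D_i D_j al0 be0 ii jj ij Dx.
have [a [b [[[Da ai] aj] [[Db bi] bj] ->]]] :=
  doubling_dec subspace_Dxi Dxi_j Dxi_i be0 al0 jj ii ji Dp.
have [c [d [[[Dc ci] cj] [[Dd di] dj] ->]]] :=
  doubling_dec subspace_Dxi Dxi_j Dxi_i be0 al0 jj ii ji Dq.
exists (fun n => nth 0 [:: a; b; c; d] n); split=> //.
by case=> -[|[|[|[|]]]].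
Qed.

(** Doubling twice: [D] over the commutant of [i], with [j] exchanging the two
    parts, and this commutant over that of [j], with [i] exchanging them. *)
Lemma quaternion_basis m :
  basis_of (fun x => [/\ D x, x * i = i * x & x * j = j * x]) m ->
  basis_of D (m + m + (m + m)).
Proof.
case=> b [Db bP]; apply: (doubling_basis sD D_i D_j al0 be0 ii jj ij).
apply: (doubling_basis subspace_Dxi Dxi_j Dxi_i be0 al0 jj ii ji).
exists b; split=> [n|x [[Dx xi] xj]]; first by have [] := Db n.
by apply: bP.
Qed.

End Quaternions.
End Subspaces.

(** * Involutions of central simple algebras *)

(** Simplicity is expressed with elementary operators: 1 lies in the ideal
    generated by any nonzero element. *)
Record central_simple_involution (k : fieldType) (B : algType k) (star : B -> B) :
    Prop := CentralSimpleInvolution {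
  csi_char0 : forall n, n.+1%:R != 0 :> k;
  csi_starD : forall x y, star (x + y) = star x + star y;
  csi_starM : forall x y, star (x * y) = star y * star x;
  csi_starK : forall x, star (star x) = x;
  csi_starZ : forall (c : k) x, star (c *: x) = c *: star x;
  csi_center : forall z : B, (forall x, z * x = x * z) -> is_scalar z;
  csi_simple : forall w : B, w <> 0 -> exists2 P, elementary P & P w = 1
}.

Section Involution.
Variables (k : fieldType) (B : algType k) (star : B -> B).
Hypothesis csi : central_simple_involution star.

Let char0 n : n.+1%:R != 0 :> k. Proof. exact: csi_char0 csi n. Qed.
Let starD x y : star (x + y) = star x + star y. Proof. exact: csi_starD csi x y. Qed.
Let starM x y : star (x * y) = star y * star x. Proof. exact: csi_starM csi x y. Qed.
Let starK x : star (star x) = x. Proof. exact: csi_starK csi x. Qed.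
Let starZ (c : k) x : star (c *: x) = c *: star x. Proof. exact: csi_starZ csi c x. Qed.
Let center_B (z : B) : (forall x, z * x = x * z) -> is_scalar z.
Proof. exact: csi_center csi z. Qed.
Let simple_B (w : B) : w <> 0 -> exists2 P, elementary P & P w = 1.
Proof. exact: csi_simple csi w. Qed.

Implicit Types (x y : B) (D V W : B -> Prop).

Definition sym x := star x = x.
Definition skew x := star x = - x.

Let two0 : 2%:R != 0 :> k. Proof. exact: char0 1. Qed.

Lemma char0B n x : x *+ n.+1 = 0 -> x = 0.
Proof.
by move/eqP; rewrite -scaler_nat scaler_eq0 (negPf (char0 n)) => /eqP.
Qed.

Lemma star0 : star 0 = 0.
Proof. by rewrite -(scale0r 0) starZ !scale0r. Qed.

Lemma starN x : star (- x) = - star x.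
Proof. by rewrite -scaleN1r starZ scaleN1r. Qed.

Lemma starB x y : star (x - y) = star x - star y.
Proof. by rewrite starD starN. Qed.

Lemma star1 : star 1 = 1.
Proof. by rewrite -[star 1]mul1r -{1}[1]starK -starM mul1r starK. Qed.

Lemma scalar_sym x : is_scalar x -> sym x.
Proof. by case=> c ->; rewrite /sym starZ star1. Qed.

Lemma sym_skew_eq0 x : sym x -> skew x -> x = 0.
Proof.
rewrite /sym /skew => -> /eqP; rewrite -addr_eq0 => /eqP.
exact: double_eq0 two0 _.
Qed.

Lemma subspace_sym : subspace sym.
Proof.
split=> [|x y sx sy|c x sx]; rewrite /sym.
- by rewrite star0.
- by rewrite starD sx sy.
- by rewrite starZ sx.
Qed.

Lemma subspace_skew : subspace skew.
Proof.
split=> [|x y sx sy|c x sx]; rewrite /skew.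
- by rewrite star0 oppr0.
- by rewrite starD sx sy opprD.
- by rewrite starZ sx scalerN.
Qed.

Lemma skew_comm x y : skew x -> skew y -> skew (x * y - y * x).
Proof. by rewrite /skew starB !starM => -> ->; ncring. Qed.

Lemma sym_skew_comm x y : sym x -> skew y -> sym (x * y - y * x).
Proof. by rewrite /sym /skew starB !starM => -> ->; ncring. Qed.

Lemma sym_comm x y : sym x -> sym y -> skew (x * y - y * x).
Proof. by rewrite /sym /skew starB !starM => -> ->; ncring. Qed.

Lemma sym_skew_jordan x y : sym x -> skew y -> skew (x * y + y * x).
Proof. by rewrite /sym /skew starD !starM => -> ->; ncring. Qed.

Lemma skew_jordan x y : skew x -> skew y -> sym (x * y + y * x).
Proof. by rewrite /sym /skew starD !starM => -> ->; ncring. Qed.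

Lemma sym_part x : sym (x + star x).
Proof. by rewrite /sym starD starK addrC. Qed.

Lemma skew_part x : skew (x - star x).
Proof. by rewrite /skew starB starK opprB. Qed.

Lemma sym_skew_dec x : exists s l, [/\ sym s, skew l, x = s + l,
  s = 2%:R^-1 *: (x + star x) & l = 2%:R^-1 *: (x - star x)].
Proof.
exists (2%:R^-1 *: (x + star x)), (2%:R^-1 *: (x - star x)); split => //.
- by apply: subspaceZ subspace_sym (sym_part _).
- by apply: subspaceZ subspace_skew (skew_part _).
by rewrite -scalerDr addrACA addrN addr0 scalerDr halfK.
Qed.

Lemma simple_prime x y : (forall r, x * r * y = 0) -> x = 0 \/ y = 0.
Proof.
move=> xy; have [->|/eqP x0] := eqVneq x 0; [by left|right].
have [P [s Es] Px] := simple_B x0; rewrite -[y]mul1r -Px Es /eop mulr_suml.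
by rewrite big1 // => p _; rewrite -!mulrA (mulrA x) xy mulr0.
Qed.

Lemma ideal_full V w x : subspace V -> (forall a y c, V y -> V (a * y * c)) ->
  V w -> w <> 0 -> V x.
Proof.
move=> sV idV Vw w0; have [P [s Es] Pw] := simple_B w0.
rewrite -[x]mul1r -Pw Es /eop mulr_suml; apply: subspace_sum => // p _.
by rewrite -(mulrA _ p.2); apply: idV.
Qed.

Lemma not_comm_neq0 x y : x * y <> y * x -> x * y - y * x <> 0.
Proof. by move=> xy /eqP; rewrite subr_eq0 => /eqP. Qed.

(** An inner derivation [d] with [d^2 = 0] is zero: [0 = d^2(xy) = 2 d(x) d(y)],
    and replacing [x] by [x z] gives [d(x) B d(y) = 0]. *)
Lemma inner_square_zero a :
  (forall x, a * (a * x - x * a) - (a * x - x * a) * a = 0) -> is_scalar a.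
Proof.
move=> d2; apply: center_B => x; pose d x := a * x - x * a.
have dd y z : d y * d z = 0.
  apply: (double_eq0 two0).
  transitivity ((a * d (y * z) - d (y * z) * a) - (a * d y - d y * a) * z
                - y * (a * d z - d z * a)); last by rewrite !d2; ncring.
  by rewrite /d; ncring.
have [|/eqP|/eqP] := @simple_prime (d x) (d x); last 2 first.
- by rewrite subr_eq0 => /eqP.
- by rewrite subr_eq0 => /eqP.
move=> r; transitivity (d x * d (r * x) - d x * d r * x).
  by rewrite /d; ncring.
by rewrite !dd mul0r subrr.
Qed.

(** For skew [x] and [y] in [D] the symmetric element [x y + y x] is a scalar, so
    the skew elements of [D] form a quadratic space. Orthogonalization gives
    anticommuting [i] and [j] with nonzero squares, unless this space has
    dimension at most 1. A skew element that commutes with [i] is a multiple of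
    [i], so only the scalars commute with both [i] and [j]. *)
Section QuadraticSubalgebra.
Variable D : B -> Prop.
Hypothesis algD : subalgebra D.
Hypothesis starD' : forall x, D x -> D (star x).
Hypothesis symD : forall x, D x -> sym x -> is_scalar x.
Hypothesis semiprimeD :
  forall x, D x -> skew x -> (forall y, D y -> x * y * x = 0) -> x = 0.

Let sD : subspace D. Proof. by case: algD. Qed.
Let DM x y : D x -> D y -> D (x * y). Proof. by case: algD => _ _; apply. Qed.

Let jordanD x y : D x -> D y -> skew x -> skew y ->
  exists c : k, x * y + y * x = c%:A.
Proof.
move=> Dx Dy sx sy; apply: symD; last exact: skew_jordan.
by apply: subspaceD => //; apply: DM.
Qed.

Let squareD x : D x -> skew x -> exists c : k, x * x = c%:A.
Proof. by move=> Dx sx; apply: symD; [exact: DM|rewrite /sym starM sx; ncring]. Qed.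

Let decD x : D x -> exists (c : k) l, [/\ D l, skew l & x = c%:A + l].
Proof.
move=> Dx; have [s [l [ss sl Ex Es El]]] := sym_skew_dec x.
have Ds : D s.
  by rewrite Es; apply: subspaceZ => //; apply: subspaceD => //; apply: starD'.
have Dl : D l.
  by rewrite El; apply: subspaceZ => //; apply: subspaceB => //; apply: starD'.
have [c Ec] := symD Ds ss.
by exists c, l; rewrite -Ec.
Qed.

Let orthogonal i al x : D i -> skew i -> i * i = al%:A -> al != 0 -> D x -> skew x ->
  exists b : k, i * (x - b *: i) = - ((x - b *: i) * i).
Proof.
move=> Di si ii al0 Dx sx; have [c Ec] := jordanD Dx Di sx si.
exists (c / (al + al)); apply/eqP; rewrite -addr_eq0 mulrBr mulrBl addrACA.
rewrite [i * x + _]addrC Ec -opprD -scalerAl -scalerAr ii -scalerDr -scalerDl.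
rewrite scalerA divfK ?subrr // -mulr2n -mulr_natr mulf_neq0 //.
Qed.

Let nilpotentD x : D x -> skew x -> x * x = 0 ->
  (forall y, D y -> skew y -> x * y + y * x = 0) -> x = 0.
Proof.
move=> Dx sx xx xy; apply: semiprimeD => // _ /decD[c [l [Dl sl ->]]].
rewrite mulrDr mulrDl mulr_algr -scalerAl xx scaler0 add0r.
transitivity (x * (x * l + l * x) - x * x * l); first by ncring.
by rewrite xy // xx mulr0 mul0r subr0.
Qed.

Lemma quadratic_subalgebra :
  [\/ forall x, D x -> is_scalar x,
      exists i, [/\ D i, ~ is_scalar i
        & forall x, D x -> exists a b : k, x = a%:A + b *: i]
    | exists i j (al be : k), [/\ D i /\ D j, al != 0 /\ be != 0,
        i * i = al%:A /\ j * j = be%:A, i * j = - (j * i) /\ skew i /\ skew j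
        & forall x, [/\ D x, x * i = i * x & x * j = j * x] -> is_scalar x]].
Proof.
have [noskew|] := pselect (forall x, D x -> skew x -> x = 0).
  apply: Or31 => _ /decD[c [l [Dl sl ->]]].
  by exists c; rewrite (noskew l) // addr0.
move=> /existsNP[x0 /not_implyP[Dx0 /not_implyP[sx0 x00]]].
have [i [al [Di si ii al0]]] : exists i (al : k), [/\ D i, skew i, i * i = al%:A & al != 0].
  apply: contrapT => noi; apply: x00.
  have sq x : D x -> skew x -> x * x = 0.
    move=> Dx sx; have [c Ec] := squareD Dx sx; have [c0|c0] := eqVneq c 0.
      by rewrite Ec c0 scale0r.
    by case: noi; exists x, c.
  apply: nilpotentD => //; first exact: sq.
  move=> y Dy sy; transitivity ((x0 + y) * (x0 + y) - x0 * x0 - y * y); first by ncring.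
  rewrite !sq ?subr0 //; first exact: subspaceD.
  exact: subspaceD subspace_skew sx0 sy.
have i0 : i <> 0.
  by move=> i0; move: ii al0; rewrite i0 mul0r -(scale0r 1) => /scalar_inj <-; rewrite eqxx.
have commi l : D l -> skew l -> l * i = i * l -> exists b : k, l = b *: i.
  move=> Dl sl li; have [b Eb] := orthogonal Di si ii al0 Dl sl; exists b.
  have Cb : i * (l - b *: i) = (l - b *: i) * i.
    by rewrite mulrBr mulrBl li -scalerAl -scalerAr.
  have : al *: (l - b *: i) = 0.
    rewrite -mulr_algl -ii -mulrA; apply: (double_eq0 two0).
    by rewrite {2}Eb -Cb mulrN subrr.
  by move/eqP; rewrite scaler_eq0 (negPf al0) subr_eq0 => /eqP.
have [alli|] := pselect (forall l, D l -> skew l -> l * i = i * l).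
  apply: Or32; exists i; split=> //.
    by move=> /scalar_sym symi; apply: i0; apply: sym_skew_eq0.
  move=> _ /decD[c [l [Dl sl ->]]]; have [b ->] := commi l Dl sl (alli l Dl sl).
  by exists c, b.
move=> /existsNP[l /not_implyP[Dl /not_implyP[sl li]]].
have ortho x : D x -> skew x -> exists (b : k) y,
    [/\ D y, skew y, i * y = - (y * i) & y = x - b *: i].
  move=> Dx sx; have [b Eb] := orthogonal Di si ii al0 Dx sx.
  exists b, (x - b *: i); split=> //.
    by apply: subspaceB => //; apply: subspaceZ.
  by apply: subspaceB subspace_skew sx _; apply: subspaceZ subspace_skew si.
have [b [j0 [Dj0 sj0 ij0 Ej0]]] := ortho l Dl sl.
have j00 : j0 <> 0.
  move: Ej0 => /[swap] -> /esym/eqP; rewrite subr_eq0 => /eqP E; apply: li.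
  by rewrite E -scalerAl -scalerAr.
(* if [j0] is isotropic, a vector that is not orthogonal to it is added *)
have [j [be [Dj sj ij jj be0]]] : exists j (be : k),
    [/\ D j, skew j, i * j = - (j * i), j * j = be%:A & be != 0].
  have [be0 Ebe0] := squareD Dj0 sj0; have [be00|be00] := eqVneq be0 0; last first.
    by exists j0, be0.
  have [m [Dm sm mj]] : exists m, [/\ D m, skew m & j0 * m + m * j0 <> 0].
    apply: contrapT => h; apply: j00; apply: nilpotentD => //.
      by rewrite Ebe0 be00 scale0r.
    by move=> y Dy sy; apply: contrapT => h'; apply: h; exists y.
  have [b' [m' [Dm' sm' im' Dfm']]] := ortho m Dm sm.
  have Em' : j0 * m' + m' * j0 = j0 * m + m * j0.
    rewrite Dfm' mulrBr mulrBl -scalerAl -scalerAr ij0 scalerN.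
    by rewrite opprK addrACA addNr addr0.
  have [z Ez] := jordanD Dj0 Dm' sj0 sm'; have [ga Ega] := squareD Dm' sm'.
  have z0 : z != 0 by apply/eqP => z0; apply: mj; rewrite -Em' Ez z0 scale0r.
  have [zg|zg] := eqVneq (z + ga) 0; last first.
    exists (j0 + m'), (z + ga); split=> //.
    - exact: subspaceD.
    - exact: subspaceD subspace_skew sj0 sm'.
    - by rewrite mulrDr ij0 im'; ncring.
    - transitivity (j0 * j0 + (j0 * m' + m' * j0) + m' * m'); first by ncring.
      by rewrite Ebe0 be00 scale0r add0r Ez Ega -scalerDl.
  exists (j0 - m'), (ga - z); split=> //.
  - exact: subspaceB.
  - exact: subspaceB subspace_skew sj0 sm'.
  - by rewrite mulrBr ij0 im'; ncring.
  - transitivity (j0 * j0 - (j0 * m' + m' * j0) + m' * m'); first by ncring.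
    by rewrite Ebe0 be00 scale0r add0r Ez Ega addrC -scalerBl.
  move/eqP: zg; rewrite addrC addr_eq0 => /eqP->.
  by rewrite -opprD oppr_eq0 -mulr2n -mulr_natr mulf_neq0.
apply: Or33; exists i, j, al, be; split=> // x [Dx xi xj].
have [c [m [Dm sm Ex]]] := decD Dx.
have mi : m * i = i * m.
  apply: (addrI (c%:A * i)); rewrite -mulrDl -Ex xi Ex mulrDr.
  by rewrite [c%:A * i]scalar_comm //; exists c.
have mj : m * j = j * m.
  apply: (addrI (c%:A * j)); rewrite -mulrDl -Ex xj Ex mulrDr.
  by rewrite [c%:A * j]scalar_comm //; exists c.
have [b' Em] := commi m Dm sm mi; exists c.
suff b'0 : b' = 0 by rewrite Ex Em b'0 scale0r addr0.
have E : b' *: (i * j) = 0.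
  apply: (double_eq0 two0); have := mj; rewrite Em -scalerAl -scalerAr => {2}->.
  by rewrite ij scalerN addNr.
have : i * (b' *: (i * j)) * j = 0 by rewrite E mulr0 mul0r.
rewrite -scalerAr -scalerAl mulrA ii -mulrA jj mulr_algl !scalerA.
by move/eqP; rewrite scaler_eq0 oner_eq0 orbF !mulf_eq0 (negPf al0) (negPf be0)
   !orbF => /eqP.
Qed.
End QuadraticSubalgebra.
End Involution.

(** * Involutions in dimensions 1 and 4 *)

Section LowDimension.
Variables (k : fieldType) (B : algType k) (star : B -> B).
Hypothesis csi : central_simple_involution star.

Let char0 n : n.+1%:R != 0 :> k. Proof. exact: csi_char0 csi n. Qed.
Let starM x y : star (x * y) = star y * star x. Proof. exact: csi_starM csi x y. Qed.
Let center_B (z : B) : (forall x, z * x = x * z) -> is_scalar z.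
Proof. exact: csi_center csi z. Qed.
Let two0 : 2%:R != 0 :> k. Proof. exact: char0 1. Qed.

Local Notation sym := (sym star).
Local Notation skew := (skew star).
Implicit Types (x y : B) (D V W : B -> Prop).

Let sS : subspace sym := subspace_sym csi.

Definition everything (x : B) := True.

Lemma subalgebra_everything : subalgebra everything.
Proof. by []. Qed.

Lemma conjugate_commute (i j : B) (be : k) : j * j = be%:A -> be != 0 ->
  i * j = - (j * i) -> forall b : k, (b *: i) * j = j * (b *: i) -> b *: i = 0.
Proof.
move=> jj be0 ij b; rewrite -scalerAl -scalerAr ij scalerN => E.
have : b *: (j * i) = 0 by apply: (double_eq0 two0); rewrite -{1}E addNr.
move/(congr1 ( *%R j)); rewrite -scalerAr mulrA jj mulr_algl mulr0 scalerA mulrC -scalerA => /eqP.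
by rewrite scaler_eq0 (negPf be0) => /eqP.
Qed.

Lemma square_zero_skew x : skew x -> (forall l, skew l -> x * l = 0) -> x = 0.
Proof.
move=> sx xl.
have xx : x * x = 0 by apply: xl.
have [||] // := @simple_prime _ _ _ csi x x.
move=> r; have [s [l [ss sl -> _ _]]] := sym_skew_dec csi r.
rewrite mulrDr (xl l) // addr0.
transitivity (x * (s * x + x * s) - x * x * s); first by ncring.
by rewrite xx mul0r subr0 xl ?mul0r //; apply: (sym_skew_jordan csi).
Qed.

(** If they are not all zero, the skew elements are then the multiples of a single
    [i]; the symmetric elements that commute with [i] are scalars, and some
    symmetric element that anticommutes with [i] completes a quaternion basis.
    The orthogonal involution of 2 by 2 matrices is an example. *)
Lemma skew_products_scalar : (forall x y, skew x -> skew y -> is_scalar (x * y)) ->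
  basis_of everything 1 \/ basis_of everything 4.
Proof.
move=> KK; have [noskew|] := pselect (forall x, skew x -> x = 0).
  left; apply: scalar_basis => // x _.
  have allsym y : star y = y.
    by apply/esym/eqP; rewrite -subr_eq0; apply/eqP/noskew/(skew_part csi).
  by apply: center_B => y; rewrite -[RHS]allsym starM !allsym.
move=> /existsNP[x0 /not_implyP[sx0 x00]]; right.
have [i [al [si ii al0]]] : exists i (al : k), [/\ skew i, i * i = al%:A & al != 0].
  apply: contrapT => noi; apply: (x00); apply: square_zero_skew => // l sl.
  have x0x0 : x0 * x0 = 0.
    have [c Ec] := KK _ _ sx0 sx0; have [c0|c0] := eqVneq c 0.
      by rewrite Ec c0 scale0r.
    by case: noi; exists x0, c.
  have [c Ec] := KK _ _ sx0 sl; rewrite Ec; have [->|c0] := eqVneq c 0.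
    by rewrite scale0r.
  have : x0 * (x0 * l) = 0 by rewrite mulrA x0x0 mul0r.
  rewrite Ec mulr_algr => /eqP; rewrite scaler_eq0 (negPf c0) /= => /eqP x0'.
  by case: x00.
have Ki l : skew l -> exists b : k, l = b *: i.
  move=> sl; have [c Ec] := KK _ _ sl si; exists (c / al).
  have : l * i * i = c *: i by rewrite Ec mulr_algl.
  rewrite -mulrA ii mulr_algr => E.
  by apply: (scalerI al0); rewrite E scalerA mulrC divfK.
have i0 : i <> 0.
  by move=> i0; move: ii al0; rewrite i0 mul0r -(scale0r 1) => /scalar_inj <-; rewrite eqxx.
have symC s : sym s -> s * i = i * s -> is_scalar s.
  move=> ss sics; have [|b Eb] := Ki (s * i).
    by rewrite /skew starM ss si mulNr sics.
  exists b; apply: (scalerI al0).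
  by rewrite -mulr_algr -ii mulrA Eb -scalerAl ii scalerA mulrC -scalerA.
have [j0 [sj0 ij0 j00]] : exists j, [/\ sym j, i * j = - (j * i) & j <> 0].
  apply: contrapT => noj.
  have : is_scalar i.
    apply: center_B => r; have [s [l [ss sl -> _ _]]] := sym_skew_dec csi r.
    have [b ->] := Ki l sl; rewrite mulrDr mulrDl -scalerAl -scalerAr; congr (_ + _).
    apply/esym/eqP; rewrite -subr_eq0; apply/eqP; apply: contrapT => si0; apply: noj.
    exists (s * i - i * s); split=> //. exact: (sym_skew_comm csi ss si).
    transitivity (- ((s * i - i * s) * i) + (s * (i * i) - (i * i) * s)); first by ncring.
    by rewrite ii mulr_algl mulr_algr subrr addr0.
  by move=> /(scalar_sym csi) symi; apply: i0; apply: (sym_skew_eq0 csi symi).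
have sqj j : sym j -> i * j = - (j * i) -> is_scalar (j * j).
  move=> sj ij; have [|b Eb] := Ki (j * (i * j) - (i * j) * j).
    apply: (sym_comm csi) => //; rewrite /sym starM sj si mulrN -ij.
    by [].
  have E : (i * (j * j)) + i * (j * j) = (- b) *: i.
    rewrite scaleNr -Eb; transitivity (i * j * j + (i * j) * j); first by ncring.
    by rewrite {2}ij; ncring.
  have E2 : (2%:R * al) *: (j * j) = (- b * al) *: 1.
    have := congr1 ( *%R i) E.
    by rewrite mulrDr mulrA ii mulr_algl -scalerAr ii scalerA -mulr2n -scaler_nat scalerA.
  have nz : 2%:R * al != 0 by rewrite mulf_neq0.
  exists ((2%:R * al)^-1 * (- b * al)); apply: (scalerI nz).
  by rewrite E2 scalerA mulrA divff // mul1r.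
have [j [be [sj ij jj be0]]] : exists j (be : k),
    [/\ sym j, i * j = - (j * i), j * j = be%:A & be != 0].
  apply: contrapT => noj.
  have sq0 j : sym j -> i * j = - (j * i) -> j * j = 0.
    move=> sj ij; have [be Ebe] := sqj j sj ij; rewrite Ebe.
    have [->|be0] := eqVneq be 0; first by rewrite scale0r.
    by case: noj; exists j, be.
  apply: j00; have [||] // := @simple_prime _ _ _ csi j0 j0.
  move=> r; have [s [l [ss sl -> _ _]]] := sym_skew_dec csi r.
  have [b ->] := Ki l sl; have j0j0 := sq0 _ sj0 ij0.
  pose p := commuting_part i al s.
  have sp : sym p.
    apply: (subspaceZ _ sS); apply: (subspaceD sS ss); apply: (subspaceZ _ sS).
    by rewrite /sym !starM ss si; ncring.
  have [c Ec] := symC p sp (commuting_partC al0 ii s).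
  have sq : sym (s - p) by apply: subspaceB.
  have iq : i * (s - p) = - ((s - p) * i).
    by rewrite (anticommuting_partN two0 al0 ii) opprK.
  have jq : j0 * (s - p) + (s - p) * j0 = 0.
    transitivity ((j0 + (s - p)) * (j0 + (s - p)) - j0 * j0 - (s - p) * (s - p)).
      by ncring.
    rewrite !sq0 ?subr0 //; first exact: subspaceD.
    by rewrite mulrDr mulrDl ij0 iq opprD.
  have Es : s = c%:A + (s - p) by rewrite -Ec addrC subrK.
  rewrite {}Es; move: (s - p) jq {sq iq} => q jq.
  have -> : j0 * (c%:A + q + b *: i) * j0 =
      c *: (j0 * j0) + j0 * q * j0 + b *: (j0 * (i * j0)).
    by rewrite !mulrDr !mulrDl mulr_algr -!scalerAr -!scalerAl !mulrA.
  have -> : j0 * q * j0 = (j0 * q + q * j0) * j0 - q * (j0 * j0) by ncring.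
  rewrite jq ij0 mulrN [j0 * (j0 * i)]mulrA j0j0 !mul0r oppr0 !scaler0 mulr0.
  by rewrite subr0 !addr0.
apply: (quaternion_basis (m := 1) two0 subalgebra_everything I I al0 be0 ii jj ij).
apply: scalar_basis => [|x [_ xi xj]]; first by rewrite !mul1r !mulr1.
have [s [l [ss sl Ex _ _]]] := sym_skew_dec csi x; have [b Eb] := Ki l sl.
have [c Ec] : is_scalar s.
  apply: symC => //; have -> : s = x - l by rewrite Ex addrK.
  by rewrite mulrBr mulrBl xi Eb -scalerAl -scalerAr.
exists c; rewrite Ex Ec Eb (conjugate_commute jj be0 ij) ?addr0 // -Eb.
have -> : l = x - s by rewrite Ex addrC addKr.
by rewrite mulrBr mulrBl xj Ec mulr_algl mulr_algr.
Qed.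

(** [B] is then quadratic over the scalars, as for the symplectic involution of
    2 by 2 matrices. *)
Lemma sym_scalar_low : (forall x, sym x -> is_scalar x) ->
  basis_of everything 1 \/ basis_of everything 4.
Proof.
move=> symZ; have [|||allZ|[i [_ iZ iE]]|] := quadratic_subalgebra csi subalgebra_everything.
- by [].
- by move=> x _; apply: symZ.
- move=> x _ _ h; have [|//|//] := @simple_prime _ _ _ csi x x.
  by move=> r; apply: h.
- by left; apply: scalar_basis.
- case: iZ; apply: center_B => y; have [a [b ->]] := iE y I.
  by rewrite mulrDr mulrDl mulr_algl mulr_algr -scalerAl -scalerAr.
move=> [i [j [al [be [_ [al0 be0] [ii jj] [ij _] h]]]]]; right.
apply: (quaternion_basis (m := 1) two0 subalgebra_everything I I al0 be0 ii jj ij).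
by apply: scalar_basis => //; rewrite !mul1r !mulr1.
Qed.
End LowDimension.

(** * Subalgebras normalized by the skew elements *)

Inductive generated (k : fieldType) (B : algType k) (X : B -> Prop) : B -> Prop :=
| generated_in x : X x -> generated X x
| generated_1 : generated X 1
| generatedD x y : generated X x -> generated X y -> generated X (x + y)
| generatedZ c x : generated X x -> generated X (c *: x)
| generatedM x y : generated X x -> generated X y -> generated X (x * y).

(** Membership in the right ideal generated by [s], in a form suited to the
    elimination of one generator at a time. *)
Fixpoint right_span (B : nzRingType) (s : seq B) (x : B) : Prop :=
  if s is a :: s' then exists b y, right_span s' y /\ x = a * b + y else x = 0.

Section NormalizedSubalgebras.
Variables (k : fieldType) (B : algType k) (star : B -> B).
Hypothesis csi : central_simple_involution star.

Let char0 n : n.+1%:R != 0 :> k. Proof. exact: csi_char0 csi n. Qed.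
Let starM x y : star (x * y) = star y * star x. Proof. exact: csi_starM csi x y. Qed.
Let center_B (z : B) : (forall x, z * x = x * z) -> is_scalar z.
Proof. exact: csi_center csi z. Qed.
Let two0 : 2%:R != 0 :> k. Proof. exact: char0 1. Qed.

Local Notation sym := (sym star).
Local Notation skew := (skew star).
Implicit Types (x y : B) (D V W : B -> Prop).

Let sS : subspace sym := subspace_sym csi.

Hypothesis not_low :
  ~ (basis_of (@everything _ B) 1 \/ basis_of (@everything _ B) 4).

Lemma subalgebra_generated X : subalgebra (generated X : B -> Prop).
Proof.
split; last exact: generatedM; last exact: generated_1.
split; [|exact: generatedD|exact: generatedZ].
by rewrite -(scale0r 1); apply/generatedZ/generated_1.
Qed.

(** The span of the products of two skew elements is a Lie ideal of [B]:
    [[s, l m] = (s l + l s) m - l (s m + m s)] for symmetric [s]. The subalgebra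
    that it generates thus contains the ideal generated by its commutators, and
    this ideal is not 0 as otherwise all [l m] would be scalars. *)
Lemma skew_generates x : generated skew x.
Proof.
pose KK z := exists l m, [/\ skew l, skew m & z = l * m].
pose V := generated KK.
have algV := subalgebra_generated KK; have [sV V1 VM] := algV.
have VB z b : V z -> V (z * b - b * z).
  elim=> {z} [z [l [m [sl sm ->]]]||z t Vz Iz Vt It|c z Vz Iz|z t Vz Iz Vt It].
  - have [s [n [ss sn -> _ _]]] := sym_skew_dec csi b.
    have VKK p q : skew p -> skew q -> V (p * q).
      by move=> sp sq; apply: generated_in; exists p, q.
    have -> : l * m * (s + n) - (s + n) * (l * m) = l * (s * m + m * s)
        - (s * l + l * s) * m + ((l * n - n * l) * m + l * (m * n - n * m)).
      by ncring.
    apply: subspaceD => //; [apply: subspaceB => //|apply: subspaceD => //];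
      apply: VKK => //.
    + exact: (sym_skew_jordan csi).
    + exact: (sym_skew_jordan csi).
    + exact: (skew_comm csi).
    + exact: (skew_comm csi).
  - by rewrite mul1r mulr1 subrr; apply: subspace0.
  - by rewrite mulrDl mulrDr opprD addrACA; apply: subspaceD.
  - by rewrite -scalerAl -scalerAr -scalerBr; apply: subspaceZ.
  - have -> : z * t * b - b * (z * t) = z * (t * b - b * t) + (z * b - b * z) * t.
      by ncring.
    by apply: subspaceD => //; apply: VM.
have VK z : V z -> generated skew z.
  elim=> {z} [z [l [m [sl sm ->]]]||z t _ Iz _ It|c z _ Iz|z t _ Iz _ It].
  - by apply: generatedM; apply: generated_in.
  - exact: generated_1.
  - exact: generatedD.
  - exact: generatedZ.
  - exact: generatedM.
apply: VK; have [comm|] := pselect (forall y z, V y -> V z -> y * z = z * y).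
  case: not_low; apply: (skew_products_scalar csi) => l m sl sm.
  have Vlm : V (l * m) by apply: generated_in; exists l, m.
  apply: (inner_square_zero csi) => b.
  by rewrite (comm _ _ Vlm (VB _ b Vlm)) subrr.
move=> /existsNP[y /existsNP[z /not_implyP[Vy /not_implyP[Vz yz]]]].
have VC b c d : V (b * ((y * z - z * y) * c) * d).
  have VCr b' : V ((y * z - z * y) * b').
    have -> : (y * z - z * y) * b' = y * (z * b') - (z * b') * y - z * (y * b' - b' * y).
      by ncring.
    by apply: subspaceB; [|exact: VB|apply: VM => //; exact: VB].
  have -> : b * ((y * z - z * y) * c) * d = (y * z - z * y) * (c * d * b)
      - ((y * z - z * y) * (c * d) * b - b * ((y * z - z * y) * (c * d))) by ncring.
  by apply: subspaceB; [|exact: VCr|apply: VB; exact: VCr].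
suff : forall b d, V (b * x * d) by move/(_ 1 1); rewrite mul1r mulr1.
apply: (@ideal_full _ _ _ csi (fun x => forall b d, V (b * x * d)) (y * z - z * y)).
- split=> [b d|u v Vu Vv b d|c u Vu b d].
  + by rewrite mulr0 mul0r; apply: subspace0.
  + by rewrite mulrDr mulrDl; apply: subspaceD.
  + by rewrite -scalerAr -scalerAl; apply: subspaceZ.
- move=> a u c Vu b d; have := Vu (b * a) (c * d); by rewrite !mulrA.
- by move=> b d; rewrite -[y * z - z * y]mulr1.
- exact: not_comm_neq0.
Qed.

Lemma skew_ind V : subspace V -> V 1 ->
  (forall l x, skew l -> V x -> V (l * x)) -> forall x, V x.
Proof.
move=> sV V1 VK x; rewrite -[x]mulr1; move: (1 : B) V1.
elim: (skew_generates x) => {x} [l sl||x z _ Ix _ Iz|c x _ Ix|x z _ Ix _ Iz] y Vy.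
- exact: VK.
- by rewrite mul1r.
- by rewrite mulrDl; apply: subspaceD; [|exact: Ix|exact: Iz].
- by rewrite -scalerAl; apply: subspaceZ => //; apply: Ix.
- by rewrite -mulrA; apply/Ix/Iz.
Qed.

Lemma commute_skew x : (forall l, skew l -> x * l = l * x) -> is_scalar x.
Proof.
move=> xl; apply: center_B; apply: skew_ind => [|| l y sl xy].
- split=> [|y z xy xz|c y xy]; first by rewrite mulr0 mul0r.
    by rewrite mulrDr mulrDl xy xz.
  by rewrite -scalerAl -scalerAr xy.
- by rewrite mulr1 mul1r.
- by rewrite mulrA xl // -mulrA xy mulrA.
Qed.

Lemma right_span_cat (s1 s2 : seq B) x y :
  right_span s1 x -> right_span s2 y -> right_span (s1 ++ s2) (x + y).
Proof.
elim: s1 x => [|a s1 IHs1] x /=; first by move=> ->; rewrite add0r.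
by move=> [b [z [sz ->]]] sy; exists b, (z + y); rewrite addrA; split=> //; apply: IHs1.
Qed.

Lemma right_spanD (s : seq B) x y :
  right_span s x -> right_span s y -> right_span s (x + y).
Proof.
elim: s x y => [|a s IHs] x y /=; first by move=> -> ->; rewrite addr0.
move=> [b [x' [sx ->]]] [c [y' [sy ->]]]; exists (b + c), (x' + y').
by split; [exact: IHs|rewrite mulrDr addrACA].
Qed.

Lemma right_spanM (s : seq B) x y : right_span s x -> right_span s (x * y).
Proof.
elim: s x => [|a s IHs] x /=; first by move=> ->; rewrite mul0r.
move=> [b [x' [sx ->]]]; exists (b * y), (x' * y).
by split; [exact: IHs|rewrite mulrDl mulrA].
Qed.

(** If [I B] is stable under left multiplication by skew elements then it is a
    two-sided ideal, so it contains 1. *)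
Lemma right_span_one (I : B -> Prop) w : I w -> w <> 0 ->
  (forall a l, I a -> skew l -> exists s : seq B, (forall a, a \in s -> I a) /\ right_span s (l * a)) ->
  exists s : seq B, (forall a, a \in s -> I a) /\ right_span s 1.
Proof.
move=> Iw w0 Il.
pose V x := exists s : seq B, (forall a, a \in s -> I a) /\ right_span s x.
have VD x y : V x -> V y -> V (x + y).
  move=> [s [sI sx]] [t [tI ty]]; exists (s ++ t); split; last exact: right_span_cat.
  by move=> a; rewrite mem_cat => /orP[/sI|/tI].
have V0 : V 0 by exists [::].
have VM x y : V x -> V (x * y).
  by move=> [s [sI sx]]; exists s; split=> //; apply: right_spanM.
have sV : subspace V.
  by split=> // c x Vx; rewrite -mulr_algr; apply: VM.
have VK l x : skew l -> V x -> V (l * x).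
  move=> sl [s [sI sx]]; elim: s x sI sx => [|a s IHs] x sI /=.
    by move=> ->; rewrite mulr0.
  move=> [b [y [sy ->]]]; rewrite mulrDr mulrA; apply: VD.
    by apply/VM/Il => //; apply: sI; rewrite mem_head.
  by apply: IHs => // c cs; apply: sI; rewrite inE cs orbT.
have VB x y : V y -> V (x * y).
  move=> Vy; move: x; apply: skew_ind.
  - split=> [|x z Vx Vz|c x Vx]; first by rewrite mul0r.
      by rewrite mulrDl; apply: VD.
    by rewrite -scalerAl; apply: subspaceZ.
  - by rewrite mul1r.
  - by move=> l x sl Vx; rewrite -mulrA; apply: VK.
apply: (@ideal_full _ _ _ csi V w) => //.
- by move=> a y c Vy; apply/VM/VB.
- by exists [:: w]; split=> [a|]; [rewrite inE => /eqP->|exists 1, 0; rewrite mulr1 addr0].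
Qed.

(** Multiplying [1 = a b + y] by [a] twice expresses [a^2], and then [a], by the
    other generators, because [a^3 = 0]; so all generators can be eliminated. *)
Lemma nilpotent_right_span (s : seq B) :
  (forall a b, a \in s -> b \in s -> exists c, a * b = b * c) ->
  (forall a, a \in s -> a * a * a = 0) -> right_span s 1 -> False.
Proof.
elim: s => [|a s IHs] /= comm cube.
  by move/eqP; rewrite (negPf (@oner_neq0 B)).
move=> [b [y [sy E]]].
have sa x : right_span s x -> right_span s (a * x).
  have : forall b, b \in s -> exists c, a * b = b * c.
    by move=> c cs; apply: comm; rewrite inE ?eqxx ?cs ?orbT.
  elim: (s) x => [|c t IHt] x h /=; first by move=> ->; rewrite mulr0.
  move=> [d [z [tz ->]]]; have [e Ee] := h c (mem_head _ _).
  exists (e * d), (a * z); split; last by rewrite mulrDr !mulrA Ee.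
  by apply: IHt => // g gt; apply: h; rewrite inE gt orbT.
have s2 : right_span s (a * a).
  have -> : a * a = a * a * a * b + a * (a * y).
    by rewrite -[LHS]mulr1 E mulrDr !mulrA.
  by rewrite cube ?mem_head // mul0r add0r; apply/sa/sa.
have s1 : right_span s a.
  have -> : a = a * a * b + a * y by rewrite -[LHS]mulr1 E mulrDr !mulrA.
  by apply: right_spanD; [exact: right_spanM|exact: sa].
apply: IHs.
- by move=> c d cs ds; apply: comm; rewrite inE ?cs ?ds orbT.
- by move=> c cs; apply: cube; rewrite inE cs orbT.
by rewrite E; apply: right_spanD => //; apply: right_spanM.
Qed.

Section InvariantSubalgebra.
Variable W : B -> Prop.
Hypothesis algW : subalgebra W.
Hypothesis WK : forall x l, W x -> skew l -> W (x * l - l * x).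
Variables (I : finType) (v : I -> B) (lam : I -> B -> k).
Hypothesis coordinates : forall x, x = \sum_i lam i x *: v i.

Let sW : subspace W. Proof. by case: algW. Qed.
Let WM x y : W x -> W y -> W (x * y). Proof. by case: algW => _ _; apply. Qed.

Let WKl x l : W x -> skew l -> W (l * x - x * l).
Proof. by move=> Wx sl; rewrite -opprB; apply: subspaceN => //; apply: WK. Qed.

(** The ideal [Q] of [W] generated by the [[s, v]] satisfies [Q K < W], since
    [2 [s, v] l] is a combination of commutators that lie in [W]. *)
Inductive comm_ideal : B -> Prop :=
| comm_ideal_in x s y z : W x -> W s -> sym s -> W y -> W z ->
    comm_ideal (x * (s * y - y * s) * z)
| comm_ideal0 : comm_ideal 0
| comm_idealD x y : comm_ideal x -> comm_ideal y -> comm_ideal (x + y).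

Let comm_idealMr x y : W y -> comm_ideal x -> comm_ideal (x * y).
Proof.
move=> Wy; elim=> {x} [x s t z Wx Ws ss Wt Wz||x z _ Ix _ Iz].
- by rewrite -(mulrA _ z y); apply: comm_ideal_in => //; apply: WM.
- by rewrite mul0r; apply: comm_ideal0.
- by rewrite mulrDl; apply: comm_idealD.
Qed.

Let comm_idealK x l : comm_ideal x -> skew l -> comm_ideal (l * x - x * l).
Proof.
move=> Qx sl; elim: Qx => {x} [x s y z Wx Ws ss Wy Wz||x y _ Ix _ Iy].
- have -> : l * (x * (s * y - y * s) * z) - x * (s * y - y * s) * z * l =
      ((l * x - x * l) * (s * y - y * s) * z
       + x * ((l * s - s * l) * y - y * (l * s - s * l)) * z)
      + (x * (s * (l * y - y * l) - (l * y - y * l) * s) * z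
         + x * (s * y - y * s) * (l * z - z * l)) by ncring.
  have sls : sym (l * s - s * l).
    by rewrite -opprB; apply: (subspaceN sS); apply: (sym_skew_comm csi).
  by apply: comm_idealD; apply: comm_idealD; apply: comm_ideal_in => //;
    exact: WKl.
- by rewrite mulr0 mul0r subrr; apply: comm_ideal0.
- by rewrite mulrDr mulrDl opprD addrACA; apply: comm_idealD.
Qed.

Let comm_ideal_skew x l : comm_ideal x -> skew l -> W (x * l).
Proof.
move=> Qx sl; elim: Qx => {x} [x s y z Wx Ws ss Wy Wz||x y _ Ix _ Iy].
- have W1 : W ((s * y - y * s) * l).
    pose m := s * l + l * s.
    have sm : skew m := sym_skew_jordan csi ss sl.
    have E : (s * y - y * s) * l + (s * y - y * s) * l =
        (m * y - y * m) - s * (l * y - y * l) - (l * y - y * l) * s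
        - (l * (s * y - y * s) - (s * y - y * s) * l) by rewrite /m; ncring.
    rewrite -[_ * l](halfK two0) -scalerDr E; apply: subspaceZ => //.
    have Wsy : W (s * y - y * s) by apply: subspaceB => //; apply: WM.
    have Wly := WKl Wy sl.
    apply: (subspaceB sW); last exact: WKl.
    apply: (subspaceB sW); last exact: WM.
    by apply: (subspaceB sW); [exact: WKl|exact: WM].
  have -> : x * (s * y - y * s) * z * l = x * (s * y - y * s) * (z * l - l * z)
      + x * ((s * y - y * s) * l) * z by ncring.
  apply: subspaceD => //; apply: WM => //; [|exact: WK|exact: WM].
  by apply: WM => //; apply: subspaceB => //; apply: WM.
- by rewrite mul0r; apply: subspace0.
- by rewrite mulrDl; apply: subspaceD.
Qed.

(** [depth n b] says that [Q ^ n * b] lies in [W]. *)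
Fixpoint depth n b : Prop :=
  if n is n'.+1 then forall q, comm_ideal q -> depth n' (q * b) else W b.

Let subspace_depth n : subspace (depth n).
Proof.
elim: n => [|n [D0 DD DZ]] //=; split=> [q Qq|x y Dx Dy q Qq|c x Dx q Qq].
- by rewrite mulr0.
- by rewrite mulrDr; apply: DD; [exact: Dx|exact: Dy].
- by rewrite -scalerAr; apply/DZ/Dx.
Qed.

Let depthM n w b : W w -> depth n b -> depth n (w * b).
Proof.
elim: n w b => [|n IHn] w b Ww /= Db; first exact: WM.
by move=> q Qq; rewrite mulrA; apply: Db; apply: comm_idealMr.
Qed.

Let comm_idealW q : comm_ideal q -> W q.
Proof.
elim=> [x s y z Wx Ws ss Wy Wz||x y _ Ix _ Iy].
- by apply: WM => //; apply: WM => //; apply: subspaceB => //; apply: WM.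
- exact: subspace0.
- exact: subspaceD.
Qed.

Let depthS n b : depth n b -> depth n.+1 b.
Proof. by move=> Db q /comm_idealW Wq; apply: depthM. Qed.

Let depth_leq n m b : (n <= m)%N -> depth n b -> depth m b.
Proof.
move=> /subnKC<-; elim: (m - n)%N => [|p IHp] Db; first by rewrite addn0.
by rewrite addnS; apply/depthS/IHp.
Qed.

Let depth_exists b : exists n, depth n b.
Proof.
move: b; apply: skew_ind.
- split=> [|x y [n Dx] [m Dy]|c x [n Dx]].
  + by exists 0%N; apply: subspace0.
  + exists (maxn n m); apply: subspaceD => //.
      exact: depth_leq (leq_maxl _ _) Dx.
    exact: depth_leq (leq_maxr _ _) Dy.
  + by exists n; apply: subspaceZ.
- by exists 0%N; case: algW.
- move=> l x sl [n Dx]; exists n.+1 => q Qq; rewrite mulrA.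
  by apply: depthM => //; apply: comm_ideal_skew.
Qed.

(** By finite dimension the depth of the elements of [B] is bounded, and it can be
    lowered to 0 because 1 is a sum of [q_i b_i] with [q_i] in [Q]. *)
Lemma invariant_subalgebra_noncomm s y : W s -> sym s -> W y -> s * y <> y * s ->
  forall x, W x.
Proof.
move=> Ws ss Wy sy.
have W1 : W 1 by case: algW.
have Q1 : comm_ideal (s * y - y * s).
  by rewrite -[_ - _]mulr1 -[_ - _]mul1r; apply: comm_ideal_in.
have [|as' [Qas s1]] := right_span_one Q1 (not_comm_neq0 sy).
  move=> a l Qa sl; exists [:: a; l * a - a * l]; split.
    by move=> b; rewrite !inE => /orP[/eqP->//|/eqP->]; apply: comm_idealK.
  exists l, (l * a - a * l); split; last by rewrite addrC subrK.
  by exists 1, 0; rewrite mulr1 addr0.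
have [n Dn] : exists n, forall b, depth n b.
  have /choice[h Dh] := depth_exists.
  exists (\max_i h (v i)) => b; rewrite (coordinates b).
  apply: subspace_sum => // i _; apply: subspaceZ => //.
  exact: depth_leq (leq_bigmax _) (Dh _).
elim: n Dn => // n IHn Dn; apply: IHn => b.
have : right_span as' b by rewrite -[b]mul1r; apply: right_spanM.
elim: (as') b Qas => [|a t IHt] b Qt /=; first by move=> ->; apply: subspace0.
move=> [c [z [tz ->]]]; apply: subspaceD => //.
  by have /= := Dn c; apply; apply: Qt; rewrite mem_head.
by apply: IHt => // d dt; apply: Qt; rewrite inE dt orbT.
Qed.

(** It remains to see that a symmetric element [s] of [W] is a scalar if all of
    them commute with [W]. For skew [l] the element [a = [s, l]] commutes with
    [s], and [[s, [s, [s, l^3]]] = 6 a^3] is 0 because [[s, l^3]] is in [W]. These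
    elements commute, and if they were not all 0 they would generate the right
    ideal [B], against [nilpotent_right_span]; so [s] commutes with the skew
    elements. *)
Lemma invariant_subalgebra : (forall x, W x) \/ forall s, W s -> sym s -> is_scalar s.
Proof.
have [comm|] := pselect (forall s y, W s -> sym s -> W y -> s * y = y * s); last first.
  move=> /existsNP[s /existsNP[y /not_implyP[Ws /not_implyP[ss /not_implyP[Wy sy]]]]].
  by left; apply: invariant_subalgebra_noncomm sy.
right=> s Ws ss; apply: commute_skew => l sl.
apply: contrapT => /not_comm_neq0 sl0.
pose G a := exists s l, [/\ W s, sym s, skew l & a = s * l - l * s].
have GW a : G a -> W a /\ sym a.
  by move=> [s' [l' [Ws' ss' sl' ->]]]; split; [exact: WK|exact: (sym_skew_comm csi)].
have Gsl : G (s * l - l * s) by exists s, l.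
have [|t [tG t1]] := right_span_one Gsl sl0.
  move=> _ m [s' [l' [Ws' ss' sl' ->]]] sm.
  exists [:: s' * l' - l' * s'; (s' * m - m * s') * l' - l' * (s' * m - m * s');
             s' * (l' * m - m * l') - (l' * m - m * l') * s'].
  split.
    move=> a; rewrite !inE => /or3P[/eqP->|/eqP->|/eqP->].
    - by exists s', l'.
    - by exists (s' * m - m * s'), l'; split=> //; [exact: WK|exact: (sym_skew_comm csi)].
    - by exists s', (l' * m - m * l'); split=> //; apply: (skew_comm csi).
  exists m, (m * (s' * l' - l' * s') - (s' * l' - l' * s') * m); split; last first.
    by ncring.
  exists (- 1), (- (s' * (l' * m - m * l') - (l' * m - m * l') * s')); split; last by ncring.
  by exists (- 1), 0; rewrite mulrN1 addr0.
apply: (nilpotent_right_span _ _ t1) => [a b /tG/GW[Wa sa] /tG/GW[Wb sb]|a /tG].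
  by exists a; apply: comm.
move=> [s' [l' [Ws' ss' sl' Ea]]].
have [Wa sa] : W a /\ sym a by apply: GW; exists s', l'.
have sa0 : s' * a - a * s' = 0 by rewrite comm // subrr.
have slll : skew (l' * l' * l') by rewrite /skew !starM sl'; ncring.
pose d3 := a * a * l' + a * l' * a + l' * a * a.
have d30 : d3 = 0.
  have E : s' * (s' * (l' * l' * l') - l' * l' * l' * s')
      - (s' * (l' * l' * l') - l' * l' * l' * s') * s' = d3 + d3 +
      ((s' * a - a * s') * l' * l' + l' * (s' * a - a * s') * l'
       + l' * l' * (s' * a - a * s')) by rewrite /d3 Ea; ncring.
  rewrite comm ?subrr // in E; last exact: WK.
  apply: (double_eq0 two0).
  by move: E; rewrite sa0 !(mul0r, mulr0) !addr0 => /esym.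
apply: (char0B csi (n := 2)).
have : s' * d3 - d3 * s' = 0 by rewrite d30 mulr0 mul0r subrr.
have -> : s' * d3 - d3 * s' = a * a * (s' * l' - l' * s') + a * (s' * l' - l' * s') * a
    + (s' * l' - l' * s') * a * a + ((s' * a - a * s') * a * l'
    + a * (s' * a - a * s') * l' + (s' * a - a * s') * l' * a + a * l' * (s' * a - a * s')
    + l' * (s' * a - a * s') * a + l' * a * (s' * a - a * s')).
  by rewrite /d3; ncring.
by rewrite -Ea sa0 !(mul0r, mulr0) !addr0 !mulrS mulr0n addr0 addrA.
Qed.

End InvariantSubalgebra.
End NormalizedSubalgebras.

(** * Classification of the invariant subspaces *)

Section InvariantClassification.
Variables (k : fieldType) (B : algType k) (star : B -> B).
Hypothesis csi : central_simple_involution star.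

Let char0 n : n.+1%:R != 0 :> k. Proof. exact: csi_char0 csi n. Qed.
Let starD x y : star (x + y) = star x + star y. Proof. exact: csi_starD csi x y. Qed.
Let starM x y : star (x * y) = star y * star x. Proof. exact: csi_starM csi x y. Qed.
Let starK x : star (star x) = x. Proof. exact: csi_starK csi x. Qed.
Let starZ (c : k) x : star (c *: x) = c *: star x. Proof. exact: csi_starZ csi c x. Qed.
Let center_B (z : B) : (forall x, z * x = x * z) -> is_scalar z.
Proof. exact: csi_center csi z. Qed.
Let two0 : 2%:R != 0 :> k. Proof. exact: char0 1. Qed.

Local Notation sym := (sym star).
Local Notation skew := (skew star).
Implicit Types (x y : B) (D V W : B -> Prop).

Let sS : subspace sym := subspace_sym csi.
Let sK : subspace skew := subspace_skew csi.

Hypothesis not_low :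
  ~ (basis_of (@everything _ B) 1 \/ basis_of (@everything _ B) 4).

Variables (J : finType) (v : J -> B) (lam : J -> B -> k).
Hypothesis coordinates : forall x, x = \sum_i lam i x *: v i.

Definition skew_invariant (L : B -> Prop) :=
  subspace L /\ forall x l, L x -> skew l -> L (x * l - l * x).

Lemma generated_skew_invariant M : skew_invariant M ->
  forall x l, generated M x -> skew l -> generated M (x * l - l * x).
Proof.
move=> [sM MK] x l gx sl; have [sG G1 GM] := subalgebra_generated M.
elim: gx => {x} [x Mx||x y _ Ix _ Iy|c x _ Ix|x y gx Ix gy Iy].
- by apply: generated_in; apply: MK.
- by rewrite mul1r mulr1 subrr; apply: subspace0.
- by rewrite mulrDl mulrDr opprD addrACA; apply: subspaceD.
- by rewrite -scalerAl -scalerAr -scalerBr; apply: subspaceZ.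
- have -> : x * y * l - l * (x * y) = x * (y * l - l * y) + (x * l - l * x) * y by ncring.
  by apply: subspaceD => //; apply: GM.
Qed.

(** For [x = m_1 ... m_r] the identity [[x y, z] = [x, y z] + [y, z x]] writes
    [[x, y]] as a sum of the [[m_i, y_i]]; symmetrizing turns each [y_i] into
    the skew element [y_i - y_i^*]. *)
Lemma generated_sym_comm M : skew_invariant M -> (forall x, M x -> sym x) ->
  forall x, generated M x -> forall y, M (x * y - y * x + star (x * y - y * x)).
Proof.
move=> [sM MK] Msym x; elim=> {x} [x Mx|| x z _ Ix _ Iz|c x _ Ix|x z _ Ix _ Iz] y.
- rewrite (starB csi) !starM (Msym x Mx).
  have -> : x * y - y * x + (star y * x - x * star y) =
      x * (y - star y) - (y - star y) * x by ncring.
  by apply: MK => //; apply: (skew_part csi).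
- by rewrite mul1r mulr1 subrr (star0 csi) addr0; apply: subspace0.
- have -> : (x + z) * y - y * (x + z) = (x * y - y * x) + (z * y - y * z) by ncring.
  by rewrite starD addrACA; apply: subspaceD.
- by rewrite -scalerAl -scalerAr -scalerBr starZ -scalerDr; apply: subspaceZ.
- have -> : x * z * y - y * (x * z) = (x * (z * y) - z * y * x) + (z * (y * x) - y * x * z).
    by ncring.
  by rewrite starD addrACA; apply: subspaceD.
Qed.

Lemma generated_skew_comm M : skew_invariant M -> (forall x, M x -> skew x) ->
  forall x, generated M x -> forall y, M (x * y - y * x - star (x * y - y * x)).
Proof.
move=> [sM MK] Mskew x; elim=> {x} [x Mx|| x z _ Ix _ Iz|c x _ Ix|x z _ Ix _ Iz] y.
- rewrite (starB csi) !starM (Mskew x Mx).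
  have -> : x * y - y * x - (star y * - x - - x * star y) =
      x * (y - star y) - (y - star y) * x by ncring.
  by apply: MK => //; apply: (skew_part csi).
- by rewrite mul1r mulr1 subrr (star0 csi) subr0; apply: subspace0.
- have -> : (x + z) * y - y * (x + z) = (x * y - y * x) + (z * y - y * z) by ncring.
  by rewrite starD opprD addrACA; apply: subspaceD.
- by rewrite -scalerAl -scalerAr -scalerBr starZ -scalerBr; apply: subspaceZ.
- have -> : x * z * y - y * (x * z) = (x * (z * y) - z * y * x) + (z * (y * x) - y * x * z).
    by ncring.
  by rewrite starD opprD addrACA; apply: subspaceD.
Qed.

(** Either all commutators [[s, l]] are of the form above, or the symmetric
    elements of the subalgebra generated by [M] are scalars. *)
Lemma sym_invariant M : skew_invariant M -> (forall x, M x -> sym x) ->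
  (forall x, M x -> is_scalar x) \/
  (forall s l, sym s -> skew l -> M (s * l - l * s)).
Proof.
move=> iM Msym; have [sM MK] := iM.
have [full|scal] := @invariant_subalgebra _ _ _ csi not_low _
   (subalgebra_generated M) (generated_skew_invariant iM) _ _ _ coordinates.
  right=> s l ss sl; have := generated_sym_comm iM Msym (full s) l.
  rewrite (sym_skew_comm csi ss sl) => h.
  by rewrite -[_ - _](halfK two0) -scalerDr; apply: subspaceZ.
by left=> x Mx; apply: scal; [exact: generated_in|exact: Msym].
Qed.

Section QuaternionSubalgebra.
Variables (W : B -> Prop) (i j : B) (al be : k).
Hypotheses (algW : subalgebra W) (scalW : forall s, W s -> sym s -> is_scalar s).
Hypothesis WK : forall x l, W x -> skew l -> W (x * l - l * x).
Hypotheses (Wi : W i) (Wj : W j) (si : skew i) (sj : skew j).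
Hypotheses (al0 : al != 0) (be0 : be != 0).
Hypotheses (ii : i * i = al%:A) (jj : j * j = be%:A) (ij : i * j = - (j * i)).

Let C x := [/\ everything x, x * i = i * x & x * j = j * x].

Let algC : subalgebra C.
Proof.
split; first split.
- by split=> //; rewrite !(mulr0, mul0r).
- by move=> x y [_ xi xj] [_ yi yj]; split=> //; rewrite mulrDl mulrDr ?xi ?xj ?yi ?yj.
- by move=> c x [_ xi xj]; split=> //; rewrite -scalerAl -scalerAr ?xi ?xj.
- by split=> //; rewrite mul1r mulr1.
- move=> x y [_ xi xj] [_ yi yj]; split=> //.
    by rewrite -mulrA yi !mulrA xi.
  by rewrite -mulrA yj !mulrA xj.
Qed.

Let starC x : C x -> C (star x).
Proof.
move=> [_ xi xj]; split=> //; apply: oppr_inj.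
  by rewrite -mulrN -mulNr -si -!starM xi.
by rewrite -mulrN -mulNr -sj -!starM xj.
Qed.

Let scalC x : C x -> sym x -> is_scalar x.
Proof.
move=> [Cx xi xj] sx; have [sW _ WM] := algW.
(* [x i] is skew and [[j, x i] = -2 x i j], so [x i j] and [x] lie in [W] *)
have sxi : skew (x * i) by rewrite /skew starM sx si mulNr -xi.
have := WK Wj sxi.
have -> : j * (x * i) - x * i * j = - (x * (i * j) + x * (i * j)).
  have ji : j * i = - (i * j) by rewrite ij opprK.
  by rewrite mulrA -xj -(mulrA x) ji; ncring.
move/(subspaceN sW); rewrite opprK -mulr2n -scaler_nat => /(subspaceZ 2%:R^-1 sW).
rewrite scalerA mulVf // scale1r => Wxij.
have : W (x * (i * j) * j * i) by apply: (WM) => //; apply: WM.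
have -> : x * (i * j) * j * i = (al * be) *: x.
  rewrite -!mulrA (mulrA j j) jj mulr_algl -scalerAr ii -scalerAr mulr_algr.
  by rewrite scalerA mulrC.
have ne : al * be != 0 by rewrite mulf_neq0.
move/(subspaceZ (al * be)^-1 sW); rewrite scalerA mulVf // scale1r => Wx.
exact: scalW.
Qed.

Let semiprimeC x : C x -> skew x -> (forall y, C y -> x * y * x = 0) -> x = 0.
Proof.
move=> [_ xi xj] sx xCx; have [|//|//] := @simple_prime _ _ _ csi x x.
move=> r; have [c [Cc ->]] :=
  quaternion_dec two0 (@subalgebra_everything _ B) I I al0 be0 ii jj ij (I : everything r).
have x0 n : x * c n * x = 0 by apply: xCx.
transitivity (x * c 0 * x + x * c 1 * (i * x)
    + (x * c 2 * (j * x) + x * c 3 * i * (j * x))); first by ncring.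
rewrite -xi -xj !mulrA !x0 -[x * c 3 * i * x]mulrA -xi !mulrA x0 !mul0r.
by rewrite !addr0.
Qed.

(** The commutant of [i] and [j] is quadratic as well. It is not of dimension 1
    because [B] is not of dimension 4, nor of dimension 2 because [B] has no
    other central elements than the scalars; so it is a quaternion algebra. *)
Lemma quaternion_subalgebra_dim : basis_of (@everything _ B) 16.
Proof.
have [||allZ|[i' [[_ i'i i'j] nZ Ci']]|] := quadratic_subalgebra csi algC starC.
- exact: scalC.
- exact: semiprimeC.
- case: not_low; right.
  apply: (quaternion_basis (m := 1) two0 (@subalgebra_everything _ B) I I al0 be0 ii jj ij).
  by apply: scalar_basis => //; case: algC.
- case: nZ; apply: center_B => r.
  have [c [Cc ->]] := quaternion_dec two0 (@subalgebra_everything _ B) I I al0 be0 ii jj ij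
    (I : everything r).
  have Cc' n : i' * c n = c n * i'.
    have [a [b ->]] := Ci' _ (Cc n).
    by rewrite mulrDr mulrDl mulr_algl mulr_algr -scalerAl -scalerAr.
  transitivity (i' * c 0 + i' * c 1 * i + (i' * c 2 * j + i' * c 3 * i * j)).
    by ncring.
  rewrite !Cc' !mulrDl -!mulrA i'i i'j !mulrA -[c 3 * i' * i * j]mulrA.
  by rewrite -[c 3 * i * j * i']mulrA -i'j -[c 3 * i * (i' * j)]mulrA
    [i * (i' * j)]mulrA -i'i !mulrA.
move=> [i' [j' [al' [be' [[Ci Cj] [al'0 be'0] [ii' jj'] [ij' _] h]]]]].
apply: (quaternion_basis (m := 4) two0 (@subalgebra_everything _ B) I I al0 be0 ii jj ij).
apply: (quaternion_basis (m := 1) two0 algC Ci Cj al'0 be'0 ii' jj' ij').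
apply: scalar_basis => //; split; [by case: algC|by rewrite mul1r mulr1|].
by rewrite mul1r mulr1.
Qed.

End QuaternionSubalgebra.

(** If [U] does not generate [B], the subalgebra [W] generated by [U] is
    quadratic. The skew [n] in [W] that anticommute with the skew elements of [W]
    are 0, since commutation with [l] preserves them and their squares are 0. If
    [W] had dimension 2, then [u [u, l] = 0] for [u] in [U] and skew [l], because
    [u^2] is a scalar and [W] is commutative; this makes [u] central. *)
Lemma skew_lie_ideal U : skew_invariant U -> (forall x, U x -> skew x) ->
  [\/ forall x, U x -> x = 0, forall l m, skew l -> skew m -> U (l * m - m * l)
    | basis_of (@everything _ B) 16].
Proof.
move=> iU Uskew; have [sU UK] := iU.
pose W := generated U; have algW : subalgebra W := subalgebra_generated U.
have WK := generated_skew_invariant iU; have [sW W1 WM] := algW.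
have [full|scal] := @invariant_subalgebra _ _ _ csi not_low _ algW WK _ _ _ coordinates.
  apply: Or32 => l m sl sm; have := generated_skew_comm iU Uskew (full l) m.
  rewrite (skew_comm csi sl sm) opprK => h.
  by rewrite -[_ - _](halfK two0) -scalerDr; apply: subspaceZ.
have starW x : W x -> W (star x).
  elim=> {x} [x Ux||x y _ Ix _ Iy|c x _ Ix|x y _ Ix _ Iy].
  - by rewrite (Uskew x Ux); apply: subspaceN => //; apply: generated_in.
  - by rewrite (star1 csi).
  - by rewrite starD; apply: subspaceD.
  - by rewrite starZ; apply: subspaceZ.
  - by rewrite starM; apply: WM.
have semiprimeW x : W x -> skew x -> (forall y, W y -> x * y * x = 0) -> x = 0.
  move=> Wx sx xWx; apply: contrapT => x0.
  have xx : x * x = 0 by have := xWx 1 W1; rewrite mulr1.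
  pose G n := [/\ W n, skew n & forall m, W m -> skew m -> n * m + m * n = 0].
  have Gx : G x.
    split=> // m Wm sm; have [||c Ec] := scal (x * m + m * x).
    - by apply: subspaceD => //; apply: WM.
    - exact: (skew_jordan csi).
    have : (x * m + m * x) * x = 0.
      by rewrite mulrDl xWx // -mulrA xx mulr0 addr0.
    rewrite Ec mulr_algl => /eqP; rewrite scaler_eq0 => /orP[/eqP->|/eqP//].
    by rewrite scale0r.
  have sq n : G n -> n * n = 0.
    by move=> [Wn sn nG]; apply: (double_eq0 two0); apply: nG.
  have [|t [tG t1]] := right_span_one csi not_low Gx x0.
    move=> n l [Wn sn nG] sl; exists [:: n; l * n - n * l]; split; last first.
      exists l, (l * n - n * l); split; last by rewrite addrC subrK.
      by exists 1, 0; rewrite mulr1 addr0.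
    have Wln : W (l * n - n * l) by rewrite -opprB; apply: subspaceN => //; apply: WK.
    move=> a; rewrite !inE => /orP[/eqP->//|/eqP->]; split=> //.
      exact: (skew_comm csi).
    move=> m Wm sm.
    transitivity (l * (n * m + m * n) - (n * m + m * n) * l
      + (n * (m * l - l * m) + (m * l - l * m) * n)); first by ncring.
    rewrite !nG ?mulr0 ?mul0r ?subrr ?addr0 //; first exact: WK.
    exact: (skew_comm csi).
  apply: (nilpotent_right_span _ _ t1) => [a b /tG[Wa sa aG] /tG[Wb sb bG]|a /tG Ga].
    exists (- a); apply/eqP; rewrite mulrN -addr_eq0; apply/eqP; exact: aG.
  by rewrite sq // mul0r.
have [U0|] := pselect (forall x, U x -> x = 0); first exact: Or31.
move=> /existsNP[u /not_implyP[Uu u0]]; have Wu : W u by apply: generated_in.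
have su := Uskew u Uu.
have [||allZ|[i [Wi nZ WE]]|] := quadratic_subalgebra csi algW starW.
- exact: scal.
- exact: semiprimeW.
- case: u0; apply: (sym_skew_eq0 csi) => //.
  by apply: (scalar_sym csi); apply: allZ.
- have Wcomm x y : W x -> W y -> x * y = y * x.
    have iy z : W z -> i * z = z * i.
      move=> /WE[c [d ->]].
      by rewrite mulrDr mulrDl mulr_algl mulr_algr -scalerAl -scalerAr.
    move=> /WE[a [b ->]] Wy.
    by rewrite mulrDl mulrDr mulr_algl mulr_algr -scalerAl -scalerAr iy.
  case: u0; have [c Ec] : is_scalar (u * u).
    by apply: scal; [exact: WM|rewrite /sym starM su; ncring].
  have [c0|c0] := eqVneq c 0.
    apply: semiprimeW => // y Wy.
    by rewrite (Wcomm u y) // -mulrA Ec c0 scale0r mulr0.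
  suff : is_scalar u by move=> /(scalar_sym csi) symu; apply: (sym_skew_eq0 csi symu).
  apply: (commute_skew csi not_low) => l sl.
  have Wul : W (u * l - l * u) by apply: WK.
  have : u * (u * l - l * u) = 0.
    apply: (double_eq0 two0); rewrite {2}Wcomm //.
    transitivity (u * u * l - l * (u * u)); first by ncring.
    by rewrite Ec mulr_algl mulr_algr subrr.
  move/(congr1 ( *%R u)); rewrite mulr0 mulrA Ec mulr_algl => /eqP.
  by rewrite scaler_eq0 (negPf c0) subr_eq0 => /eqP.
move=> [i [j [al [be [[Wi Wj] [al0 be0] [ii jj] [ij [si sj]] _]]]]].
apply: Or33.
exact: (quaternion_subalgebra_dim algW scal WK Wi Wj si sj al0 be0 ii jj ij).
Qed.

(** * The trace form and the Casimir operator *)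

Section TraceForm.
Hypothesis lam_elementary : forall i, elementary (fun x => (lam i x)%:A : B).

Lemma linear_elementary (g : B -> B) : (forall x y, g (x + y) = g x + g y) ->
  (forall (c : k) x, g (c *: x) = c *: g x) -> elementary g.
Proof.
move=> gD gZ.
have g0 : g 0 = 0 by rewrite -(scale0r 0) gZ !scale0r.
have [s Es] : elementary (fun x => \sum_i (lam i x)%:A * g (v i)).
  by apply: elementary_bigsum => i _; apply: elementary_mulr.
exists s => x; rewrite -Es.
transitivity (g (\sum_i lam i x *: v i)); first by rewrite -coordinates.
rewrite (big_morph g gD g0).
by apply: eq_bigr => i _; rewrite gZ mulr_algl.
Qed.

(** The operator [x |-> sum_k a_k x b_k] determines the tensor [sum_k a_k (x) b_k],
    to which a linear map can then be applied on one side. *)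
Lemma tensor_mapr (s : seq (B * B)) (g : B -> B) : elementary g ->
  (forall y, eop s y = 0) -> forall y, \sum_(p <- s) p.1 * y * g p.2 = 0.
Proof.
move=> [t Et] s0 y.
transitivity (\sum_(q <- t) eop s (y * q.1) * q.2).
  under eq_bigr do rewrite Et /eop mulr_sumr.
  rewrite exchange_big; apply: eq_bigr => q _; rewrite mulr_suml.
  by apply: eq_bigr => p _; rewrite !mulrA.
by rewrite big1 // => q _; rewrite s0 mul0r.
Qed.

Lemma tensor_mapl (s : seq (B * B)) (g : B -> B) : elementary g ->
  (forall y, eop s y = 0) -> forall y, \sum_(p <- s) g p.1 * y * p.2 = 0.
Proof.
move=> [t Et] s0 y.
transitivity (\sum_(q <- t) q.1 * eop s (q.2 * y)).
  under eq_bigr do rewrite Et /eop !mulr_suml.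
  rewrite exchange_big; apply: eq_bigr => q _; rewrite mulr_sumr.
  by apply: eq_bigr => p _; rewrite !mulrA.
by rewrite big1 // => q _; rewrite s0 mulr0.
Qed.

Let star_elementary : elementary star := linear_elementary starD starZ.

Variables (c : seq (B * B)) (tau : B -> k).
Hypothesis tauE : forall x, eop c x = (tau x)%:A.
Hypothesis tauC : forall x y, tau (x * y) = tau (y * x).
Hypothesis tau_star : forall x, tau (star x) = tau x.
Hypothesis tau1 : tau 1 <> 0.

Lemma tauD x y : tau (x + y) = tau x + tau y.
Proof. by apply: (@scalar_inj _ B); rewrite scalerDl -!tauE eopD. Qed.

Lemma tauZ a x : tau (a *: x) = a * tau x.
Proof.
by apply: (@scalar_inj _ B); rewrite -scalerA -!tauE (elementaryZ _ _ (eop_elementary c)).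
Qed.

Lemma tauN x : tau (- x) = - tau x.
Proof. by rewrite -scaleN1r tauZ mulN1r. Qed.

Lemma tau0 : tau 0 = 0.
Proof. by have := tauZ 0 0; rewrite scale0r mul0r. Qed.

Lemma tau_sum (T : Type) (r : seq T) (F : T -> B) :
  tau (\sum_(i <- r) F i) = \sum_(i <- r) tau (F i).
Proof. exact: (big_morph tau tauD tau0). Qed.

Lemma tau_nondegenerate x : (forall y, tau (x * y) = 0) -> x = 0.
Proof.
move=> tx; apply: contrapT => x0; apply: tau1.
have [P [s Es] <-] := csi_simple csi x0; rewrite Es /eop tau_sum big1 // => p _.
by rewrite -mulrA tauC -mulrA tx.
Qed.

Lemma tau_sym_skew s l : sym s -> skew l -> tau (s * l) = 0.
Proof.
move=> ss sl; have := tau_star (s * l); rewrite starM ss sl mulNr tauN tauC.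
move/eqP; rewrite eq_sym -subr_eq0 opprK -mulr2n -mulr_natr mulf_eq0 (negPf two0) orbF.
by move/eqP.
Qed.

(** The linear form that separates [x0] from [X] is obtained as an elementary
    operator, so that it can be represented by the trace form. *)
Lemma separation (X : B -> Prop) x0 : subspace X -> ~ X x0 ->
  exists T, [/\ elementary T, forall x, X x -> T x = 0 & T x0 <> 0].
Proof.
move=> sX Xx0; set m := #|J|.
have lamD i x y : lam i (x + y) = lam i x + lam i y.
  by apply: (@scalar_inj _ B); rewrite scalerDl (elementaryD _ _ (lam_elementary i)).
pose r x : 'rV[k]_m := \row_i lam (enum_val i) x.
pose e (u : 'rV[k]_m) : B := \sum_i u 0 i *: v (enum_val i).
have rK x : e (r x) = x.
  rewrite {2}(coordinates x) (reindex (@enum_val J J)) /=; last first.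
    by apply: onW_bij; exists enum_rank; [exact: enum_valK|exact: enum_rankK].
  by apply: eq_bigr => i _; rewrite mxE.
have eD u w : e (u + w) = e u + e w.
  by rewrite /e -big_split; apply: eq_bigr => i _; rewrite mxE scalerDl.
pose inX (A : 'M[k]_m) := forall u : 'rV_m, (u <= A)%MS -> X (e u).
pose P n := `[< exists A : 'M[k]_m, inX A /\ \rank A = n >].
have P0 : exists n, P n.
  exists 0%N; apply/asboolP; exists 0; split; last exact: mxrank0.
  move=> u; rewrite submx0 => /eqP->; rewrite /e big1 => [|i _]; first by apply: subspace0.
  by rewrite mxE scale0r.
have Pm n : P n -> (n <= m)%N by move=> /asboolP[A [_ <-]]; apply: rank_leq_row.
case: (ex_maxnP P0 Pm) => n /asboolP[A [XA rA]] maxn.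
have XinA x : X x -> (r x <= A)%MS.
  move=> Xx; apply: contraT => rxA.
  have XAx : inX (A + r x)%MS.
    move=> u /sub_addsmxP[[u1 u2] /= ->]; rewrite eD; apply: subspaceD => //.
      by apply: XA; apply: submxMl.
    have -> : u2 *m r x = u2 0 0 *: r x.
      by rewrite [u2]mx11_scalar mul_scalar_mx mxE mulr1n.
    have -> : e (u2 0 0 *: r x) = u2 0 0 *: e (r x).
      by rewrite /e scaler_sumr; apply: eq_bigr => i _; rewrite !mxE scalerA.
    by rewrite rK; apply: subspaceZ.
  have : (A < A + r x)%MS by rewrite /ltmx addsmxSl addsmx_sub submx_refl.
  rewrite ltmxErank rA => /andP[_]; rewrite ltnNge => /negP[]; apply: maxn.
  by apply/asboolP; exists (A + r x)%MS.
have : ~~ (r x0 <= A)%MS by apply/negP => /XA; rewrite rK.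
rewrite submxE => /matrix0Pn[i0 [j0]]; rewrite (ord1 i0) => nz.
exists (fun x => ((r x *m cokermx A) 0 j0)%:A); split.
- have [s Es] : elementary (fun x => \sum_(i < m) (lam (enum_val i) x)%:A * (cokermx A i j0)%:A).
    by apply: elementary_bigsum => i _; apply: elementary_mulr.
  exists s => x; rewrite -Es mxE scaler_suml; apply: eq_bigr => i _.
  by rewrite mxE mulr_algl scalerA.
- by move=> x /XinA; rewrite submxE => /eqP->; rewrite mxE scale0r.
- by rewrite -(scale0r 1) => /scalar_inj E; rewrite E eqxx in nz.
Qed.

Lemma tau_separation (X : B -> Prop) x0 : subspace X -> ~ X x0 ->
  exists b, (forall x, X x -> tau (b * x) = 0) /\ tau (b * x0) <> 0.
Proof.
move=> sX /(separation sX)[T [[s Es] TX Tx0]].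
have adj y x : tau (y * T x) = tau (eop (flip s) y * x).
  rewrite Es /eop /flip big_map mulr_sumr mulr_suml !tau_sum; apply: eq_bigr => p _ /=.
  by rewrite !mulrA tauC !mulrA.
have [y ty] : exists y, tau (y * T x0) <> 0.
  apply: contrapT => /forallNP h; apply: Tx0; apply: tau_nondegenerate => y.
  by rewrite tauC; apply: contrapT.
exists (eop (flip s) y); split=> [x Xx|]; last by rewrite -adj.
by rewrite -adj TX // mulr0 tau0.
Qed.

Lemma tau_skew_comm0 l x : skew l -> (forall m, skew m -> tau ((l * x - x * l) * m) = 0) ->
  skew x -> l * x = x * l.
Proof.
move=> sl h sx; apply/eqP; rewrite -subr_eq0; apply/eqP; apply: tau_nondegenerate => y.
have [s [m [ss sm -> _ _]]] := sym_skew_dec csi y.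
rewrite mulrDr tauD (h m) // addr0 tauC; apply: tau_sym_skew => //.
exact: (skew_comm csi).
Qed.

(** By duality: an element that is orthogonal to all [[l, m]] commutes with the
    skew elements. *)
Lemma skew_perfect X : subspace X ->
  (forall l m, skew l -> skew m -> X (l * m - m * l)) -> forall l, skew l -> X l.
Proof.
move=> sX XKK x0 sx0; apply: contrapT => /(tau_separation sX)[b [bX]]; apply.
pose l1 := b - star b; have sl1 : skew l1 := skew_part csi b.
have tl1 x : skew x -> tau (l1 * x) = tau (b * x) + tau (b * x).
  move=> sx; rewrite mulrBl tauD tauN -(tau_star (star b * x)) starM starK sx.
  by rewrite mulNr tauN opprK (tauC x).
have l1C l : skew l -> l1 * l = l * l1.
  move=> sl; apply: tau_skew_comm0 => // m sm.
  have slm : skew (l * m - m * l) := skew_comm csi sl sm.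
  have : tau (l1 * (l * m - m * l)) = 0 by rewrite tl1 // !bX ?addr0 //; apply: XKK.
  move=> <-; have -> : (l1 * l - l * l1) * m = l1 * (l * m) - l * (l1 * m) by ncring.
  have -> : l1 * (l * m - m * l) = l1 * (l * m) - (l1 * m) * l by ncring.
  by rewrite !tauD !tauN (tauC l).
have l10 : l1 = 0.
  apply: (sym_skew_eq0 csi) => //; apply: (scalar_sym csi).
  exact: (commute_skew csi not_low).
have /eqP := tl1 x0 sx0; rewrite l10 mul0r tau0 eq_sym -mulr2n -mulr_natr mulf_eq0.
by rewrite (negPf two0) orbF => /eqP.
Qed.

(** By duality: a symmetric element that is orthogonal to all [[s, l]] commutes
    with the skew elements, so it is a scalar, which is 0 if it is orthogonal
    to 1. *)
Lemma sym_decomposition X : subspace X -> X 1 ->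
  (forall s l, sym s -> skew l -> X (s * l - l * s)) -> forall s, sym s -> X s.
Proof.
move=> sX X1 XSK x0 sx0; apply: contrapT => /(tau_separation sX)[b [bX]]; apply.
pose s1 := b + star b; have ss1 : sym s1 := sym_part csi b.
have ts1 x : sym x -> tau (s1 * x) = tau (b * x) + tau (b * x).
  move=> sx; rewrite mulrDl tauD -(tau_star (star b * x)) starM starK sx.
  by rewrite (tauC x).
have s1C l : skew l -> s1 * l = l * s1.
  move=> sl; apply/esym/eqP; rewrite -subr_eq0; apply/eqP; apply: tau_nondegenerate => y.
  have [s [m [ss sm -> _ _]]] := sym_skew_dec csi y; rewrite mulrDr tauD.
  have sls : sym (l * s1 - s1 * l).
    by rewrite -opprB; apply: (subspaceN sS); apply: (sym_skew_comm csi).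
  rewrite (tau_sym_skew sls sm) addr0.
  have ssl : sym (s * l - l * s) := sym_skew_comm csi ss sl.
  have : tau (s1 * (s * l - l * s)) = 0 by rewrite ts1 // !bX ?addr0 //; apply: XSK.
  move=> <-; have -> : (l * s1 - s1 * l) * s = l * (s1 * s) - s1 * l * s by ncring.
  have -> : s1 * (s * l - l * s) = (s1 * s) * l - s1 * l * s by ncring.
  by rewrite !tauD !tauN (tauC l).
have s10 : s1 = 0.
  have [a Ea] := commute_skew csi not_low s1C.
  have : tau s1 = 0.
    have := ts1 1 (star1 csi); rewrite mulr1 => ->.
    by rewrite bX ?addr0.
  rewrite Ea tauZ => /eqP; rewrite mulf_eq0 => /orP[/eqP->|/eqP//].
  by rewrite scale0r.
have /eqP := ts1 x0 sx0; rewrite s10 mul0r tau0 eq_sym -mulr2n -mulr_natr mulf_eq0.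
by rewrite (negPf two0) orbF => /eqP.
Qed.

Hypothesis c_star : forall y, \sum_(p <- c) star p.2 * y * star p.1 = eop c y.

Let F x := \sum_(p <- c) p.1 * x * star p.2.

Let F_mulr x y : F (x * y) = F y * star x.
Proof.
pose s := [seq (p.1 * x, p.2) | p <- c] ++ [seq (- p.1, x * p.2) | p <- c].
have s0 z : eop s z = 0.
  rewrite eop_cat /eop !big_map /=.
  transitivity ((tau (x * z))%:A - (tau (z * x))%:A : B); last by rewrite tauC subrr.
  rewrite -!tauE /eop -sumrN -!big_split /=; apply: eq_bigr => p _.
  by rewrite !mulNr !mulrA.
have /eqP := tensor_mapr star_elementary s0 y.
rewrite big_cat !big_map /=.
under [X in _ + X == 0]eq_bigr do rewrite !mulNr starM mulrA.
rewrite sumrN subr_eq0 /F mulr_suml => /eqP <-.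
by apply: eq_bigr => p _; rewrite !mulrA.
Qed.

Let F_mull x y : x * F y = F (y * star x).
Proof.
pose s := [seq (x * p.1, p.2) | p <- c] ++ [seq (- p.1, p.2 * x) | p <- c].
have s0 z : eop s z = 0.
  rewrite eop_cat /eop !big_map /=.
  transitivity (x * (tau z)%:A - (tau z)%:A * x); last by rewrite mulr_algl mulr_algr subrr.
  rewrite -!tauE /eop mulr_sumr mulr_suml -sumrN; congr (_ + _);
    by apply: eq_bigr => p _; rewrite ?mulNr !mulrA.
have /eqP := tensor_mapr star_elementary s0 y.
rewrite big_cat !big_map /=.
under [X in _ + X == 0]eq_bigr do rewrite !mulNr starM mulrA.
rewrite sumrN subr_eq0 /F mulr_sumr => /eqP E.
transitivity (\sum_(j <- c) x * j.1 * y * star j.2).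
  by apply: eq_bigr => p _; rewrite !mulrA.
by rewrite E; apply: eq_bigr => p _; rewrite !mulrA.
Qed.

(** With [c = sum_k p_k (x) q_k] dual bases of the trace form, the sum of the
    [p_k x q_k^*] is a nonzero multiple [ze x^*]: this operator is determined by
    its commutation with the multiplications. *)
Lemma dual_bases_star : exists2 ze : k, ze != 0 & forall x, F x = ze *: star x.
Proof.
have FE x : F x = F 1 * star x by rewrite -{1}[x]mulr1 F_mulr.
have [ze Eze] : is_scalar (F 1).
  by apply: center_B => x; rewrite F_mull mul1r (FE (star x)) starK.
have FE' x : F x = ze *: star x by rewrite FE Eze mulr_algl.
exists ze => //; apply/eqP => ze0; apply: tau1; apply: (@scalar_inj _ B).
rewrite -tauE scale0r; pose s := [seq (p.1, star p.2) | p <- c].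
have s0 y : eop s y = 0 by rewrite /eop big_map -/(F y) FE' ze0 scale0r.
have := tensor_mapr star_elementary s0 1; rewrite big_map => E.
by rewrite -[RHS]E /eop; apply: eq_bigr => p _ /=; rewrite starK.
Qed.

Let sumP (f g : B -> B) x := \sum_(p <- c) f p.1 * x * g p.2.
Let sumN (f g : B -> B) x := \sum_(p <- c) f p.2 * x * g p.1.

Let sum_star1 : exists2 ze : k, ze != 0 & forall x,
  [/\ sumP id star x = ze *: star x, sumN star id x = ze *: star x,
      sumP star id x = ze *: star x & sumN id star x = ze *: star x].
Proof.
have [ze ze0 FE] := dual_bases_star; exists ze => // x.
pose s := [seq (star p.2, star p.1) | p <- c] ++ [seq (- p.1, p.2) | p <- c].
have s0 y : eop s y = 0.
  rewrite eop_cat /eop !big_map /= c_star /eop -big_split big1 // => p _ /=.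
  by rewrite !mulNr addrN.
have Nid y : sumN star id y = F y.
  have /eqP := tensor_mapr star_elementary s0 y; rewrite big_cat !big_map /=.
  rewrite addr_eq0 -sumrN => /eqP E; rewrite /sumN /F.
  transitivity (\sum_(j <- c) star j.2 * y * star (star j.1)).
    by apply: eq_bigr => p _; rewrite starK.
  by rewrite E; apply: eq_bigr => p _; rewrite !mulNr opprK.
have starF y : sumN id star (star y) = star (F y).
  rewrite /F (big_morph star starD (star0 csi)); apply: eq_bigr => p _.
  by rewrite !starM starK mulrA.
have starF' y : sumP star id (star y) = star (sumN star id y).
  rewrite /sumN (big_morph star starD (star0 csi)); apply: eq_bigr => p _.
  by rewrite !starM starK mulrA.
by split; rewrite ?Nid ?FE // -[x]starK ?starF ?starF' ?Nid FE starZ !starK.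
Qed.

Let sum_scalar x : [/\ is_scalar (sumP id id x), is_scalar (sumN star star x),
  is_scalar (sumP star star x) & is_scalar (sumN id id x)].
Proof.
have Pstar y : is_scalar (sumP star star y).
  apply: center_B => z.
  pose s := [seq (p.1 * star z, p.2) | p <- c] ++ [seq (- p.1, star z * p.2) | p <- c].
  have s0 t : eop s t = 0.
    rewrite eop_cat /eop !big_map /=.
    transitivity ((tau (star z * t))%:A - (tau (t * star z))%:A : B); last by rewrite tauC subrr.
    rewrite -!tauE /eop -sumrN -!big_split /=; apply: eq_bigr => p _.
    by rewrite !mulNr !mulrA.
  have s1 : forall t, eop [seq (star p.1, p.2) | p <- s] t = 0.
    by move=> t; rewrite /eop big_map; apply: tensor_mapl.
  have /eqP := tensor_mapr star_elementary s1 y.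
  rewrite big_map big_cat !big_map /= addr_eq0 -sumrN => /eqP E.
  rewrite /sumP mulr_sumr mulr_suml; apply/esym.
  transitivity (\sum_(j <- c) star (j.1 * star z) * y * star j.2).
    by apply: eq_bigr => p _; rewrite starM starK !mulrA.
  rewrite E; apply: eq_bigr => p _.
  by rewrite (starN csi) !mulNr opprK starM starK mulrA.
split=> //; first by exists (tau x); rewrite -tauE.
  by exists (tau x); rewrite /sumN c_star tauE.
have [a Ea] := Pstar (star x); exists a.
transitivity (star (sumP star star (star x))); last by rewrite Ea starZ (star1 csi).
rewrite /sumP (big_morph star starD (star0 csi)); apply: eq_bigr => p _.
by rewrite !starM !starK mulrA.
Qed.

Let comm_with a x := a * x - x * a.

(** In the expansion of the double commutators every term is a scalar or, by the
    relations above, a multiple of [x] or of [x^*]. As [ze] is not 0, the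
    operator tells symmetric from skew elements up to scalars. *)
Lemma casimir : exists mu ze : k, ze != 0 /\ forall x, exists2 z, is_scalar z &
  \sum_(p <- c) comm_with (p.1 - star p.1) (comm_with (p.2 - star p.2) x) =
    mu *: x + ze *: star x + z.
Proof.
have [ze ze0 sums] := sum_star1.
pose S1 x := \sum_(p <- c) (p.1 - star p.1) * x * (p.2 - star p.2).
pose S2 x := \sum_(p <- c) (p.2 - star p.2) * x * (p.1 - star p.1).
have S1E x : exists2 z, is_scalar z & S1 x = z - (ze *: star x + ze *: star x).
  have [E1 _ E3 _] := sums x; have [Z1 _ Z3 _] := sum_scalar x.
  exists (sumP id id x + sumP star star x).
    exact: (subspaceD (@subspace_scalar _ B)).
  rewrite -{1}E1 -E3 /sumP opprD -!sumrN -!big_split; apply: eq_bigr => p _ /=.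
  by ncring.
have S2E x : exists2 z, is_scalar z & S2 x = z - (ze *: star x + ze *: star x).
  have [_ E2 _ E4] := sums x; have [_ Z2 _ Z4] := sum_scalar x.
  exists (sumN id id x + sumN star star x).
    exact: (subspaceD (@subspace_scalar _ B)).
  rewrite -{1}E2 -E4 /sumN opprD -!sumrN -!big_split; apply: eq_bigr => p _ /=.
  by ncring.
have S1_scalar T : (exists2 z, is_scalar z & T = z - (ze *: star 1 + ze *: star 1)) ->
    is_scalar T.
  move=> [z Zz ->]; apply: (subspaceB (@subspace_scalar _ B)) => //.
  by rewrite (star1 csi); apply: (subspaceD (@subspace_scalar _ B)); exists ze.
have [m1 Em1] := S1_scalar _ (S1E 1); have [m2 Em2] := S1_scalar _ (S2E 1).
exists (m1 + m2), (ze *+ 4); split.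
  by rewrite -mulr_natr mulf_neq0.
move=> x; have [z1 Z1 E1] := S1E x; have [z2 Z2 E2] := S2E x.
exists (- (z1 + z2)).
  by apply: (subspaceN (@subspace_scalar _ B)); apply: (subspaceD (@subspace_scalar _ B)).
transitivity (S1 1 * x - S1 x - S2 x + x * S2 1).
  rewrite /S1 /S2 mulr_suml mulr_sumr -!sumrN -!big_split; apply: eq_bigr => p _ /=.
  by rewrite /comm_with !mulr1; ncring.
rewrite E1 E2 Em1 Em2 mulr_algl mulr_algr !mulrS mulr0n !scalerDl scale0r.
by ncring.
Qed.

(** Subtracting [mu - ze] times [s + l] from its image under the Casimir operator
    leaves [2 ze s] and a scalar. *)
Lemma casimir_splits L : skew_invariant L -> forall s l, sym s -> skew l ->
  L (s + l) -> exists z, [/\ is_scalar z, L (s + z) & L (l - z)].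
Proof.
move=> [sL LK] s l ss sl Lu; have [mu [ze [ze0 casE]]] := casimir.
have LKl x m : L x -> skew m -> L (m * x - x * m).
  by move=> Lx sm; rewrite -opprB; apply: subspaceN => //; apply: LK.
have [z Zz Ez] := casE (s + l).
have Lsz : L ((ze + ze) *: s + z).
  have -> : (ze + ze) *: s + z = (mu *: (s + l) + ze *: star (s + l) + z)
      - (mu - ze) *: (s + l).
    rewrite starD ss sl !scalerBl !scalerDr !scalerDl scalerN; ncring.
  rewrite -Ez; apply: subspaceB => //; last exact: subspaceZ.
  apply: subspace_sum => // p _ /=.
  apply: (LKl); last exact: (skew_part csi).
  by apply: LKl => //; apply: (skew_part csi).
have ze2 : ze + ze != 0 by rewrite -mulr2n -mulr_natr mulf_neq0.
have Lsz' : L (s + (ze + ze)^-1 *: z).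
  have := subspaceZ (ze + ze)^-1 sL Lsz.
  by rewrite scalerDr scalerA mulVf // scale1r.
exists ((ze + ze)^-1 *: z); split=> //.
  exact: (subspaceZ _ (@subspace_scalar _ B)).
have -> : l - (ze + ze)^-1 *: z = (s + l) - (s + (ze + ze)^-1 *: z) by ncring.
exact: subspaceB.
Qed.

Hypothesis not16 : ~ basis_of (@everything _ B) 16.

Lemma skew_contained U : skew_invariant U -> (forall x, U x -> skew x) ->
  forall u, U u -> u <> 0 -> forall l, skew l -> U l.
Proof.
move=> iU Uskew u Uu u0; have [U0|UKK|//] := skew_lie_ideal iU Uskew.
  by case: u0; apply: U0.
by apply: skew_perfect UKK; case: iU.
Qed.

(** If [s + l] is in [L] with [l <> 0], so are [s + z] for some scalar [z] and
    then the commutators [[l, m]]. As some of them are not 0, the skew elements of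
    [L] form a nonzero invariant subspace. *)
Lemma skew_invariant_dichotomy L : skew_invariant L ->
  (forall x, L x -> sym x) \/ (forall l, skew l -> L l).
Proof.
move=> iL; have [sL LK] := iL.
have [|/existsNP[x /not_implyP[Lx nsx]]] := pselect (forall x, L x -> sym x); first by left.
right; have [s [l [ss sl Ex _ _]]] := sym_skew_dec csi x.
have l0 : l <> 0 by move=> l0; apply: nsx; rewrite Ex l0 addr0.
have Lsl : L (s + l) by rewrite -Ex.
have [z [Zz Lsz _]] := casimir_splits iL ss sl Lsl.
have [m [sm lm]] : exists m, skew m /\ l * m <> m * l.
  apply: contrapT => /forallNP h; apply: l0; apply: (sym_skew_eq0 csi) => //.
  apply: (scalar_sym csi); apply: (commute_skew csi not_low) => m sm.
  by apply: contrapT => lm; apply: (h m).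
have Llm : L (l * m - m * l).
  have -> : l * m - m * l = ((s + l) * m - m * (s + l)) - ((s + z) * m - m * (s + z)).
    rewrite (mulrDl s z) (mulrDr m s z) (scalar_comm m Zz); ncring.
  by apply: subspaceB => //; apply: LK.
pose U y := L y /\ skew y.
have iU : skew_invariant U.
  split=> [|y n [Ly sy] sn]; last by split; [exact: LK|exact: (skew_comm csi)].
  split=> [|y n [Ly sy] [Ln sn]|a y [Ly sy]].
  - by split; [exact: subspace0|exact: (subspace0 sK)].
  - by split; [exact: subspaceD|exact: (subspaceD sK)].
  - by split; [exact: subspaceZ|exact: (subspaceZ _ sK)].
move=> n sn.
have [] // : U n.
apply: (skew_contained iU _ _ (not_comm_neq0 lm)) => // [y []//|].
by split=> //; apply: (skew_comm csi).
Qed.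

Lemma sym_invariant_dichotomy L : skew_invariant L ->
  (forall x, L x -> sym x -> is_scalar x) \/
  (forall s l, sym s -> skew l -> L (s * l - l * s)).
Proof.
move=> [sL LK]; pose M y := L y /\ sym y.
have iM : skew_invariant M.
  split=> [|y n [Ly sy] sn]; last by split; [exact: LK|exact: (sym_skew_comm csi)].
  split=> [|y n [Ly sy] [Ln sn]|a y [Ly sy]].
  - by split; [exact: subspace0|exact: (subspace0 sS)].
  - by split; [exact: subspaceD|exact: (subspaceD sS)].
  - by split; [exact: subspaceZ|exact: (subspaceZ _ sS)].
have [scal|SK] := sym_invariant iM (fun y My => proj2 My).
  by left=> x Lx sx; apply: scal.
by right=> s l ss sl; have [] := SK s l ss sl.
Qed.

End TraceForm.
End InvariantClassification.

(** * Evaluation of noncommutative polynomials *)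

Section Evaluation.
Variables (F k : fieldType) (kappa : {rmorphism F -> k}) (B : algType k).
Variable I : choiceType.
Implicit Types (x : I -> B) (g : {malg F[{fmonom I}]}) (w : seq I).

Definition wprod x w : B := \prod_(i <- w) x i.

Lemma wprod_cat x v w : wprod x (v ++ w) = wprod x v * wprod x w.
Proof. by rewrite /wprod big_cat. Qed.

Lemma wprod_cons x i w : wprod x (i :: w) = x i * wprod x w.
Proof. by rewrite /wprod big_cons. Qed.

Lemma wprod_nil x : wprod x [::] = 1.
Proof. by rewrite /wprod big_nil. Qed.

Definition eval x g : B := \sum_(w <- msupp g) kappa g@_w *: wprod x w.

Lemma evalEw x (d : {fset {fmonom I}}) g : (msupp g `<=` d)%fset ->
  eval x g = \sum_(w <- d) kappa g@_w *: wprod x w.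
Proof.
move=> sub; rewrite /eval (big_fset_incl _ sub) //= => w _ /mcoeff_outdom->.
by rewrite rmorph0 scale0r.
Qed.

Lemma evalD x g h : eval x (g + h) = eval x g + eval x h.
Proof.
rewrite (evalEw _ (msuppD_le g h)) (evalEw x (fsubsetUl (msupp g) (msupp h))).
rewrite (evalEw x (fsubsetUr (msupp g) (msupp h))) -big_split /=.
by apply: eq_bigr => w _; rewrite mcoeffD rmorphD scalerDl.
Qed.

Lemma evalZ x c g : eval x (c *: g) = kappa c *: eval x g.
Proof.
rewrite (evalEw _ (msuppZ_le c g)) scaler_sumr.
by apply: eq_bigr => w _; rewrite mcoeffZ rmorphM scalerA.
Qed.

Lemma eval0 x : eval x 0 = 0.
Proof. by rewrite /eval msupp0 big_seq_fset0. Qed.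

Lemma evalN x g : eval x (- g) = - eval x g.
Proof. by rewrite -scaleN1r evalZ rmorphN1 scaleN1r. Qed.

Lemma eval_sum x (T : Type) (r : seq T) (P : pred T) (G : T -> {malg F[{fmonom I}]}) :
  eval x (\sum_(i <- r | P i) G i) = \sum_(i <- r | P i) eval x (G i).
Proof. exact: (big_morph (eval x) (evalD x) (eval0 x)). Qed.

Lemma evalU x c (w : {fmonom I}) : eval x << c *g w >> = kappa c *: wprod x w.
Proof.
rewrite (evalEw _ msuppU_le) big_seq_fset1 mcoeffUU.
by [].
Qed.

Lemma evalM x g h : eval x (g * h) = eval x g * eval x h.
Proof.
rewrite (monalgE g) (monalgE h) mulr_suml !eval_sum mulr_suml.
apply: eq_bigr => v _; rewrite mulr_sumr eval_sum mulr_sumr.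
apply: eq_bigr => w _.
rewrite malgM_def fgmulUU !evalU -scalerAl -scalerAr scalerA rmorphM; congr (_ *: _).
by rewrite fmM wprod_cat.
Qed.

(** * Multilinearization *)

(** Inclusion-exclusion over the supersets of [A]. *)
Lemma alternating_supersets (T : finType) (A : {set T}) :
  \sum_(J : {set T} | A \subset J) (-1) ^+ #|~: J| = (A == [set: T])%:R :> k.
Proof.
have [->|] := eqVneq A [set: T].
  rewrite (big_pred1 [set: T]) => [|J]; first by rewrite setCT cards0.
  by rewrite subTset.
rewrite -subTset => /subsetPn[t _ tA].
rewrite (bigID (fun J : {set T} => t \in J)) /=.
rewrite (reindex_onto (fun J => t |: J) (fun J => J :\ t)) /=; last first.
  by move=> J /andP[_ tJ]; apply: setD1K.
apply/eqP; rewrite addr_eq0 -sumrN; apply/eqP.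
apply: eq_big => J.
  rewrite setU11 andbT; apply/andP/andP => -[].
    move=> AJ /eqP E; have tJ : t \notin J by rewrite -E !inE eqxx.
    split=> //; apply/subsetP => u uA; have := subsetP AJ u uA.
    by rewrite !inE => /orP[/eqP ut|//]; rewrite -ut uA in tA.
  move=> AJ tJ; split; last by rewrite setU1K.
  exact: subset_trans AJ (subsetUr _ _).
case/andP=> /andP[_ _] /eqP E; have tJ : t \notin J by rewrite -E !inE eqxx.
have -> : ~: J = t |: ~: (t |: J).
  by apply/setP => u; rewrite !inE negb_or; case: eqP => [->|]; rewrite ?tJ.
by rewrite cardsU1 !inE eqxx /= exprS mulN1r opprK.
Qed.

Variable X : B -> Prop.
Hypothesis X0 : X 0.
Hypothesis XD : forall a b, X a -> X b -> X (a + b).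

Section Polarization.
Variables (d : nat) (w : d.-tuple I) (y : 'I_d -> B).

Definition polar (J : {set 'I_d}) i := \sum_(j in J | tnth w j == i) y j.

(** Substituting [X_i := sum_(j in J, w_j = i) y_j] in a word of length at most
    [d] and taking the alternating sum over [J] keeps the terms where every
    [y_j] occurs exactly once. *)
Lemma polarize_word m (t : m.-tuple I) : (m <= d)%N ->
  \sum_(J : {set 'I_d}) (-1) ^+ #|~: J| *: wprod (polar J) t =
  \sum_(s : 'S_d) if tval t == [seq tnth w (s i) | i <- enum 'I_d]
                  then \prod_(i < d) y (s i) else 0.
Proof.
move=> le_ud.
pose ok (f : {ffun 'I_m -> 'I_d}) := [forall p, tnth w (f p) == tnth t p].
have E J : wprod (polar J) t =
    \sum_(f : {ffun 'I_m -> 'I_d} | ok f && (f @: setT \subset J)) \prod_(p < m) y (f p).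
  rewrite /wprod big_tuple.
  under eq_bigr => p _ do rewrite /polar big_mkcond.
  rewrite (bigA_distr_bigA (fun p j => if (j \in J) && (tnth w j == tnth t p) then y j else 0)).
  rewrite [RHS]big_mkcond; apply: eq_bigr => f _.
  case: ifP => [/andP[/forallP okf /subsetP fJ]|].
    by apply: eq_bigr => p _; rewrite okf fJ ?imset_f.
  move/negbT; rewrite negb_and => bad.
  have [p badp] : exists p, ~~ ((f p \in J) && (tnth w (f p) == tnth t p)).
    case/orP: bad => [/forallPn[p wp]|/subsetPn[_ /imsetP[p _ ->] fJ]]; exists p.
      by rewrite (negPf wp) andbF.
    by rewrite (negPf fJ).
  have [l1 [l2 ->]] : exists l1 l2, index_enum 'I_m = l1 ++ p :: l2.
    have : p \in index_enum 'I_m by rewrite mem_index_enum.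
    by case/splitPr => l1 l2; exists l1, l2.
  by rewrite big_cat big_cons /= (negPf badp) mul0r mulr0.
under eq_bigr do rewrite E scaler_sumr.
rewrite (exchange_big_dep ok) /=; last by move=> J f _ /andP[].
transitivity (\sum_(f | ok f && (f @: setT == setT)) \prod_(p < m) y (f p)).
  rewrite [RHS]big_mkcondr; apply: eq_bigr => f okf.
  under eq_bigl do rewrite okf /=.
  rewrite -scaler_suml alternating_supersets.
  by case: eqP => _; rewrite ?scale1r ?scale0r.
have [md|md] := eqVneq m d; last first.
  rewrite big1 => [|f /andP[_ /eqP fT]].
    rewrite big1 // => s _; case: eqP => // /(congr1 size) E'.
    by case/eqP: md; rewrite -[LHS](size_tuple t) E' size_map size_enum_ord.
  have := leq_imset_card f [set: 'I_m]; rewrite fT !cardsT !card_ord => le_dm.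
  by case/eqP: md; apply/eqP; rewrite eqn_leq le_ud.
subst m; rewrite (reindex_onto (fun s : 'S_d => val s) (fun f : {ffun 'I_d -> 'I_d} => insubd (1%g : 'S_d) f)) /=; last first.
  move=> f /andP[_ /eqP fT]; rewrite insubdK //; apply/injectiveP => p q.
  have /imset_injP finj : #|f @: [set: 'I_d]| == #|[set: 'I_d]| by rewrite fT.
  by apply: finj; rewrite inE.
rewrite [RHS]big_mkcond [LHS]big_mkcond; apply: eq_bigr => s _ /=.
have -> : val s @: [set: 'I_d] == setT.
  rewrite eqEcard subsetT /= card_imset // => p q.
  rewrite !pvalE; exact: perm_inj.
rewrite valKd eqxx !andbT /ok.
have -> : [forall p, tnth w (val s p) == tnth t p] =
    (tval t == [seq tnth w (s i) | i <- enum 'I_d]).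
  have -> : [seq tnth w (s i) | i <- enum 'I_d] = mktuple (fun i => tnth w (s i)) by [].
  apply/forallP/eqP => [h|Et p].
    apply: (congr1 val); apply: eq_from_tnth => p.
    by rewrite tnth_mktuple -(eqP (h p)) pvalE.
  by rewrite pvalE (val_inj Et) tnth_mktuple.
case: ifP => // _; apply: eq_bigr => p _.
by rewrite pvalE.
Qed.

End Polarization.

(** The identity is polarized along one of its longest words. *)
Lemma multilinear_identity (g : {malg F[{fmonom I}]}) : g != 0 ->
  (forall x : I -> B, (forall i, X (x i)) -> eval x g = 0) ->
  exists d (c : 'S_d -> k), c 1%g = 1 /\
    forall y : 'I_d -> B, (forall i, X (y i)) -> \sum_s c s *: \prod_(i < d) y (s i) = 0.
Proof.
move=> g0 gX.
have [w wg maxw] : exists2 w : {fmonom I}, w \in msupp g & forall u, u \in msupp g -> (fdeg u <= fdeg w)%N.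
  have [w0 w0g] : exists w : {fmonom I}, w \in msupp g.
    by apply/fset0Pn; rewrite msupp_eq0.
  pose P n := has (fun w : {fmonom I} => fdeg w == n) (msupp g).
  have P0 : exists n, P n by exists (fdeg w0); apply/hasP; exists w0.
  have Pm n : P n -> (n <= \max_(w <- msupp g) fdeg w)%N.
    case/hasP => w wg /eqP<-.
    exact: (@leq_bigmax_seq _ _ xpredT (@fdeg I) w wg isT).
  case: (ex_maxnP P0 Pm) => n /hasP[w wg /eqP<-] maxn; exists w => // u ug.
  by apply: maxn; apply/hasP; exists u.
pose d := fdeg w; pose wt : d.-tuple I := in_tuple w.
pose wp (s : 'S_d) : {fmonom I} := FMonom [seq tnth wt (s i) | i <- enum 'I_d].
have gw0 : kappa g@_w != 0 by rewrite fmorph_eq0 mcoeff_neq0.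
have wp1 : wp 1%g = w.
  apply/eqP; rewrite fmP /= -[X in _ == X](map_tnth_enum wt); apply/eqP.
  by apply: eq_map => i; rewrite perm1.
exists d, (fun s => kappa g@_(wp s) / kappa g@_w); split=> [|y Xy].
  by rewrite wp1 divff.
have sum0 : \sum_(J : {set 'I_d}) (-1) ^+ #|~: J| *: eval (polar wt y J) g = 0.
  rewrite big1 // => J _; rewrite gX ?scaler0 // => i.
  by rewrite /polar; elim/big_ind: _.
suff E : \sum_s kappa g@_(wp s) *: \prod_(i < d) y (s i) = 0.
  under eq_bigr do rewrite mulrC -scalerA.
  by rewrite -scaler_sumr E scaler0.
rewrite -[RHS]sum0 /eval; under [RHS]eq_bigr do rewrite scaler_sumr.
rewrite exchange_big /=.
transitivity (\sum_(u <- msupp g) \sum_s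
   if u == wp s then kappa g@_u *: \prod_(i < d) y (s i) else 0).
  rewrite exchange_big /=; apply: eq_bigr => s _.
  have [wg'|wg'] := boolP (wp s \in msupp g).
    rewrite (big_fsetD1 (wp s) wg') /= eqxx [X in _ + X]big_seq [X in _ + X]big1 ?addr0 // => u.
    by rewrite in_fsetD1 => /andP[/negPf->].
  rewrite mcoeff_outdom // rmorph0 scale0r big_seq big1 // => u ug.
  by case: eqP => // us; rewrite -us ug in wg'.
rewrite big_seq [RHS]big_seq; apply: eq_bigr => u ug.
under [RHS]eq_bigr do rewrite scalerA mulrC -scalerA.
rewrite -scaler_sumr (polarize_word wt y (in_tuple u)) ?maxw // scaler_sumr.
apply: eq_bigr => s _.
have -> : (u == wp s) = (tval (in_tuple u) == [seq tnth wt (s i) | i <- enum 'I_d]).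
  by rewrite fmP.
by case: ifP; rewrite ?scaler0.
Qed.

End Evaluation.

(** * Coefficients of polynomial families in a subspace *)

Section Coefficients.
Variables (F k : fieldType) (kappa : {rmorphism F -> k}) (B : algType k).
Hypothesis char0 : forall n, n.+1%:R != 0 :> k.
Variable X : B -> Prop.
Hypothesis sX : subspace X.

Lemma natr_inj0 (m n : nat) : (m < n)%N -> n%:R - m%:R != 0 :> k.
Proof.
move=> lt; rewrite -natrB; last exact: ltnW.
by case: (n - m)%N (subn_gt0 m n) => [|p]; rewrite ?lt.
Qed.

(** The Vandermonde matrix of distinct integers is invertible, so that a vector
    polynomial with values in [X] has its coefficients there. *)
Lemma vandermonde_subspace n (v : 'I_n -> B) :
  (forall t : nat, X (\sum_(i < n) (t%:R : k) ^+ i *: v i)) -> forall i, X (v i).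
Proof.
move=> Xt i0; pose M := Vandermonde n (\row_(t < n) t%:R : 'rV[k]_n).
have uM : M \in unitmx.
  rewrite unitmxE det_Vandermonde unitfE; apply/prodf_neq0 => i _.
  by apply/prodf_neq0 => j ij; rewrite !mxE natr_inj0.
have -> : v i0 = \sum_(t < n) invmx M t i0 *: \sum_(i < n) (t%:R : k) ^+ i *: v i.
  transitivity (\sum_i (M *m invmx M) i i0 *: v i).
    rewrite mulmxV // (bigD1 i0) //= mxE eqxx scale1r big1 ?addr0 // => i.
    by rewrite mxE => /negPf->; rewrite scale0r.
  under [RHS]eq_bigr do rewrite scaler_sumr.
  rewrite exchange_big; apply: eq_bigr => i _; rewrite mxE scaler_suml.
  by apply: eq_bigr => t _; rewrite !mxE scalerA mulrC.
by apply: subspace_sum => // t _; apply: subspaceZ.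
Qed.

Lemma poly_coef_subspace (p : {poly B}) :
  (forall t : nat, X p.[t%:R]) -> forall i, X p`_i.
Proof.
move=> Xp i; have [lt|le] := ltnP i (size p); last first.
  by rewrite nth_default //; apply: subspace0.
apply: (@vandermonde_subspace _ (fun j : 'I_(size p) => p`_j) _ (Ordinal lt)) => t.
have := Xp t; rewrite horner_coef; congr X; apply: eq_bigr => j _.
by rewrite -[t%:R]scaler_nat exprZn expr1n mulr_algr.
Qed.

Variables (I : choiceType) (f : {malg F[{fmonom I}]}).
Local Notation eval := (eval kappa).

(** The homogeneous parts of the value lie in [X], by comparison of the powers of
    [t], and can then be rescaled. *)
Lemma homogeneous_subspace (x : I -> B) (r : nat -> k) :
  (forall t : nat, X (eval (fun i => (t%:R : k) *: x i) f)) ->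
  X (\sum_(w <- msupp f) (kappa f@_w * r (size w)) *: wprod x w).
Proof.
move=> Xt; pose n := (\max_(w <- msupp f) size w).+1.
have wn (w : {fmonom I}) : w \in msupp f -> (size w < n)%N.
  move=> wf; rewrite ltnS.
  exact: (@leq_bigmax_seq _ _ xpredT (fun w : {fmonom I} => size w) w wf isT).
pose v (d : 'I_n) := \sum_(w <- msupp f | size w == d) kappa f@_w *: wprod x w.
have byd (c : nat -> k) : \sum_(w <- msupp f) (kappa f@_w * c (size w)) *: wprod x w =
    \sum_(d < n) c d *: v d.
  under [RHS]eq_bigr do rewrite /v scaler_sumr big_mkcond.
  rewrite exchange_big /= big_seq [RHS]big_seq; apply: eq_bigr => w wf.
  rewrite (bigD1 (Ordinal (wn w wf))) //= eqxx big1 ?addr0.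
    by rewrite scalerA mulrC.
  by move=> d /negPf nd; case: eqP => // E; case/eqP: nd; apply: val_inj.
have Xv : forall d, X (v d).
  apply: vandermonde_subspace => t; rewrite -(byd (fun d => t%:R ^+ d)).
  have := Xt t; congr X; apply: eq_bigr => w _; rewrite -scalerA; congr (_ *: _).
  elim: (fmonom_val w) => [|i u IHu] /=; first by rewrite !wprod_nil scale1r.
  by rewrite !wprod_cons IHu -scalerAl -scalerAr scalerA exprS.
by rewrite byd; apply: subspace_sum => // d _; apply: subspaceZ.
Qed.

(** The derivative of a word, when the letter [i] moves in the direction [de i]. *)
Definition dword (x de : I -> B) (w : seq I) :=
  \sum_(j < size w) wprod x (take j w) *
    (if drop j w is i :: w' then de i * wprod x w' else 0).

Lemma dword_cons x de i w :
  dword x de (i :: w) = de i * wprod x w + x i * dword x de w.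
Proof.
rewrite /dword big_ord_recl /= wprod_nil mul1r; congr (_ + _).
by rewrite mulr_sumr; apply: eq_bigr => j _; rewrite wprod_cons mulrA.
Qed.

(** The sum is the coefficient of [t] in the value at [x + t de]. *)
Lemma linear_coef_subspace (x de : I -> B) :
  (forall t : nat, X (eval (fun i => x i + (t%:R : k) *: de i) f)) ->
  X (\sum_(w <- msupp f) kappa f@_w *: dword x de w).
Proof.
move=> Xt; pose q i := (x i)%:P + (de i)%:P * 'X.
pose W w : {poly B} := \prod_(i <- w) q i.
have W0 w : (W w)`_0 = wprod x w.
  rewrite /W; elim: w => [|i w IHw]; first by rewrite big_nil wprod_nil coef1.
  by rewrite big_cons wprod_cons coefM big_ord1 IHw /q coefD coefC coefMX addr0.
have W1 w : (W w)`_1 = dword x de w.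
  rewrite /W; elim: w => [|i w IHw].
    by rewrite big_nil /dword big_ord0 coef1.
  rewrite big_cons dword_cons coefM !big_ord_recl big_ord0 addr0 /= IHw -/(W w) W0.
  by rewrite /q !coefD !coefC !coefMX /= !coefC /= addr0 add0r addrC.
have Wt w (t : nat) : (W w).[t%:R] = wprod (fun i => x i + (t%:R : k) *: de i) w.
  rewrite /W; elim: w => [|i w IHw]; first by rewrite big_nil wprod_nil hornerC.
  rewrite big_cons wprod_cons hornerM_comm; last exact/esym/commr_nat.
  rewrite IHw; congr (_ * _); rewrite /q hornerD hornerC hornerMX hornerC.
  by rewrite -[t%:R in LHS]scaler_nat mulr_algr.
pose P : {poly B} := \sum_(w <- msupp f) (kappa f@_w)%:A *: W w.
have : X P`_1.
  apply: poly_coef_subspace => t; rewrite /P horner_sum.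
  have := Xt t; congr X; apply: eq_bigr => w _.
  by rewrite hornerZ Wt mulr_algl.
rewrite /P coef_sum; congr X; apply: eq_bigr => w _.
by rewrite coefZ W1 mulr_algl.
Qed.

End Coefficients.

(** * Cyclic equivalence *)

Section CommutatorSums.
Variable R : nzRingType.
Implicit Types f g p q z : R.

(** Cyclic equivalence of [g] and [h] is [comm_sum (g - h)]. *)
Definition comm_sum g := exists n (p q : 'I_n -> R), g = \sum_i (p i * q i - q i * p i).

Lemma comm_sumP g :
  comm_sum g <-> exists s : seq (R * R), g = \sum_(r <- s) (r.1 * r.2 - r.2 * r.1).
Proof.
split=> [[n [p [q ->]]]|[s ->]].
  by exists [seq (p i, q i) | i <- index_enum 'I_n]; rewrite big_map.
exists (size s), (fun i => (tnth (in_tuple s) i).1), (fun i => (tnth (in_tuple s) i).2).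
by rewrite big_tnth.
Qed.

Lemma comm_sum0 : comm_sum 0.
Proof. by apply/comm_sumP; exists [::]; rewrite big_nil. Qed.

Lemma comm_sumD f g : comm_sum f -> comm_sum g -> comm_sum (f + g).
Proof.
move=> /comm_sumP[s ->] /comm_sumP[t ->]; apply/comm_sumP; exists (s ++ t).
by rewrite big_cat.
Qed.

Lemma comm_sum_comm p q : comm_sum (p * q - q * p).
Proof. by apply/comm_sumP; exists [:: (p, q)]; rewrite big_seq1. Qed.

Lemma comm_sum_central z g : (forall f, z * f = f * z) -> comm_sum g -> comm_sum (z * g).
Proof.
move=> zC [n [p [q ->]]]; exists n, (fun i => z * p i), q.
by rewrite mulr_sumr; apply: eq_bigr => i _; rewrite mulrBr !mulrA (zC (q i)).
Qed.

Lemma comm_sum_sum (T : Type) (r : seq T) (P : pred T) (G : T -> R) :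
  (forall i, P i -> comm_sum (G i)) -> comm_sum (\sum_(i <- r | P i) G i).
Proof.
by move=> GP; elim/big_ind: _ => //; [exact: comm_sum0|exact: comm_sumD].
Qed.

End CommutatorSums.

(** * Polynomials with involution *)

Section StarPolynomials.
Variables (F : fieldType) (L : choiceType) (bar : L -> L).
Hypothesis barK : involutive bar.
Local Notation "'poly'" := {malg F[{fmonom L}]}.
Implicit Types (f g h p q : poly) (w : {fmonom L}).

(** The letters are kept abstract: [bar] exchanges [X_i] and [X_i^*]. *)
Definition bar_word w : {fmonom L} := FMonom (rev [seq bar i | i <- w]).

Definition bar_poly g : poly := \sum_(w <- msupp g) << g@_w *g bar_word w >>.

Local Notation starP := bar_poly.

Lemma bar_wordK : involutive bar_word.
Proof.
move=> w; rewrite -[RHS]fmK /bar_word /= map_rev revK -map_comp.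
by congr FMonom; rewrite -[RHS]map_id; apply: eq_map => i /=; rewrite barK.
Qed.

Lemma mcoeff_star g w : (starP g)@_w = g@_(bar_word w).
Proof.
rewrite /bar_poly raddf_sum /=.
transitivity (\sum_(u <- msupp g) g@_u *+ (u == bar_word w)).
  apply: eq_bigr => u _; rewrite mcoeffU; congr (_ *+ nat_of_bool _).
  by apply/eqP/eqP => [<-|->]; rewrite bar_wordK.
have [wg|wg] := boolP (bar_word w \in msupp g).
  rewrite (big_fsetD1 _ wg) /= eqxx big_seq big1 ?addr0 // => u.
  by rewrite in_fsetD1 => /andP[/negPf->].
rewrite mcoeff_outdom // big_seq big1 // => u ug.
by case: eqP => // E; rewrite -E ug in wg.
Qed.

Lemma bar_polyD f g : starP (f + g) = starP f + starP g.
Proof. by apply/malgP => w; rewrite [LHS]mcoeff_star [LHS]mcoeffD [RHS]mcoeffD !mcoeff_star. Qed.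

Lemma bar_polyZ c f : starP (c *: f) = c *: starP f.
Proof. by apply/malgP => w; rewrite [LHS]mcoeff_star [LHS]mcoeffZ [RHS]mcoeffZ !mcoeff_star. Qed.

Lemma bar_polyN f : starP (- f) = - starP f.
Proof. by rewrite -scaleN1r bar_polyZ scaleN1r. Qed.

Lemma bar_polyK f : starP (starP f) = f.
Proof. by apply/malgP => w; rewrite !mcoeff_star bar_wordK. Qed.

Lemma bar_wordM (v w : seq L) :
  bar_word (FMonom (v ++ w)) = FMonom (bar_word (FMonom w) ++ bar_word (FMonom v)).
Proof. by rewrite /bar_word /= map_cat rev_cat. Qed.

Lemma malgC_central c f : c%:MP * f = f * c%:MP.
Proof.
rewrite mul_malgC [in RHS](monalgE f) mulr_suml.
rewrite [in LHS](monalgE f) scaler_sumr.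
apply: eq_bigr => w _; rewrite malgM_def fgmulUU mulm1 mulrC.
by rewrite -mul_malgC malgM_def fgmulUU mul1m.
Qed.

Lemma comm_sumZ c f : comm_sum f -> comm_sum (c *: f).
Proof.
by rewrite -mul_malgC; apply: comm_sum_central => g; apply: malgC_central.
Qed.

Definition mono (v : seq L) : poly := << FMonom v >>.

Lemma mono_cat (v w : seq L) : mono (v ++ w) = mono v * mono w.
Proof.
rewrite /mono malgM_def fgmulUU mulr1; congr (mkmalgU _ 1).
by apply/eqP; rewrite fmP fmM.
Qed.

Lemma mono_star (v : seq L) : starP (mono v) = mono (bar_word (FMonom v)).
Proof.
apply/malgP => w; rewrite mcoeff_star /mono !mcoeffU; congr (1 *+ nat_of_bool _).
rewrite [FMonom (bar_word _)]fmK.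
by apply/eqP/eqP => [->|<-]; rewrite bar_wordK.
Qed.

Lemma mcoeff_mono (v : seq L) w : (mono v)@_w = (FMonom v == w)%:R.
Proof. by rewrite /mono mcoeffU. Qed.

Lemma monalg_mono (d : {fset {fmonom L}}) f : (msupp f `<=` d)%fset ->
  f = \sum_(w <- d) f@_w *: mono w.
Proof.
move=> sub; rewrite [LHS](monalgEw sub); apply: eq_bigr => w _.
apply/malgP => u; rewrite mcoeffU mcoeffZ mcoeff_mono fmK.
by case: eqP; rewrite ?mulr1 ?mulr0.
Qed.

(** The terms of the cyclic derivative: moving the [j]-th letter of the word to
    the front gives a cyclically equivalent word. *)
Definition cyclic_term (w : seq L) j : poly :=
  if drop j w is i :: w' then
    mono [:: i] * mono (w' ++ take j w) +
    mono [:: bar i] * starP (mono (w' ++ take j w))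
  else 0.

Lemma cyclic_term_equiv (w : seq L) j : (j < size w)%N ->
  comm_sum (mono w + starP (mono w) - cyclic_term w j).
Proof.
move=> jw; rewrite /cyclic_term; case E: (drop j w) => [|i w'].
  by have := size_drop j w; rewrite E => /esym/eqP; rewrite subn_eq0 leqNgt jw.
have Ew : w = take j w ++ i :: w' by rewrite -E cat_take_drop.
set t := take j w in Ew *; rewrite {1 2}Ew.
have -> : mono [:: i] * mono (w' ++ t) = mono (i :: w') * mono t.
  by rewrite -(mono_cat [:: i]) -(mono_cat (i :: w')).
rewrite !mono_star (bar_wordM w' t) (bar_wordM t (i :: w')).
set a : seq L := bar_word (FMonom t); set b : seq L := bar_word (FMonom w').
have -> : (bar_word (FMonom (i :: w')) : seq L) = b ++ [:: bar i].
  by rewrite /b /bar_word /= rev_cons cats1.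
rewrite -[X in _ - (_ + X)]mono_cat.
have -> : mono ([:: bar i] ++ a ++ b) = mono (bar i :: a) * mono b.
  by rewrite -mono_cat.
have -> : mono (FMonom ((b ++ [:: bar i]) ++ a)) = mono b * mono (bar i :: a).
  by rewrite -mono_cat -catA.
rewrite (mono_cat t) opprD addrACA; apply: comm_sumD; exact: comm_sum_comm.
Qed.

Definition cyclic_sum g : poly :=
  \sum_(w <- msupp g) g@_w *: \sum_(j < size w) cyclic_term w j.

Lemma cyclic_sum_equiv f g : (forall w, f@_w = (size w)%:R * g@_w) ->
  comm_sum (f + starP f - cyclic_sum g).
Proof.
move=> fg.
have sub : (msupp f `<=` msupp g)%fset.
  apply/fsubsetP => w; rewrite -!mcoeff_neq0 fg.
  by apply: contraNneq => ->; rewrite mulr0.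
have Ef : f = \sum_(w <- msupp g) g@_w *: \sum_(j < size w) mono w.
  rewrite [LHS](monalg_mono sub); apply: eq_bigr => w _.
  by rewrite sumr_const card_ord fg mulrC -scalerA scaler_nat.
have starPsum (T : Type) (r : seq T) (G : T -> poly) :
    starP (\sum_(i <- r) G i) = \sum_(i <- r) starP (G i).
  apply: (big_morph starP bar_polyD); by rewrite -(scale0r 0) bar_polyZ !scale0r.
have -> : starP f = \sum_(w <- msupp g) g@_w *: \sum_(j < size w) starP (mono w).
  rewrite {1}Ef starPsum; apply: eq_bigr => w _.
  by rewrite bar_polyZ starPsum.
rewrite {1}Ef /cyclic_sum -sumrN -!big_split; apply: comm_sum_sum => w _.
change (comm_sum (g@_w *: (\sum_(j < size w) mono w) +
  g@_w *: (\sum_(j < size w) starP (mono w)) - g@_w *: (\sum_(j < size w) cyclic_term w j))).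
rewrite -scalerDr -scalerBr; apply: comm_sumZ.
rewrite -sumrN -!big_split; apply: comm_sum_sum => j _.
exact: cyclic_term_equiv.
Qed.

Lemma cyclic_sum_coef1 g : (cyclic_sum g)@_mone = 0.
Proof.
rewrite /cyclic_sum raddf_sum /= big1 // => w _; rewrite mcoeffZ raddf_sum /=.
rewrite big1 ?mulr0 // => j _; rewrite /cyclic_term.
case: (drop j w) => [|i w']; first exact: mcoeff0.
have coef1 i' (v : seq L) : (mono [:: i'] * mono v)@_mone = 0.
  rewrite -mono_cat mcoeff_mono.
  have /negPf-> : FMonom ([:: i'] ++ v) != mone by rewrite fmP fm1.
  by [].
by rewrite [LHS]mcoeffD mono_star [X in X + _]coef1 [X in _ + X]coef1 addr0.
Qed.

(** * Traces of polynomial values *)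

(** The values of [f] are taken at the elements of a set [Y] that is closed under
    addition and spans [B]: the image of the given algebra in its central
    closure. *)
Section Traces.
Variables (k : fieldType) (kappa : {rmorphism F -> k}) (B : algType k) (star : B -> B).
Hypothesis csi : central_simple_involution star.

Let starD x y : star (x + y) = star x + star y. Proof. exact: csi_starD csi x y. Qed.
Let starM x y : star (x * y) = star y * star x. Proof. exact: csi_starM csi x y. Qed.
Let starK x : star (star x) = x. Proof. exact: csi_starK csi x. Qed.
Let starZ (c : k) x : star (c *: x) = c *: star x. Proof. exact: csi_starZ csi c x. Qed.

Variables (index : L -> nat) (starred : L -> bool).
Hypothesis index_bar : forall i, index (bar i) = index i.
Hypothesis starred_bar : forall i, starred (bar i) = ~~ starred i.

Definition letters (a : nat -> B) i :=
  if starred i then star (a (index i)) else a (index i).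

Lemma letters_flip a i : letters a (bar i) = star (letters a i).
Proof. by rewrite /letters index_bar starred_bar; case: (starred i) => //=; rewrite starK. Qed.

Lemma wprod_star a w : wprod (letters a) (bar_word w) = star (wprod (letters a) w).
Proof.
rewrite /bar_word /=; elim: (fmonom_val w) => [|i v IHv] /=.
  by rewrite wprod_nil (star1 csi).
by rewrite rev_cons -cats1 wprod_cat IHv !wprod_cons wprod_nil mulr1 letters_flip starM.
Qed.

Lemma eval_star a g : eval kappa (letters a) (starP g) = star (eval kappa (letters a) g).
Proof.
rewrite /bar_poly eval_sum /eval (big_morph star starD (star0 csi)).
apply: eq_bigr => w _; have := @evalU _ _ kappa _ _ (letters a) g@_w (bar_word w).
by rewrite /eval => ->; rewrite wprod_star starZ.
Qed.

Lemma eval_mono (x : L -> B) (v : seq L) : eval kappa x (mono v) = wprod x v.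
Proof. by rewrite /mono evalU rmorph1 scale1r. Qed.

Variable tau : B -> k.
Hypothesis tauD : forall x y, tau (x + y) = tau x + tau y.
Hypothesis tauZ : forall c x, tau (c *: x) = c * tau x.
Hypothesis tauC : forall x y, tau (x * y) = tau (y * x).
Hypothesis tau_star : forall x, tau (star x) = tau x.
Hypothesis tau_nondegenerate : forall x, (forall y, tau (x * y) = 0) -> x = 0.

Variable Y : B -> Prop.
Hypothesis Y0 : Y 0.
Hypothesis YD : forall x y, Y x -> Y y -> Y (x + y).
Hypothesis Yspan : forall b, exists c y, Y y /\ b = c *: y.

Let YMn (t : nat) y : Y y -> Y ((t%:R : k) *: y).
Proof.
move=> Yy; elim: t => [|t IHt]; first by rewrite scale0r.
by rewrite mulrS scalerDl scale1r; apply: YD.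
Qed.

Let subspace_ker : subspace (fun x => tau x = 0).
Proof.
split=> [|x y tx ty|c x tx].
- by rewrite -(scale0r 0) tauZ mul0r.
- by rewrite tauD tx ty addr0.
- by rewrite tauZ tx mulr0.
Qed.

(** The value of the word that follows the [j]-th letter cyclically, or its image
    under the involution if that letter is starred: the factor of [y] in the trace
    of [w] after rotation. *)
Definition tail_value a (w : seq L) j : B :=
  if drop j w is i :: w' then
    (let t := wprod (letters a) (w' ++ take j w) in if starred i then star t else t) else 0.

(** The linear part of [tau (g (a + t y))], where only [X_n] moves, is
    [tau (y W)] for the [n]-th cyclic derivative [W] of [g]. *)
Lemma cyclic_derivative_eq0 g a n : (forall i, Y (a i)) ->
  (forall a, (forall i, Y (a i)) -> tau (eval kappa (letters a) g) = 0) ->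
  \sum_(w <- msupp g) kappa g@_w *: \sum_(j < size w)
     (if (drop j w) is i :: _ then if index i == n then tail_value a w j else 0 else 0) = 0.
Proof.
move=> Ya tg; set W := \sum_(w <- _) _.
apply: tau_nondegenerate => b; rewrite tauC; have [c [y [Yy ->]]] := Yspan b.
rewrite -scalerAl tauZ; suff -> : tau (y * W) = 0 by rewrite mulr0.
pose de (i : L) := if index i == n then (if starred i then star y else y) else 0.
have := @linear_coef_subspace F k kappa B (csi_char0 csi) _ subspace_ker _ g (letters a) de.
move=> <-; last first.
  move=> t; rewrite -[RHS](tg (fun m => a m + (if m == n then (t%:R : k) *: y else 0))).
    congr (tau (eval _ _ _)); apply: functional_extensionality_dep => i.
    rewrite /letters /de; case: (starred i); case: eqP => _;
      by rewrite ?starD ?starZ ?(star0 csi) ?scaler0.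
  by move=> i; apply: YD => //; case: eqP => // _; apply: YMn.
have tau_sum (T : Type) (r : seq T) (G : T -> B) : tau (\sum_(i <- r) G i) = \sum_(i <- r) tau (G i).
  by apply: (big_morph tau tauD); case: subspace_ker.
rewrite /W mulr_sumr !tau_sum; apply: eq_bigr => w _.
rewrite -scalerAr !tauZ mulr_sumr /dword !tau_sum; congr (_ * _).
apply: eq_bigr => j _; rewrite /tail_value /de.
case: (drop j w) => [|i w']; first by rewrite !mulr0.
case: eqP => _; last by rewrite mul0r !mulr0.
rewrite [RHS]tauC -mulrA -wprod_cat; case: (starred i) => //.
by rewrite -[RHS]tau_star starM starK tauC.
Qed.

(** A polynomial with zero trace is, after symmetrization, cyclically equivalent
    to an identity: after dividing its homogeneous parts by their degrees, it is
    the sum of the [X_n W_n] up to cyclic equivalence, and by nondegeneracy all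
    cyclic derivatives [W_n + ...] vanish. *)
Lemma trace_zero_cyclic f : f@_mone = 0 ->
  (forall a, (forall i, Y (a i)) -> tau (eval kappa (letters a) f) = 0) ->
  exists h, [/\ comm_sum (f + starP f - h), h@_mone = 0 &
    forall a, (forall i, Y (a i)) -> eval kappa (letters a) h = 0].
Proof.
move=> f1 tf.
pose g : poly := \sum_(w <- msupp f) (f@_w / (size w)%:R) *: mono w.
have gE w : g@_w = f@_w / (size w)%:R.
  rewrite /g raddf_sum /=.
  have [wf|wf] := boolP (w \in msupp f).
    rewrite (big_fsetD1 w wf) /= [X in X + _]mcoeffZ mcoeff_mono fmK eqxx mulr1 big_seq.
    rewrite big1 ?addr0 //.
    move=> u; rewrite in_fsetD1 => /andP[/negPf uw _].
    by rewrite mcoeffZ mcoeff_mono fmK uw mulr0.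
  rewrite mcoeff_outdom // mul0r big_seq big1 // => u uf.
  rewrite mcoeffZ mcoeff_mono fmK; case: eqP => [E|]; last by rewrite mulr0.
  by rewrite -E uf in wf.
have charF n : n.+1%:R != 0 :> F.
  by rewrite -(fmorph_eq0 kappa) rmorph_nat (csi_char0 csi).
exists (cyclic_sum g); split; last 1 first.
- move=> a Ya.
  pose W n := \sum_(w <- msupp g) kappa g@_w *: \sum_(j < size w)
     (if (drop j w) is i :: _ then if index i == n then tail_value a w j else 0 else 0).
  have W0 n : W n = 0.
    apply: cyclic_derivative_eq0 => // a' Ya'.
    have := @homogeneous_subspace F k kappa B (csi_char0 csi) _ subspace_ker _ f (letters a')
      (fun d => d%:R^-1).
    move=> <-; last first.
      move=> t; rewrite -[RHS](tf (fun m => (t%:R : k) *: a' m)).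
        congr (tau (eval _ _ _)); apply: functional_extensionality_dep => i.
        by rewrite /letters; case: (starred i) => //; rewrite starZ.
      by move=> i; apply: YMn.
    rewrite /g eval_sum; congr tau; apply: eq_bigr => w _.
    by rewrite evalZ rmorphM fmorphV rmorph_nat eval_mono.
  pose N := (\max_(w <- msupp g) \max_(i <- fmonom_val w) index i).+1.
  transitivity (\sum_(n < N) (a n * W n + star (a n) * star (W n))); last first.
    by rewrite big1 // => n _; rewrite W0 (star0 csi) !mulr0 addr0.
  have ssum (T : Type) (r : seq T) (G : T -> B) : star (\sum_(i <- r) G i) = \sum_(i <- r) star (G i).
    exact: (big_morph star starD (star0 csi)).
  rewrite /cyclic_sum eval_sum.
  under [RHS]eq_bigr => n _.
    rewrite /W ssum !mulr_sumr -big_split /=.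
    under eq_bigr => w _ do rewrite starZ -!scalerAr -scalerDr ssum !mulr_sumr -big_split /=.
    over.
  rewrite exchange_big /= big_seq [RHS]big_seq; apply: eq_bigr => w wg.
  rewrite evalZ -scaler_sumr; congr (_ *: _); rewrite eval_sum exchange_big /=.
  apply: eq_bigr => j _; rewrite /cyclic_term /tail_value.
  case Ed: (drop j w) => [|i w'].
    by rewrite eval0 big1 // => n _; rewrite (star0 csi) !mulr0 addr0.
  have iN : (index i < N)%N.
    rewrite ltnS; have iw : i \in fmonom_val w by apply: (mem_drop (n0 := j)); rewrite Ed mem_head.
    apply: leq_trans (@leq_bigmax_seq _ (fmonom_val w) xpredT (fun i => index i) i iw isT) _.
    exact: (@leq_bigmax_seq _ _ xpredT (fun w : {fmonom L} => \max_(i <- fmonom_val w) index i)%N w wg isT).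
  rewrite (bigD1 (Ordinal iN)) //= eqxx big1 ?addr0 => [|n]; last first.
    move=> ni; case: eqP => [E|]; last by rewrite (star0 csi) !mulr0 addr0.
    by case/eqP: ni; apply: val_inj.
  rewrite evalD [X in X + _]evalM [X in _ + X]evalM eval_star !eval_mono !wprod_cons !wprod_nil !mulr1.
  rewrite letters_flip /letters; case: (starred i); rewrite ?starK //.
  by rewrite addrC.
- apply: cyclic_sum_equiv => w; rewrite gE mulrC.
  have [w0|w0] := eqVneq (size w) 0%N; last first.
    by rewrite divfK //; case: (size w) w0.
  have -> : w = mone by apply/eqP; rewrite -fdeg_eq0 fdegE w0.
  by rewrite f1 !mul0r.
exact: cyclic_sum_coef1.
Qed.

End Traces.
End StarPolynomials.

From mathcomp Require Import classical_sets.

(** * Central closures *)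

Local Open Scope classical_set_scope.

Section Localization.
Variables (F : fieldType) (A : nuAlgType F).
Variables (Zt : fieldType) (At : algType Zt) (iota : {additive A -> At}) (j : A -> Zt).
Hypothesis iota_inj : injective iota.
Hypothesis iotaM : forall a b, iota (a * b)%nu = iota a * iota b.
Hypothesis iota_center : forall z, center z -> iota z = (j z)%:A.
Hypothesis scalar_fraction :
  forall k : Zt, exists z y, [/\ center z, z <> 0, center y & k = (j z)^-1 * j y].
Hypothesis fraction : forall b, exists z a, [/\ center z, z <> 0 & b = (j z)^-1 *: iota a].

Lemma denominator_neq0 z : center z -> z <> 0 -> j z != 0.
Proof.
move=> cz z0; apply/eqP => jz; apply: z0; apply: iota_inj.
by rewrite iota_center // jz scale0r raddf0.
Qed.

Lemma nonzero_center : exists2 z, center z & z <> 0 :> A.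
Proof. by have [z [a [cz z0 _]]] := fraction 1; exists z. Qed.

Lemma iotaMl z a : center z -> iota (z * a)%nu = j z *: iota a.
Proof. by move=> cz; rewrite iotaM iota_center // -scalerAl mul1r. Qed.

Lemma center_scale (c : F) z : center z -> center (c *: z : A).
Proof. by move=> cz a; rewrite amulZl cz amulZr. Qed.

Lemma scalar_mul_eq0 z a : center z -> z <> 0 -> (z * a)%nu = 0 :> A -> a = 0.
Proof.
move=> cz z0 za; apply: iota_inj; rewrite raddf0.
have := congr1 iota za; rewrite iotaMl // raddf0 => /eqP.
by rewrite scaler_eq0 (negPf (denominator_neq0 cz z0)) => /eqP.
Qed.

(** As [A] need not be unital, a scalar [c] is sent to the fraction [c z / z] for
    any nonzero central [z]. *)
Lemma exists_scalar_morphism :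
  exists kappa : {rmorphism F -> Zt}, forall c a, iota (c *: a) = kappa c *: iota a.
Proof.
have [z cz z0] := nonzero_center; have jz := denominator_neq0 cz z0.
pose kap c := (j z)^-1 * j (c *: z).
have kapE c a : iota (c *: a) = kap c *: iota a.
  apply: (scalerI jz); rewrite scalerA mulVKf // -!iotaMl //; last exact: center_scale.
  by rewrite amulZl amulZr.
have kapI (c1 c2 : Zt) : c1 *: iota z = c2 *: iota z -> c1 = c2.
  rewrite iota_center // !scalerA => /scalar_inj/(mulIf jz); exact.
have kapB : zmod_morphism kap.
  by move=> c d; apply: kapI; rewrite scalerBl -!kapE scalerBl raddfB.
have kapM : monoid_morphism kap.
  split=> [|c d]; apply: kapI; rewrite -?kapE ?scale1r //.
  by rewrite -[RHS]scalerA -!kapE scalerA.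
pose kB := GRing.isZmodMorphism.Build _ _ kap kapB.
pose kM := GRing.isMonoidMorphism.Build _ _ kap kapM.
pose kappa : {rmorphism F -> Zt} := HB.pack kap kB kM.
by exists kappa.
Qed.

Lemma closure_center (z : At) : (forall x, z * x = x * z) -> is_scalar z.
Proof.
have [y [a [cy y0 ->]]] := fraction z => za.
have ca : center a.
  move=> b; apply: iota_inj; rewrite !iotaM.
  have := za (iota b); rewrite -scalerAl -scalerAr; apply: scalerI.
  by rewrite invr_eq0 denominator_neq0.
by exists ((j y)^-1 * j a); rewrite -scalerA -iota_center.
Qed.

Hypothesis primeA : is_prime A.

(** Primeness is applied to ideals that are defined as annihilators: [I] is the
    left annihilator of [A b], and [J] the right annihilator of [I A]. *)
Lemma prime_elements (a b : A) : (forall r, (a * r * b = 0)%nu) -> a = 0 \/ b = 0.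
Proof.
move=> ab; have [z cz z0] := nonzero_center.
have [a0|/eqP a0] := eqVneq a 0; first by left.
have [b0|/eqP b0] := eqVneq b 0; [by right | exfalso].
have mul0a (x : A) : (0 * x = 0)%nu by rewrite -(scale0r 0) amulZl !scale0r.
have mula0 (x : A) : (x * 0 = 0)%nu by rewrite -(scale0r 0) amulZr !scale0r.
pose I : set A := [set u | forall r, (u * r * b = 0)%nu].
pose J : set A := [set v | forall u r, I u -> (u * r * v = 0)%nu].
apply: (primeA (I := I) (J := J)).
- split=> [r|u v Iu Iv r|c u Iu r|u v Iu]; rewrite /I /=.
  + by rewrite !mul0a.
  + by rewrite !amulDl Iu Iv addr0.
  + by rewrite !amulZl Iu scaler0.
  + split=> r; first by rewrite -(amulA v) -(amulA v) Iu mula0.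
    by rewrite -(amulA u) Iu.
- split=> [u r _|u v Ju Jv w r Iw|c u Ju w r Iw|u v Ju]; rewrite /J /=.
  + by rewrite mula0.
  + by rewrite amulDr Ju // Jv // addr0.
  + by rewrite amulZr Ju // scaler0.
  + split=> w r Iw; first by rewrite amulA -(amulA w) Ju.
    by rewrite amulA Ju // mul0a.
- by move=> I0; apply: a0; have : I a by []; rewrite I0.
- move=> J0; apply: b0; have : J b by move=> u r; apply.
  by rewrite J0.
apply/seteqP; split=> [x [n [c [v [vP ->]]]]|x ->].
  apply: big1 => i _; have [u Iu [w Jw <-]] := vP i.
  have uzw : (z * (u * w) = 0)%nu by rewrite amulA cz; apply: Jw.
  by rewrite (scalar_mul_eq0 cz z0 uzw) scaler0.
exists 0%N, (fun=> 0), (fun=> 0); split; first by case.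
by rewrite big_ord0.
Qed.

Lemma closure_prime (x y : At) : (forall r, x * r * y = 0) -> x = 0 \/ y = 0.
Proof.
have [z [a [cz z0 ->]]] := fraction x; have [w [b [cw w0 ->]]] := fraction y => xy.
have [r|->|->] := @prime_elements a b; last 2 first.
- by left; rewrite raddf0 scaler0.
- by right; rewrite raddf0 scaler0.
apply: iota_inj; rewrite raddf0 !iotaM; apply/eqP.
have := xy (iota r); rewrite -!scalerAl -scalerAr scalerA => /eqP.
by rewrite scaler_eq0 mulf_eq0 !invr_eq0 !(negPf (denominator_neq0 _ _)).
Qed.

Section Scalars.
Variable kappa : {rmorphism F -> Zt}.
Hypothesis iotaZ : forall c a, iota (c *: a) = kappa c *: iota a.

Lemma iota_one e : is_one e -> iota e = 1.
Proof.
move=> e1; have [z [a [cz z0 E]]] := fraction 1.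
by rewrite -[LHS]mulr1 E -scalerAr -iotaM (e1 a).1.
Qed.

Lemma iota_poly_eval (I : choiceType) (a : I -> A) g : admissible A g ->
  iota (poly_eval a g) = eval kappa (iota \o a) g.
Proof.
move=> adm; rewrite /poly_eval raddf_sum; apply: eq_bigr => w _.
rewrite [LHS]iotaZ; case: w => -[|i w].
  case: adm => [[e e1]|g1]; last first.
    have -> : FMonom [::] = mone :> {fmonom I} by rewrite -fmoneE.
    by rewrite g1 rmorph0 !scale0r.
  rewrite wprod_nil /word_eval /one_or_zero; congr (_ *: _).
  by apply: iota_one; apply: (xgetPex 0 (P := [set e | is_one e])); exists e.
congr (_ *: _); rewrite wprod_cons /=.
elim: w (a i) => [|i' w IHw] b /=; first by rewrite wprod_nil mulr1.
by rewrite IHw iotaM wprod_cons mulrA.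
Qed.

Hypothesis char0 : [pchar F] =i pred0.

Lemma closure_char0 n : n.+1%:R != 0 :> Zt.
Proof.
rewrite -(rmorph_nat kappa) fmorph_eq0.
by have /pcharf0P-> := char0.
Qed.

Lemma closure_torsion_free n (x : At) : x *+ n.+1 = 0 -> x = 0.
Proof.
move/eqP; rewrite -scaler_nat scaler_eq0 (negPf (closure_char0 n)).
by move/eqP.
Qed.

Hypothesis piA : is_PI A.

(** A multilinear identity passes to fractions, as it is homogeneous of degree 1
    in each variable. *)
Lemma closure_finite_rank :
  exists n (b : 'I_n -> At), forall x, in_closure b [set: 'I_n]%SET x.
Proof.
have [g [/eqP g0 adm gA]] := piA.
pose X b := exists a, b = iota a.
have X0 : X 0 by exists 0; rewrite raddf0.
have XD b1 b2 : X b1 -> X b2 -> X (b1 + b2).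
  by move=> [a1 ->] [a2 ->]; exists (a1 + a2); rewrite raddfD.
have [x Xx|d [c [c1 cX]]] := multilinear_identity (kappa := kappa) X0 XD g0.
  have [a aE] := choice Xx.
  have -> : x = iota \o a by apply/funext.
  by rewrite -iota_poly_eval // gA raddf0.
apply: (PI_finite_rank c1 _ closure_prime) => y.
have [z /choice[a yE]] := choice (fun i => fraction (y i)).
have -> : \sum_s c s *: \prod_(i < d) y (s i) =
    (\prod_i (j (z i))^-1) *: \sum_s c s *: \prod_(i < d) iota (a (s i)).
  rewrite scaler_sumr; apply: eq_bigr => s _.
  have -> : \prod_(i < d) y (s i) =
      \prod_(i < d) ((j (z (s i)))^-1 *: iota (a (s i))).
    by apply: eq_bigr => i _; have [_ _ <-] := yE (s i).
  rewrite scaler_prod [LHS]scalerA [RHS]scalerA mulrC.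
  by congr (_ * _ *: _); rewrite [RHS](reindex_inj (@perm_inj _ s)).
by rewrite (cX (fun i => iota (a i))) ?scaler0 // => i; exists (a i).
Qed.

Variables (star : A -> A) (sigma : {rmorphism F -> F}).
Hypothesis starP : is_involution star sigma.
Hypothesis star1 : first_kind star.

(** Since [z] and [c z] are fixed for central [z], so is [c]. *)
Lemma first_kind_scalars c : sigma c = c.
Proof.
have [z cz z0] := nonzero_center.
have /eqP := star1 (center_scale c cz); rewrite (starZ starP) (star1 cz).
rewrite -subr_eq0 -scalerBl scaler_eq0 subr_eq0 => /orP[/eqP //|/eqP].
by move/z0.
Qed.

Lemma common_denominator x y : exists d a b, [/\ d != 0, d *: x = iota a & d *: y = iota b].
Proof.
have [z [a [cz z0 ->]]] := fraction x; have [w [b [cw w0 ->]]] := fraction y.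
have jz := denominator_neq0 cz z0; have jw := denominator_neq0 cw w0.
exists (j z * j w), (w * a)%nu, (z * b)%nu; rewrite !iotaMl // !scalerA mulf_neq0 //.
by rewrite mulfK // mulrAC divff // mul1r.
Qed.

(** The involution extends to the central closure because it fixes the
    denominators. *)
Lemma closure_involution : exists starB : At -> At,
  central_simple_involution starB /\ forall a, iota (star a) = starB (iota a).
Proof.
have [zf /choice[af fE]] := choice fraction.
pose starB b := (j (zf b))^-1 *: iota (star (af b)).
have starBE z a : center z -> z <> 0 ->
    starB ((j z)^-1 *: iota a) = (j z)^-1 *: iota (star a).
  move=> cz z0; rewrite /starB; set b := _ *: iota a.
  have [cz' z0' bE] := fE b; set z' := zf b in cz' z0' bE *; set a' := af b in bE *.
  have jz := denominator_neq0 cz z0; have jz' := denominator_neq0 cz' z0'.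
  have E : (z * a' = z' * a)%nu.
    apply: iota_inj; rewrite !iotaMl //.
    have -> : iota a = j z *: ((j z')^-1 *: iota a').
      by rewrite -bE /b scalerA mulfV // scale1r.
    by rewrite !scalerA mulrAC mulfV // mul1r.
  have E' : (z * star a' = z' * star a)%nu.
    by have := congr1 star E; rewrite !(starM starP) (star1 cz) (star1 cz') -cz -cz'.
  apply: (scalerI (mulf_neq0 jz jz')); rewrite !scalerA mulfK // mulrAC mulfV // mul1r.
  by rewrite -!iotaMl // E'.
have starBZ c x : starB (c *: x) = c *: starB x.
  have [z [y [cz z0 cy ->]]] := scalar_fraction c.
  have [w [a [cw w0 ->]]] := fraction x.
  have zw0 : (z * w)%nu <> 0 by move/(scalar_mul_eq0 cz z0).
  have czw : center (z * w)%nu.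
    by move=> b; rewrite [RHS]amulA -(cz b) -[RHS]amulA -(cw b) amulA.
  have jzw : j (z * w)%nu = j z * j w.
    apply: (@scalar_inj _ At); rewrite -iota_center // iotaMl // iota_center //.
    by rewrite scalerA.
  have -> : ((j z)^-1 * j y) *: ((j w)^-1 *: iota a) = (j (z * w)%nu)^-1 *: iota (y * a)%nu.
    by rewrite iotaMl // !scalerA jzw invfM mulrAC.
  rewrite !starBE // (starM starP) (star1 cy) -cy iotaMl // !scalerA jzw invfM.
  by rewrite mulrAC.
have starBi a : starB (iota a) = iota (star a).
  have [z cz z0] := nonzero_center; have jz := denominator_neq0 cz z0.
  have := starBE z (z * a)%nu cz z0; rewrite (starM starP) (star1 cz) -cz !iotaMl //.
  by rewrite !scalerA mulVf // !scale1r.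
have [n [b fr]] := closure_finite_rank.
exists starB; split; last by move=> a; rewrite starBi.
split.
- exact: closure_char0.
- move=> x y; have [d [a [b' [d0 xE yE]]]] := common_denominator x y.
  apply: (scalerI d0); rewrite -starBZ !scalerDr xE yE -raddfD starBi (starD starP) raddfD.
  by rewrite -!starBi -xE -yE !starBZ.
- move=> x y; have [d [a [b' [d0 xE yE]]]] := common_denominator x y.
  apply: (scalerI d0); apply: (scalerI d0).
  rewrite -!starBZ scalerAr yE scalerAl xE -iotaM starBi (starM starP) iotaM.
  by rewrite -!starBi -xE -yE !starBZ -scalerAl -scalerAr.
- move=> x; have [d [a [b' [d0 xE yE]]]] := common_denominator x x.
  by apply: (scalerI d0); rewrite -!starBZ xE !starBi (starK starP).
- exact: starBZ.
- exact: closure_center.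
exact: (finite_rank_simple closure_prime closure_torsion_free closure_center fr).
Qed.

End Scalars.
End Localization.

Section SymmetrizedTrace.
Variables (k : fieldType) (B : algType k) (star : B -> B).
Hypothesis csi : central_simple_involution star.

(** Averaging over the involution makes the trace and its elementary expression
    compatible with the involution. *)
Lemma symmetrized_trace (s : seq (B * B)) (t : B -> k) :
  (forall x, eop s x = (t x)%:A) -> (forall x y, t (x * y) = t (y * x)) -> t 1 <> 0 ->
  exists c tau, [/\ forall x, eop c x = (tau x)%:A :> B,
    forall x y : B, tau (x * y) = tau (y * x), forall x, tau (star x) = tau x,
    tau 1 <> 0 & forall y, \sum_(p <- c) star p.2 * y * star p.1 = eop c y].
Proof.
move=> tE tC t1; have sK := csi_starK csi; have sM := csi_starM csi.
exists (s ++ [seq (star p.2, star p.1) | p <- s]), (fun x => t x + t (star x)).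
have E x : \sum_(p <- s) star p.2 * x * star p.1 = (t (star x))%:A.
  have <- : star (eop s (star x)) = (t (star x))%:A by rewrite tE (csi_starZ csi) (star1 csi).
  rewrite /eop (big_morph star (csi_starD csi) (star0 csi)); apply: eq_bigr => p _.
  by rewrite !sM sK mulrA.
split.
- move=> x; rewrite /eop big_cat big_map /= -[X in X + _]/(eop s x) tE E.
  by rewrite -scalerDl.
- by move=> x y; rewrite !sM tC [in X in _ + X]tC.
- by move=> x; rewrite sK addrC.
- rewrite (star1 csi) -mulr2n -mulr_natr => /eqP.
  by rewrite mulf_eq0 (negPf (csi_char0 csi 1)) orbF => /eqP.
move=> y; rewrite /eop !big_cat !big_map /= addrC; congr (_ + _).
by apply: eq_bigr => p _; rewrite !sK.
Qed.

End SymmetrizedTrace.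

(** * Subspaces invariant under commutation with skew elements *)

Lemma lspan_incl (R : nzRingType) (V : lmodType R) (S : set V) x : S x -> lspan S x.
Proof.
move=> Sx; exists 1%N, (fun=> 1), (fun=> x); split=> //.
by rewrite big_ord1 scale1r.
Qed.

Section Spans.
Variables (k : fieldType) (B : algType k).
Implicit Types (S : set B) (X : B -> Prop).

Lemma lspan_min S X : subspace X -> (forall x, S x -> X x) -> forall x, lspan S x -> X x.
Proof.
move=> sX SX x [n [c [v [vS ->]]]]; apply: (subspace_sum _ sX) => i _.
by apply: (subspaceZ _ sX); apply: SX.
Qed.

Lemma subspace_lspan S : subspace (lspan S).
Proof.
split.
- by exists 0%N, (fun=> 0), (fun=> 0); split; [case | rewrite big_ord0].
- move=> _ _ [n [c [v [vS ->]]]] [m [e [w [wS ->]]]].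
  pose u T (f : 'I_n -> T) (g : 'I_m -> T) (i : 'I_(n + m)) :=
    match split i with inl i => f i | inr i => g i end.
  exists (n + m)%N, (u _ c e), (u _ v w); split.
    by move=> i; rewrite /u; case: (split i).
  rewrite big_split_ord; congr (_ + _); apply: eq_bigr => i _; rewrite /u.
    by rewrite (unsplitK (inl i : 'I_n + 'I_m)%type).
  by rewrite (unsplitK (inr i : 'I_n + 'I_m)%type).
- move=> a _ [n [c [v [vS ->]]]]; exists n, (fun i => a * c i), v; split=> //.
  by rewrite scaler_sumr; apply: eq_bigr => i _; rewrite scalerA.
Qed.

End Spans.

Section InvariantSubspaces.
Variables (k : fieldType) (B : algType k) (star : B -> B).
Hypothesis csi : central_simple_involution star.
Local Notation sym := (sym star).
Local Notation skew := (skew star).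
Hypothesis not_low :
  ~ (basis_of (@everything _ B) 1 \/ basis_of (@everything _ B) 4).
Hypothesis not16 : ~ basis_of (@everything _ B) 16.
Variables (J : finType) (v : J -> B) (lam : J -> B -> k).
Hypothesis coordinates : forall x, x = \sum_i lam i x *: v i.
Hypothesis lam_elementary : forall i, elementary (fun x => (lam i x)%:A : B).
Variables (e : seq (B * B)) (tau : B -> k).
Hypothesis tauE : forall x, eop e x = (tau x)%:A.
Hypothesis tauC : forall x y, tau (x * y) = tau (y * x).
Hypothesis tau_star : forall x, tau (star x) = tau x.
Hypothesis tau1 : tau 1 <> 0.
Hypothesis e_star : forall y, \sum_(p <- e) star p.2 * y * star p.1 = eop e y.

Local Notation SK := (comm_span sym skew).

Lemma SK_comm s l : sym s -> skew l -> SK (s * l - l * s).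
Proof. by move=> ss sl; apply: lspan_incl; exists s => //; exists l. Qed.

Lemma SK_sym n : SK n -> sym n.
Proof.
apply: lspan_min => [|_ [s ss [l sl <-]]]; first exact: subspace_sym.
exact: sym_skew_comm.
Qed.

Lemma subspace_tau : subspace (fun x => tau x = 0).
Proof.
split=> [|x y tx ty|c x tx]; first exact: (tau0 tauE).
  by rewrite (tauD tauE) tx ty addr0.
by rewrite (tauZ tauE) tx mulr0.
Qed.

Lemma tau_comm x y : tau (x * y - y * x) = 0.
Proof. by rewrite (tauD tauE) (tauN tauE) (tauC x) addrN. Qed.

Lemma SK_tau n : SK n -> tau n = 0.
Proof.
apply: (lspan_min (X := fun x => tau x = 0)) => [|_ [s ss [l sl <-]]].
  exact: subspace_tau.
exact: tau_comm.
Qed.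

Lemma skew_tau l : skew l -> tau l = 0.
Proof.
move=> sl; have := tau_star l; rewrite sl (tauN tauE) => E; apply/eqP.
have : tau l *+ 2 == 0 by rewrite mulr2n -{1}E addNr.
by rewrite -mulr_natr mulf_eq0 (negPf (csi_char0 csi 1)) orbF.
Qed.

Lemma scalar_tau c : tau (c%:A) = 0 -> c = 0.
Proof.
rewrite (tauZ tauE) => /eqP; rewrite mulf_eq0 => /orP[/eqP //|/eqP].
by move/tau1.
Qed.

Lemma SK_scalar n : SK n -> is_scalar n -> n = 0.
Proof. by move=> Nn [c E]; have := SK_tau Nn; rewrite E => /scalar_tau->; rewrite scale0r. Qed.

Lemma skew_scalar l : skew l -> is_scalar l -> l = 0.
Proof. by move=> sl /(scalar_sym csi) ss; apply: (sym_skew_eq0 csi). Qed.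

Lemma exists_skew : exists2 l, skew l & l <> 0.
Proof.
apply: contrapT => H; apply: not_low; apply: (skew_products_scalar csi) => x y sx _.
have -> : x = 0 by apply: contrapT => x0; apply: H; exists x.
by exists 0; rewrite mul0r scale0r.
Qed.

Lemma exists_SK : exists2 n, SK n & n <> 0.
Proof.
apply: contrapT => H; apply: not_low; apply: (sym_scalar_low csi) => s ss.
apply: (commute_skew csi not_low) => l sl; apply/eqP; rewrite -subr_eq0; apply/eqP.
by apply: contrapT => n0; apply: H; exists (s * l - l * s) => //; apply: SK_comm.
Qed.

Lemma sym_scalar_SK s : sym s -> exists c n, SK n /\ s = c%:A + n.
Proof.
apply: (sym_decomposition csi not_low coordinates lam_elementary tauE tauC tau_star tau1
  (X := fun s => exists c n, SK n /\ s = c%:A + n)).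
- have [N0 ND NZ] := subspace_lspan [set s * l - l * s | s in sym & l in skew].
  split.
  + by exists 0, 0; split=> //; rewrite scale0r addr0.
  + move=> _ _ [a [n [Nn ->]]] [b [m [Nm ->]]]; exists (a + b), (n + m).
    by split; [exact: ND | rewrite scalerDl addrACA].
  + move=> a _ [b [n [Nn ->]]]; exists (a * b), (a *: n).
    by split; [exact: NZ | rewrite scalerDr scalerA].
- by exists 1, 0; split; [case: (subspace_lspan (B := B) [set s * l - l * s | s in sym & l in skew]) | rewrite scale1r addr0].
- by move=> t l st sl; exists 0, (t * l - l * t); rewrite scale0r add0r; split=> //; apply: SK_comm.
Qed.

Lemma skew_comm_everything l : skew l -> comm_span [set: B] [set: B] l.
Proof.
apply: (skew_perfect csi not_low coordinates lam_elementary tauE tauC tau_star tau1).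
  exact: subspace_lspan.
by move=> x y _ _; apply: lspan_incl; exists x => //; exists y.
Qed.

Lemma commutators_dec x : comm_span [set: B] [set: B] x ->
  exists n l, [/\ SK n, skew l & x = n + l].
Proof.
have [N0 ND NZ] := subspace_lspan [set s * l - l * s | s in sym & l in skew].
have [K0 KD KZ] := subspace_skew csi.
apply: (lspan_min (X := fun x => exists n l, [/\ SK n, skew l & x = n + l])) =>
    [|_ [y _ [z _ <-]]].
  split.
  + by exists 0, 0; split=> //; rewrite addr0.
  + move=> _ _ [n [l [Nn sl ->]]] [m [l' [Nm sl' ->]]]; exists (n + m), (l + l').
    by split; [exact: ND | exact: KD | rewrite addrACA].
  + move=> a _ [n [l [Nn sl ->]]]; exists (a *: n), (a *: l).
    by split; [exact: NZ | exact: KZ | rewrite scalerDr].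
have [s [l [ss sl -> _ _]]] := sym_skew_dec csi y.
have [t [m [st sm -> _ _]]] := sym_skew_dec csi z.
exists ((s * m - m * s) + -1 *: (t * l - l * t)), ((s * t - t * s) + (l * m - m * l)); split.
- by apply: ND; [|apply: NZ]; apply: SK_comm.
- by apply: KD; [exact: sym_comm|exact: skew_comm].
by rewrite scaleN1r; ncring.
Qed.

Variable L : B -> Prop.
Hypothesis LK : skew_invariant star L.

Let sL : subspace L. Proof. by case: LK. Qed.

(** If [L] has nonsymmetric elements it contains the skew part of [x], hence the
    symmetric part as well. If the symmetric elements of [L] are not all scalars
    it contains the [[S, K]]-part of the latter, hence its scalar part. *)
Lemma invariant_dec x : L x -> exists c n l,
  [/\ x = c%:A + n + l, SK n /\ skew l, c = 0 \/ L 1,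
      n = 0 \/ (forall m, SK m -> L m) & l = 0 \/ (forall m, skew m -> L m)].
Proof.
have symL s : L s -> sym s -> exists c n,
    [/\ s = c%:A + n, SK n, c = 0 \/ L 1 & n = 0 \/ (forall m, SK m -> L m)].
  have scL c : L (c%:A) -> c = 0 \/ L 1.
    move=> Lc; have [->|c0] := eqVneq c 0; [by left | right].
    by have := subspaceZ c^-1 sL Lc; rewrite scalerA mulVf // scale1r.
  have [N0 _ _] := subspace_lspan [set s * l - l * s | s in sym & l in skew].
  move=> Ls ss; have [H|H] := sym_invariant_dichotomy csi not_low coordinates LK.
    have [c E] := H s Ls ss; exists c, 0; split=> //; [by rewrite addr0 | | by left].
    by apply: scL; rewrite -E.
  have NL m : SK m -> L m by apply: lspan_min => // _ [t st [l sl <-]]; apply: H.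
  have [c [n [Nn E]]] := sym_scalar_SK ss; exists c, n; split=> //; last by right.
  apply: scL; have -> : c%:A = s - n :> B by rewrite E addrK.
  by apply: (subspaceB sL) => //; apply: NL.
move=> Lx.
have [H|H] := skew_invariant_dichotomy csi not_low coordinates lam_elementary tauE
  tauC tau_star tau1 e_star not16 LK.
  have [c [n [E Nn Hc Hn]]] := symL x Lx (H x Lx); exists c, n, 0; split=> //; [| |by left].
    by rewrite addr0.
  by split=> //; case: (subspace_skew csi).
have [s [l [ss sl E _ _]]] := sym_skew_dec csi x.
have Ls : L s.
  have -> : s = x - l by rewrite E addrK.
  by apply: (subspaceB sL) => //; apply: H.
have [c [n [Es Nn Hc Hn]]] := symL s Ls ss.
by exists c, n, l; split=> //; [rewrite -Es | right].
Qed.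

(** The occurrence in [L] of the scalars, of [[S, K]] and of [K]: the inclusions
    and equalities below are all expressed by these three. *)
Definition Zpart := L 1.
Definition Npart := forall m, SK m -> L m.
Definition Kpart := forall m, skew m -> L m.

Lemma mem_parts c n l : SK n -> skew l ->
  c = 0 \/ Zpart -> n = 0 \/ Npart -> l = 0 \/ Kpart -> L (c%:A + n + l).
Proof.
have [L0 LD LZ] := sL => Nn sl hc hn hl; apply: (LD); first apply: (LD).
- by case: hc => [->|]; [rewrite scale0r | exact: LZ].
- by case: hn => [->|]; [| exact].
by case: hl => [->|]; [| exact].
Qed.

Lemma Npart_not_scalar (X : B -> Prop) : (forall x, L x -> X x) ->
  (forall n, SK n -> X n -> n = 0) -> ~ Npart.
Proof.
by move=> LX H N; have [n Nn n0] := exists_SK; apply: n0; apply: H => //; apply/LX/N.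
Qed.

Lemma Kpart_not (X : B -> Prop) : (forall x, L x -> X x) ->
  (forall l, skew l -> X l -> l = 0) -> ~ Kpart.
Proof.
by move=> LX H K; have [l sl l0] := exists_skew; apply: l0; apply: H => //; apply/LX/K.
Qed.

Lemma sub_zero : (forall x, L x -> x = 0) <-> [/\ ~ Zpart, ~ Npart & ~ Kpart].
Proof.
split=> [H|[hZ hN hK] x /invariant_dec[c [n [l [-> _ hc hn hl]]]]].
  split; [by move=> /H/eqP; rewrite oner_eq0 | |].
    exact: (Npart_not_scalar H).
  exact: (Kpart_not H).
by case: hc hn hl => [->|/hZ//] [->|/hN//] [->|/hK//]; rewrite scale0r !addr0.
Qed.

Lemma sub_scalar : (forall x, L x -> is_scalar x) <-> ~ Npart /\ ~ Kpart.
Proof.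
split=> [H|[hN hK] x /invariant_dec[c [n [l [-> _ hc hn hl]]]]].
  split; [exact: (Npart_not_scalar H SK_scalar) | exact: (Kpart_not H skew_scalar)].
by exists c; case: hn hl => [->|/hN//] [->|/hK//]; rewrite !addr0.
Qed.

Lemma sub_skew : (forall x, L x -> skew x) <-> ~ Zpart /\ ~ Npart.
Proof.
split=> [H|[hZ hN] x /invariant_dec[c [n [l [-> [_ sl] hc hn hl]]]]].
  split.
    move=> /H/(sym_skew_eq0 csi (star1 csi))/eqP.
    by rewrite oner_eq0.
  apply: (Npart_not_scalar H) => n /SK_sym; exact: sym_skew_eq0.
by case: hc hn => [->|/hZ//] [->|/hN//]; rewrite scale0r !add0r.
Qed.

Lemma sub_sym : (forall x, L x -> sym x) <-> ~ Kpart.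
Proof.
split=> [H|hK x /invariant_dec[c [n [l [-> [Nn _] hc hn hl]]]]].
  by apply: (Kpart_not H) => l sl sy; apply: (sym_skew_eq0 csi).
case: hl => [->|/hK//]; rewrite addr0; apply: (subspaceD (subspace_sym csi)).
  by apply: (scalar_sym csi); exists c.
exact: SK_sym.
Qed.

Lemma sub_trace : (forall x, L x -> tau x = 0) <-> ~ Zpart.
Proof.
split=> [H /H //|hZ x /invariant_dec[c [n [l [-> [Nn sl] hc hn hl]]]]].
case: hc => [->|/hZ//]; rewrite scale0r add0r (tauD tauE) SK_tau // skew_tau //.
by rewrite addr0.
Qed.

Lemma sub_sum_scalar : (forall x, L x -> is_scalar (x + star x)) <-> ~ Npart.
Proof.
split=> [H|hN x /invariant_dec[c [n [l [-> [Nn sl] hc hn hl]]]]].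
  apply: (Npart_not_scalar H) => n Nn; rewrite (SK_sym Nn) => sc; apply: SK_scalar => //.
  by rewrite -(halfK (csi_char0 csi 1) n) -scalerDr; apply: (subspaceZ _ (@subspace_scalar _ B)).
case: hn => [->|/hN//]; exists (c + c).
by rewrite addr0 (csi_starD csi) (csi_starZ csi) (star1 csi) sl addrACA addrN addr0 scalerDl.
Qed.

Lemma value_zero : ~ Zpart -> ~ Npart -> ~ Kpart -> L = [set 0].
Proof.
move=> hZ hN hK; apply/seteqP; split=> x; last by move=> ->; case: sL.
exact: (sub_zero.2 (And3 hZ hN hK)).
Qed.

Lemma value_scalar : Zpart -> ~ Npart -> ~ Kpart -> L = @is_scalar k B.
Proof.
move=> hZ hN hK; apply/seteqP; split=> x; first exact: (sub_scalar.2 (conj hN hK)).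
by case=> c ->; apply: (subspaceZ _ sL).
Qed.

Lemma value_skew : ~ Zpart -> ~ Npart -> Kpart -> L = skew.
Proof.
by move=> hZ hN hK; apply/seteqP; split=> x; [exact: (sub_skew.2 (conj hZ hN)) | exact: hK].
Qed.

Lemma value_scalar_skew : Zpart -> ~ Npart -> Kpart -> L = add_set (@is_scalar k B) skew.
Proof.
move=> hZ hN hK; apply/seteqP; split=> x.
  move=> /invariant_dec[c [n [l [-> [Nn sl] hc [->|//] hl]]]].
  by exists (c%:A); [exists c | exists l => //; rewrite addr0].
case=> _ [c ->] [l sl <-]; have := @mem_parts c 0 l; rewrite addr0; apply; auto.
by case: (subspace_lspan (B := B) [set s * l - l * s | s in sym & l in skew]).
Qed.

Lemma value_SK : ~ Zpart -> Npart -> ~ Kpart -> L = SK.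
Proof.
move=> hZ hN hK; apply/seteqP; split=> x; last exact: hN.
move=> /invariant_dec[c [n [l [-> [Nn sl] [->|//] hn [->|//]]]]].
by rewrite scale0r add0r addr0.
Qed.

Lemma value_sym : Zpart -> Npart -> ~ Kpart -> L = sym.
Proof.
move=> hZ hN hK; apply/seteqP; split=> x; first exact: (sub_sym.2 hK).
move=> /sym_scalar_SK[c [n [Nn ->]]]; rewrite -[_ + n]addr0.
by apply: mem_parts; auto; case: (subspace_skew csi).
Qed.

Lemma value_commutators : ~ Zpart -> Npart -> Kpart -> L = comm_span [set: B] [set: B].
Proof.
move=> hZ hN hK; apply/seteqP; split=> x.
  move=> /invariant_dec[c [n [l [-> [Nn sl] [->|//] hn hl]]]]; rewrite scale0r add0r.
  apply: subspaceD (subspace_lspan _) _ (skew_comm_everything sl).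
  apply: lspan_min Nn => [|_ [s _ [m _ <-]]]; first exact: subspace_lspan.
  by apply: lspan_incl; exists s => //; exists m.
by move/commutators_dec=> [n [l [Nn sl ->]]]; apply: (subspaceD sL); [exact: hN|exact: hK].
Qed.

Lemma value_everything : Zpart -> Npart -> Kpart -> L = [set: B].
Proof.
move=> hZ hN hK; apply/seteqP; split=> // x _.
have [s [l [ss sl -> _ _]]] := sym_skew_dec csi x.
have [c [n [Nn ->]]] := sym_scalar_SK ss.
by apply: mem_parts; auto.
Qed.

End InvariantSubspaces.

(** * The span of the values of a polynomial *)

Section ValueSpan.
Variables (F k : fieldType) (kappa : {rmorphism F -> k}) (B : algType k) (star : B -> B).
Hypothesis csi : central_simple_involution star.
Variables (L : choiceType) (bar : L -> L) (index : L -> nat) (starred : L -> bool).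
Hypothesis barK : involutive bar.
Hypothesis index_bar : forall i, index (bar i) = index i.
Hypothesis starred_bar : forall i, starred (bar i) = ~~ starred i.
Variable Y : B -> Prop.
Hypothesis Y0 : Y 0.
Hypothesis YD : forall x y, Y x -> Y y -> Y (x + y).
Hypothesis YN : forall x, Y x -> Y (- x).
Hypothesis YM : forall x y, Y x -> Y y -> Y (x * y).
Hypothesis Ystar : forall x, Y x -> Y (star x).
Hypothesis Yspan : forall b, exists c y, Y y /\ b = c *: y.
Local Notation poly := {malg F[{fmonom L}]}.
Implicit Types (f g h p q : poly).
Local Notation bar_poly := (bar_poly bar).

Let starD x y : star (x + y) = star x + star y. Proof. exact: csi_starD csi x y. Qed.
Let starM x y : star (x * y) = star y * star x. Proof. exact: csi_starM csi x y. Qed.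
Let starK x : star (star x) = x. Proof. exact: csi_starK csi x. Qed.
Let starZ (c : k) x : star (c *: x) = c *: star x. Proof. exact: csi_starZ csi c x. Qed.

Definition value a g : B := eval kappa (letters star index starred a) g.

Definition value_set g : set B := [set x | exists2 a, (forall i, Y (a i)) & x = value a g].

Local Notation span g := (lspan (value_set g)).

Lemma value_bar a g : value a (bar_poly g) = star (value a g).
Proof. exact: eval_star. Qed.

Lemma span_sub (X : B -> Prop) g : subspace X ->
  (forall x, span g x -> X x) <-> (forall a, (forall i, Y (a i)) -> X (value a g)).
Proof.
move=> sX; split=> [H a Ya|H x]; first by apply/H/lspan_incl; exists a.
by apply: lspan_min => // _ [a Ya ->]; apply: H.
Qed.

Lemma dword_commutator (x : L -> B) l w :
  dword x (fun i => x i * l - l * x i) w = wprod x w * l - l * wprod x w.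
Proof.
elim: w => [|i w IHw]; last by rewrite dword_cons IHw !wprod_cons; ncring.
by rewrite /dword big_ord0 wprod_nil mul1r mulr1 subrr.
Qed.

(** The substitution of [a + t [a, l]] for [a] is compatible with the involution
    for skew [l], and its linear part is the commutator of the value with [l]. *)
Lemma span_invariant f : skew_invariant star (span f).
Proof.
split=> [|x l]; first exact: subspace_lspan.
have sL := subspace_lspan (value_set f).
move=> Lx sl; have [c [y [Yy lE]]] := Yspan l.
pose m := y - star y.
have sm : star m = - m by rewrite /m starD (starN csi) starK opprB addrC.
have -> : l = (2^-1 * c) *: m.
  rewrite -scalerA /m scalerBr -starZ -lE sl opprK scalerDr halfK //.
  exact: (csi_char0 csi 1).
rewrite -scalerAl -scalerAr -scalerBr; apply: (subspaceZ _ sL).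
apply: (lspan_min (X := fun x => span f (x * m - m * x))) Lx => [|_ [a Ya ->]].
  split=> [|u v Lu Lv|b u Lu].
  - by rewrite mul0r mulr0 subr0; case: sL.
  - have -> : (u + v) * m - m * (u + v) = (u * m - m * u) + (v * m - m * v) by ncring.
    exact: subspaceD.
  - by rewrite -scalerAl -scalerAr -scalerBr; apply: subspaceZ.
have Ym : Y m by apply: YD => //; apply/YN/Ystar.
set z := letters star index starred a.
have := @linear_coef_subspace F k kappa B (csi_char0 csi) _ sL _ f z
  (fun i => z i * m - m * z i).
have <- : \sum_(w <- msupp f) kappa f@_w *: dword z (fun i => z i * m - m * z i) w =
    value a f * m - m * value a f.
  rewrite /value /eval mulr_suml mulr_sumr -sumrB; apply: eq_bigr => w _.
  by rewrite dword_commutator scalerBr -scalerAl -scalerAr.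
apply=> t; apply: lspan_incl.
exists (fun n => a n + (t%:R : k) *: (a n * m - m * a n)) => [n|].
  apply: YD => //; elim: t => [|t IHt]; first by rewrite scale0r.
  rewrite mulrS scalerDl scale1r; apply: YD => //.
  by apply: YD; [|apply: YN]; apply: YM.
congr (eval _ _ _); apply: functional_extensionality_dep => i; rewrite /z /letters.
case: (starred i) => //; rewrite starD starZ; congr (_ + _ *: _).
by rewrite starD (starN csi) !starM sm mulrN mulNr opprK addrC.
Qed.

Variables (e : seq (B * B)) (tau : B -> k).
Hypothesis tauE : forall x, eop e x = (tau x)%:A.
Hypothesis tauC : forall x y, tau (x * y) = tau (y * x).
Hypothesis tau_star : forall x, tau (star x) = tau x.
Hypothesis tau1 : tau 1 <> 0.

Variable adm : poly -> Prop.
Hypothesis adm_coef1 : forall g, g@_mone = 0 -> adm g.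
Hypothesis admD : forall g h, adm g -> adm h -> adm (g + h).
Hypothesis admZ : forall c g, adm g -> adm (c *: g).
Hypothesis adm_bar : forall g, adm g -> adm (bar_poly g).

Definition identity : set poly :=
  [set g | adm g /\ forall a, (forall i, Y (a i)) -> value a g = 0].

Definition central_poly : set poly :=
  [set g | [/\ adm g, ~ identity g &
    forall a, (forall i, Y (a i)) -> is_scalar (value a g)]].

Definition cyclic_identity g := exists2 h, identity h & comm_sum (g - h).

Let subspace_zero : subspace (fun x : B => x = 0).
Proof. by split=> [//|x y -> ->|c x ->]; rewrite ?addr0 ?scaler0. Qed.

Let admN g : adm g -> adm (- g). Proof. by rewrite -scaleN1r; apply: admZ. Qed.

Let half : F := 2^-1.

Let twoF : 2%:R != 0 :> F.
Proof. by rewrite -(fmorph_eq0 kappa) rmorph_nat (csi_char0 csi 1). Qed.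

Let kappa_half : kappa half = 2^-1.
Proof. by rewrite fmorphV rmorph_nat. Qed.

Let halves f : half *: (f - bar_poly f) + half *: (f + bar_poly f) = f.
Proof.
have H (V : lmodType F) (u w : V) : half *: (u - w) + half *: (u + w) = u.
  by rewrite -scalerDr addrACA addNr addr0 -mulr2n -scaler_nat scalerA mulVf // scale1r.
exact: H.
Qed.

Let half_skew f : bar_poly (half *: (f - bar_poly f)) = - (half *: (f - bar_poly f)).
Proof. by rewrite bar_polyZ // bar_polyD // bar_polyN // bar_polyK // -scalerN opprB addrC. Qed.

Let half_sym f : bar_poly (half *: (f + bar_poly f)) = half *: (f + bar_poly f).
Proof.
have E : bar_poly (f + bar_poly f) = f + bar_poly f.
  rewrite [LHS](bar_polyD barK) (bar_polyK barK f); exact: addrC.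
rewrite [LHS](bar_polyZ barK) E; exact: erefl.
Qed.

Let value_half_skew a f : value a (half *: (f - bar_poly f)) = 2^-1 *: (value a f - star (value a f)).
Proof. by rewrite /value evalZ evalD evalN kappa_half -value_bar. Qed.

Let value_half_sym a f : value a (half *: (f + bar_poly f)) = 2^-1 *: (value a f + star (value a f)).
Proof. by rewrite /value evalZ evalD kappa_half -value_bar. Qed.

Lemma identityP f : adm f -> identity f <-> (forall x, span f x -> x = 0).
Proof. by move=> af; split=> [[_ H]|H]; [|split=> //]; apply/(span_sub f subspace_zero). Qed.

Lemma central_polyP f : adm f ->
  central_poly f <-> ~ (forall x, span f x -> x = 0) /\ (forall x, span f x -> is_scalar x).
Proof.
move=> af; split=> [[_ H1 H2]|[H1 H2]]; split=> //.
- by move/(identityP af).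
- by apply/(span_sub f (@subspace_scalar _ B)).
- by move/(identityP af).
- by apply/(span_sub f (@subspace_scalar _ B)).
Qed.

(** Here and below, [f] is split into the halves of [f - f^*] and [f + f^*]. *)
Lemma skew_identityP f : adm f ->
  add_set [set p | bar_poly p = - p] identity f <-> (forall x, span f x -> skew star x).
Proof.
move=> af; rewrite span_sub; last exact: subspace_skew.
split=> [[p pE [q [_ q0] <-]] a Ya|H].
  by rewrite /value evalD -/(value a q) q0 // addr0 /skew -value_bar pE /value evalN.
exists (half *: (f - bar_poly f)); first exact: half_skew.
exists (half *: (f + bar_poly f)); last exact: halves.
split; first by apply/admZ/admD/adm_bar.
by move=> a Ya; rewrite value_half_sym (H a Ya) addrN scaler0.
Qed.

Lemma sym_identityP f : adm f ->
  add_set [set p | bar_poly p = p] identity f <-> (forall x, span f x -> sym star x).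
Proof.
move=> af; rewrite span_sub; last exact: subspace_sym.
split=> [[p pE [q [_ q0] <-]] a Ya|H].
  by rewrite /value evalD -/(value a q) q0 // addr0 /sym -value_bar pE.
exists (half *: (f + bar_poly f)); first exact: half_sym.
exists (half *: (f - bar_poly f)); last by rewrite addrC halves.
split; first by apply/admZ/admD => //; apply/admN/adm_bar.
by move=> a Ya; rewrite value_half_skew (H a Ya) addrN scaler0.
Qed.

(** If [f = p + q] with [p] skew and [q] central, the values satisfy
    [x + x^* = 2 q(a)]. *)
Lemma skew_centralP f : adm f ->
  add_set [set p | bar_poly p = - p] central_poly f <->
  (forall x, span f x -> is_scalar (x + star x)) /\ ~ (forall x, span f x -> skew star x).
Proof.
have two0 := csi_char0 csi 1; move=> af.
have sS : subspace (fun x => is_scalar (x + star x)).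
  split=> [|x y hx hy|c x hx].
  - by exists 0; rewrite (star0 csi) addr0 scale0r.
  - by rewrite starD addrACA; apply: (subspaceD (@subspace_scalar _ B)).
  - by rewrite starZ -scalerDr; apply: (subspaceZ _ (@subspace_scalar _ B)).
rewrite (span_sub f sS) (span_sub f (subspace_skew csi)).
split=> [[p pE [q [aq qI qs] <-]]|[H1 H2]].
  have E a : (forall i, Y (a i)) ->
      value a (p + q) + star (value a (p + q)) = value a q + value a q.
    move=> Ya; have sq : star (value a q) = value a q by apply: (scalar_sym csi); apply: qs.
    rewrite -value_bar bar_polyD // pE /value !evalD evalN addrACA addrN add0r.
    by rewrite -/(value a q) -/(value a (bar_poly q)) value_bar sq.
  split=> [a Ya|H].
    by rewrite E //; apply: (subspaceD (@subspace_scalar _ B)); apply: qs.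
  apply: qI; split=> // a Ya; apply: (double_eq0 two0).
  by rewrite -E // H // addrN.
exists (half *: (f - bar_poly f)); first exact: half_skew.
exists (half *: (f + bar_poly f)); last exact: halves.
have aq : adm (half *: (f + bar_poly f)) by apply/admZ/admD/adm_bar.
split=> // [[_ H]|a Ya].
  apply: H2 => a Ya; have := H a Ya; rewrite value_half_sym => /eqP.
  rewrite scaler_eq0 invr_eq0 (negPf two0) => /eqP E.
  by apply/eqP; rewrite -addr_eq0 addrC E.
by rewrite value_half_sym; apply: (subspaceZ _ (@subspace_scalar _ B)); apply: H1.
Qed.

Lemma tau_value_comm_sum a g : comm_sum g -> tau (value a g) = 0.
Proof.
case=> n [p [q ->]]; rewrite /value eval_sum (tau_sum tauE) big1 // => i _.
by rewrite evalD evalN [X in X - _]evalM [X in _ - X]evalM (tauD tauE) (tauN tauE) tauC addrN.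
Qed.

(** The value of [f] at 0 is its constant term. *)
Lemma trace_zero_coef1 f : (forall x, span f x -> tau x = 0) -> f@_mone = 0.
Proof.
move=> H; have : tau (value (fun=> 0) f) = 0 by apply/H/lspan_incl; exists (fun=> 0).
have -> : value (fun=> 0) f = (kappa f@_mone)%:A.
  have z0 i : letters star index starred (fun=> 0) i = 0.
    by rewrite /letters (star0 csi); case: (starred i).
  have w0 (w : {fmonom L}) : w != mone -> wprod (letters star index starred (fun=> 0)) w = 0.
    by rewrite fmP fm1; case: w => -[|i w] //= _; rewrite wprod_cons z0 mul0r.
  rewrite /value (evalEw _ _ (fsubsetUl (msupp f) [fset mone]%fset)).
  have m1 : mone \in (msupp f `|` [fset mone])%fset by rewrite in_fsetU in_fset1 eqxx orbT.
  rewrite (big_fsetD1 _ m1) /= [X in _ + X]big_seq [X in _ + X]big1 => [|w].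
    by rewrite fm1 wprod_nil addr0.
  by rewrite in_fsetD1 => /andP[wn _]; rewrite w0 ?scaler0.
rewrite (tauZ tauE) => /eqP; rewrite mulf_eq0 fmorph_eq0 => /orP[/eqP //|/eqP].
by move/tau1.
Qed.

(** The trace kills the commutators, hence is the same for the values of cyclically
    equivalent polynomials; and it does not change under the involution. *)
Lemma cyclic_sum_identityP f :
  cyclic_identity (f + bar_poly f) <-> (forall x, span f x -> tau x = 0).
Proof.
split=> [[h [ah h0] ch]|H].
  apply/(span_sub f (subspace_tau tauE)) => a Ya.
  have := tau_value_comm_sum a ch.
  rewrite /value !evalD evalN -![eval _ _ _]/(value a _) h0 // subr0 value_bar (tauD tauE).
  rewrite tau_star -mulr2n -mulr_natr => /eqP.
  by rewrite mulf_eq0 (negPf (csi_char0 csi 1)) orbF => /eqP.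
have tf a : (forall i, Y (a i)) -> tau (eval kappa (letters star index starred a) f) = 0.
  by move=> Ya; apply/H/lspan_incl; exists a.
have [h [ch h1 h0]] := trace_zero_cyclic barK csi index_bar starred_bar (tauD tauE)
  (tauZ tauE) tauC tau_star (tau_nondegenerate csi tauE tauC tau1) Y0 YD Yspan
  (trace_zero_coef1 H) tf.
by exists h => //; split=> //; apply: adm_coef1.
Qed.

(** If the values are symmetric, [f - f^*] is an identity, so [f] and the half of
    [f + f^*] differ by an identity. *)
Lemma cyclic_identityP f : adm f -> (forall x, span f x -> sym star x) ->
  cyclic_identity f <-> (forall x, span f x -> tau x = 0).
Proof.
move=> af fs; split=> [[h [ah h0] ch]|H].
  apply/(span_sub f (subspace_tau tauE)) => a Ya.
  have := tau_value_comm_sum a ch.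
  by rewrite /value !evalD evalN -![eval _ _ _]/(value a _) h0 // subr0.
have [h [ah h0] ch] := (cyclic_sum_identityP f).2 H.
exists (half *: (h + (f - bar_poly f))).
  split; first by apply/admZ/admD => //; apply/admD => //; apply/admN/adm_bar.
  move=> a Ya; rewrite /value evalZ !evalD evalN -![eval _ _ _]/(value a _) h0 // add0r.
  have -> : value a (bar_poly f) = value a f.
    by rewrite value_bar; apply/fs/lspan_incl; exists a.
  by rewrite addrN scaler0.
have -> : f - half *: (h + (f - bar_poly f)) = half *: (f + bar_poly f - h).
  have H3 (V : zmodType) (u w z : V) : (u + w) - (z + u) = w - z.
    by rewrite [z + u]addrC opprD addrACA addrN add0r.
  rewrite -{1}(halves f) -scalerDr -scalerBr; congr (_ *: _); exact: H3.
exact: comm_sumZ.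
Qed.

End ValueSpan.

(** * Values in the central closure *)

Section ImageValues.
Variables (F : fieldType) (A : nuAlgType F).
Variables (Zt : fieldType) (At : algType Zt) (iota : {additive A -> At}) (j : A -> Zt).
Hypothesis iota_inj : injective iota.
Hypothesis iotaM : forall a b, iota (a * b)%nu = iota a * iota b.
Hypothesis iota_center : forall z, center z -> iota z = (j z)%:A.
Hypothesis scalar_fraction :
  forall k : Zt, exists z y, [/\ center z, z <> 0, center y & k = (j z)^-1 * j y].
Hypothesis fraction : forall b, exists z a, [/\ center z, z <> 0 & b = (j z)^-1 *: iota a].
Variable kappa : {rmorphism F -> Zt}.
Hypothesis iotaZ : forall c a, iota (c *: a) = kappa c *: iota a.
Variables (star : A -> A) (starB : At -> At).
Hypothesis csi : central_simple_involution starB.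
Hypothesis iota_star : forall a, iota (star a) = starB (iota a).
Variables (sigma : {rmorphism F -> F}).
Hypothesis sigma_id : forall c, sigma c = c.

Definition flip_star (i : nat * bool) := (i.1, ~~ i.2).

Lemma flip_starK : involutive flip_star.
Proof. by case=> n b; rewrite /flip_star /= negbK. Qed.

Lemma poly_star_bar (g : starPoly F) : poly_star sigma g = bar_poly flip_star g.
Proof. by apply: eq_bigr => w _; rewrite sigma_id. Qed.

Definition in_image (b : At) := exists a, b = iota a.

Local Notation value := (value kappa starB fst snd).
Local Notation value_set := (value_set kappa starB fst snd in_image).

Lemma iota_star_eval a (g : starPoly F) : admissible A g ->
  iota (star_eval star a g) = value (iota \o a) g.
Proof.
move=> adm; rewrite /star_eval (iota_poly_eval iotaM fraction iotaZ) //.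
by congr (eval _ _ _); apply/funext => -[n []] /=.
Qed.

Lemma image_valuation (a : nat -> At) : (forall i, in_image (a i)) ->
  exists a', a = iota \o a'.
Proof. by move=> /choice[a' aE]; exists a'; apply/funext. Qed.

Lemma image_values g : admissible A g -> iota @` values star g = value_set g.
Proof.
move=> adm; apply/seteqP; split=> [_ [_ [a _ <-] <-]|_ [a /image_valuation[a' ->] ->]].
  by exists (iota \o a); [move=> i; exists (a i) | exact: iota_star_eval].
by exists (star_eval star a' g); [exists a' | exact: iota_star_eval].
Qed.

Lemma tilde_span g : admissible A g -> tilde iota (lspan (values star g)) = lspan (value_set g).
Proof.
move=> adm; rewrite -image_values //; apply/seteqP; split=> x.
  apply: lspan_min => [|_ [_ [n [c [v [vS ->]]]] <-]]; first exact: subspace_lspan.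
  rewrite raddf_sum; apply: (subspace_sum _ (subspace_lspan _)) => i _.
  by rewrite [iota _]iotaZ; apply: (subspaceZ _ (subspace_lspan _)); apply: lspan_incl; exists (v i).
apply: lspan_min => [|_ [y yS <-]]; first exact: subspace_lspan.
by apply: lspan_incl; exists y => //; apply: lspan_incl.
Qed.

Lemma Id_identity : Id star = identity kappa starB fst snd in_image (@admissible F A _).
Proof.
apply/seteqP; split=> g [adm H]; split=> //.
  move=> a /image_valuation[a' ->]; rewrite -iota_star_eval //.
  have : values star g (star_eval star a' g) by exists a'.
  by rewrite H => ->; rewrite raddf0.
apply/seteqP; split=> [_ [a _ <-]|_ ->].
  by apply: iota_inj; rewrite raddf0 iota_star_eval // H // => i; exists (a i).
exists (fun=> 0) => //; apply: iota_inj; rewrite raddf0 iota_star_eval // H // => i.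
by exists 0.
Qed.

Lemma Cen_central_poly :
  Cen star = central_poly kappa starB fst snd in_image (@admissible F A _).
Proof.
apply/seteqP; split=> g [adm nI H]; split=> //; rewrite -?Id_identity // ?Id_identity //.
  move=> a /image_valuation[a' ->]; rewrite -iota_star_eval // iota_center; first by exists (j (star_eval star a' g)).
  by apply: H; exists a'.
move=> _ [a _ <-] b; apply: iota_inj; rewrite !iotaM iota_star_eval //.
by apply: scalar_comm; apply: H => i; exists (a i).
Qed.

Lemma tilde_center : tilde iota (@center F A) = @is_scalar Zt At.
Proof.
apply/seteqP; split=> x.
  apply: lspan_min => [|_ [z cz <-]]; first exact: subspace_scalar.
  by exists (j z); apply: iota_center.
case=> c ->; have [z [y [cz z0 cy ->]]] := scalar_fraction c.
rewrite -scalerA -iota_center //; apply: (subspaceZ _ (subspace_lspan _)).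
by apply: lspan_incl; exists y.
Qed.

Lemma tilde_symmetric : tilde iota (symmetric_elts star) = sym starB.
Proof.
apply/seteqP; split=> x.
  apply: lspan_min => [|_ [s ss <-]]; first exact: subspace_sym.
  by rewrite /sym -iota_star ss.
have [z [a [cz z0 ->]]] := fraction x; rewrite /sym (csi_starZ csi) -iota_star => E.
apply: (subspaceZ _ (subspace_lspan _)); apply: lspan_incl; exists a => //.
by apply: iota_inj; apply: scalerI E; rewrite invr_eq0 (denominator_neq0 iota_inj iota_center).
Qed.

Lemma tilde_skew : tilde iota (skew_elts star) = skew starB.
Proof.
apply/seteqP; split=> x.
  apply: lspan_min => [|_ [s ss <-]]; first exact: subspace_skew.
  by rewrite /skew -iota_star ss raddfN.
have [z [a [cz z0 ->]]] := fraction x; rewrite /skew (csi_starZ csi) -iota_star => E.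
apply: (subspaceZ _ (subspace_lspan _)); apply: lspan_incl; exists a => //.
apply: iota_inj; rewrite raddfN; rewrite -scalerN in E; apply: scalerI E.
by rewrite invr_eq0 (denominator_neq0 iota_inj iota_center).
Qed.

Lemma admissible_coef1 (g : starPoly F) : g@_mone = 0 -> admissible A g.
Proof. by right. Qed.

Lemma admissible_add (g h : starPoly F) :
  admissible A g -> admissible A h -> admissible A (g + h).
Proof. by move=> [u|g1] [u'|h1]; [left|left|left|right; rewrite mcoeffD g1 h1 addr0]. Qed.

Lemma admissible_scale c (g : starPoly F) : admissible A g -> admissible A (c *: g).
Proof. by move=> [u|g1]; [left|right; rewrite mcoeffZ g1 mulr0]. Qed.

Lemma admissible_bar (g : starPoly F) : admissible A g -> admissible A (bar_poly flip_star g).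
Proof.
move=> [u|g1]; [by left|right]; rewrite (mcoeff_star flip_starK).
have -> : bar_word flip_star mone = mone by apply/eqP; rewrite fmP fm1 /= fm1.
exact: g1.
Qed.

End ImageValues.

(** * The eight possibilities *)

Lemma exactly_one_at (i0 : nat) cs : (forall i, (nth (False, True) cs i).1 <-> i = i0) ->
  (nth (False, True) cs i0).2 -> exactly_one_of cs.
Proof.
move=> H V; split; last by move=> i /H->.
by exists i0; split; [exact/H | move=> i /H].
Qed.

(** [Z], [N] and [K] stand for the occurrence of the scalars, of [[S, K]] and of
    [K] in the span of the values. The possibilities are listed in the order 0,
    [Z], [K], [Z + K], [N], [Z + N], [N + K], [Z + N + K]. *)
Lemma eight_possibilities (Z N K idt cen skid skcen syid cyc cyc2 : Prop)
    (V0 V1 V2 V3 V4 V5 V6 V7 : Prop) :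
  (idt <-> [/\ ~ Z, ~ N & ~ K]) -> (cen <-> ~ [/\ ~ Z, ~ N & ~ K] /\ (~ N /\ ~ K)) ->
  (skid <-> ~ Z /\ ~ N) -> (skcen <-> ~ N /\ ~ (~ Z /\ ~ N)) -> (syid <-> ~ K) ->
  (~ K -> (cyc <-> ~ Z)) -> (cyc2 <-> ~ Z) ->
  (~ Z -> ~ N -> ~ K -> V0) -> (Z -> ~ N -> ~ K -> V1) ->
  (~ Z -> ~ N -> K -> V2) -> (Z -> ~ N -> K -> V3) ->
  (~ Z -> N -> ~ K -> V4) -> (Z -> N -> ~ K -> V5) ->
  (~ Z -> N -> K -> V6) -> (Z -> N -> K -> V7) ->
  exactly_one_of [:: (idt, V0); (cen, V1); (skid /\ ~ idt, V2); (skcen /\ ~ cen, V3);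
    ([/\ syid, ~ idt & cyc], V4); ([/\ syid, ~ cen & ~ cyc], V5);
    ([/\ ~ syid, ~ skid & cyc2], V6); ([/\ ~ syid, ~ skid, ~ skcen & ~ cyc2], V7)].
Proof.
move=> Hid Hcen Hskid Hskcen Hsyid Hcyc Hcyc2 v0 v1 v2 v3 v4 v5 v6 v7.
have only i0 cs : (i0 < size cs)%N -> (forall i, (i < size cs)%N ->
    (nth (False, True) cs i).1 <-> i = i0) -> (nth (False, True) cs i0).2 -> exactly_one_of cs.
  move=> i0s H V; apply: (exactly_one_at (i0 := i0)) => // i.
  have [lis|si] := ltnP i (size cs); first exact: H.
  by rewrite nth_default //; split=> // E; rewrite E leqNgt i0s in si.
have TF P : P = True \/ P = False.
  by have [p|p] := EM P; [left | right]; apply/propext; split.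
rewrite (propext Hid) (propext Hcen) (propext Hskid) (propext Hskcen) (propext Hsyid).
rewrite (propext Hcyc2); clear Hid Hcen Hskid Hskcen Hsyid Hcyc2.
have pick i0 : (i0 < 8)%N -> forall cs, size cs = 8 -> (forall i, (i < 8)%N ->
    (nth (False, True) cs i).1 <-> i = i0) -> (nth (False, True) cs i0).2 -> exactly_one_of cs.
  by move=> i08 cs s8 H V; apply: (only i0) => //; rewrite s8.
clear only.
have and3E (A B C : Prop) : [/\ A, B & C] = (A /\ B /\ C).
  by apply/propext; split=> [[]|[? []]].
have and4E (A B C D : Prop) : [/\ A, B, C & D] = (A /\ B /\ C /\ D).
  by apply/propext; split=> [[]|[? [? []]]].
have [?|?] := TF Z; have [?|?] := TF N; have [?|?] := TF K; subst;
  try (have {}Hcyc := Hcyc id; rewrite (propext Hcyc)); clear Hcyc TF;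
  [apply: (pick 7%N) | apply: (pick 5%N) | apply: (pick 3%N) | apply: (pick 1%N)
  |apply: (pick 6%N) | apply: (pick 4%N) | apply: (pick 2%N) | apply: (pick 0%N)] => //=.
all: try (by auto).
all: clear -and3E and4E.
all: case=> [|[|[|[|[|[|[|[|i]]]]]]]] // _ /=.
all: rewrite ?and3E ?and4E.
all: first [by split=> // h; exfalso; tauto | by split=> // _; tauto].
Qed.

Theorem theorem4p9
  (F : fieldType) (sigma : {rmorphism F -> F}) (sigmaK : involutive sigma)
  (char0 : [pchar F] =i pred0)
  (A : nuAlgType F) (primeA : is_prime A) (piA : is_PI A)
  (star : A -> A) (starP : is_involution star sigma)
  (star1 : first_kind star)
  (Zt : fieldType) (At : algType Zt) (iota : {additive A -> At})
  (closure : is_central_closure iota)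
  (dim1 : ~ has_dim At 1) (dim4 : ~ has_dim At 4) (dim16 : ~ has_dim At 16)
  (f : starPoly F) (admf : admissible A f) :
  let Sym := Sym sigma in
  let Skew := Skew sigma in
  let Id := Id star in
  let Cen := Cen star in
  let cyc_to_Id g := exists2 h, Id h & cyc_equiv g h in
  let Z' := tilde iota (@center F A) in
  let S' := tilde iota (symmetric_elts star) in
  let K' := tilde iota (skew_elts star) in
  let L' := tilde iota (lspan (values star f)) in
  exactly_one_of
    [:: (Id f,
         L' = [set 0]);
        (Cen f,
         L' = Z');
        (add_set Skew Id f /\ ~ Id f,
         L' = K');
        (add_set Skew Cen f /\ ~ Cen f,
         L' = add_set Z' K');
        ([/\ add_set Sym Id f, ~ Id f & cyc_to_Id f],
         L' = comm_span S' K');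
        ([/\ add_set Sym Id f, ~ Cen f & ~ cyc_to_Id f],
         L' = S');
        ([/\ ~ add_set Sym Id f, ~ add_set Skew Id f
           & cyc_to_Id (f + poly_star sigma f)],
         L' = comm_span [set: At] [set: At]);
        ([/\ ~ add_set Sym Id f, ~ add_set Skew Id f, ~ add_set Skew Cen f
           & ~ cyc_to_Id (f + poly_star sigma f)],
         L' = [set: At])].
Proof.
move: closure => [j [iota_inj iotaM iota_center scalar_fraction fraction]].
have [kappa iotaZ] := exists_scalar_morphism iota_inj iotaM iota_center fraction.
have sigma_id := first_kind_scalars fraction starP star1.
have [starB [csi iota_star]] := closure_involution iota_inj iotaM iota_center scalar_fraction
  fraction primeA iotaZ char0 piA starP star1.
have [n [b fr]] := closure_finite_rank iota_inj iotaM iota_center fraction primeA iotaZ piA.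
have [[v [lam [lamE coord]]] [s [t [tE tC t1]]]] := finite_rank_coordinates
  (closure_prime iota_inj iotaM iota_center fraction primeA)
  (closure_torsion_free kappa char0 (At := At)) (closure_center iota_inj iotaM iota_center fraction) fr.
have [e [tau [tauE tauC tau_star tau1 e_star]]] := symmetrized_trace csi tE tC t1.
have dimP m : basis_of (@everything _ At) m -> has_dim At m.
  by case=> b' [_ H]; exists b' => x; apply: H.
have not_low : ~ (basis_of (@everything _ At) 1 \/ basis_of (@everything _ At) 4).
  by case=> /dimP.
have not16 : ~ basis_of (@everything _ At) 16 by move/dimP.
pose Y := in_image iota.
have Y0 : Y 0 by exists 0; rewrite raddf0.
have YD x y : Y x -> Y y -> Y (x + y) by move=> [a ->] [a' ->]; exists (a + a'); rewrite raddfD.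
have YN x : Y x -> Y (- x) by move=> [a ->]; exists (- a); rewrite raddfN.
have YM x y : Y x -> Y y -> Y (x * y) by move=> [a ->] [a' ->]; exists (a * a')%nu.
have Ystar x : Y x -> Y (starB x) by move=> [a ->]; exists (star a); rewrite iota_star.
have Yspan x : exists c y, Y y /\ x = c *: y.
  by have [z [a [_ _ ->]]] := fraction x; exists (j z)^-1, (iota a); split=> //; exists a.
have idx i : (flip_star i).1 = i.1 by [].
have str i : (flip_star i).2 = ~~ i.2 by [].
have inv := span_invariant kappa csi fst snd Y0 YD YN YM Ystar Yspan f.
set L := lspan _ in inv.
move=> Sym0 Skew0 Id0 Cen0 cyc Z' S' K' L'.
have EL : L' = L := tilde_span iotaM fraction iotaZ iota_star admf.
have EId : Id0 = _ := Id_identity iota_inj iotaM fraction iotaZ iota_star.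
have ECen : Cen0 = _ := Cen_central_poly iota_inj iotaM iota_center fraction iotaZ iota_star.
have EZ : Z' = _ := tilde_center iota_center scalar_fraction.
have ES : S' = _ := tilde_symmetric iota_inj iota_center fraction csi iota_star.
have EK : K' = _ := tilde_skew iota_inj iota_center fraction csi iota_star.
have ESym : Sym0 = [set p | bar_poly flip_star p = p].
  by rewrite /Sym0 /Defs.Sym; apply/seteqP; split=> p /=; rewrite (poly_star_bar sigma_id).
have ESkew : Skew0 = [set p | bar_poly flip_star p = - p].
  by rewrite /Skew0 /Defs.Skew; apply/seteqP; split=> p /=; rewrite (poly_star_bar sigma_id).
have a1 := @admissible_coef1 F A; have aD := @admissible_add F A.
have aZ := @admissible_scale F A; have aB := @admissible_bar F A.
have s0 := sub_zero csi not_low not16 coord lamE tauE tauC tau_star tau1 e_star inv.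
have sZ := sub_scalar csi not_low not16 coord lamE tauE tauC tau_star tau1 e_star inv.
have sK := sub_skew csi not_low not16 coord lamE tauE tauC tau_star tau1 e_star inv.
have sS := sub_sym csi not_low not16 coord lamE tauE tauC tau_star tau1 e_star inv.
have sT := sub_trace csi not_low not16 coord lamE tauE tauC tau_star tau1 e_star inv.
have sN := sub_sum_scalar csi not_low not16 coord lamE tauE tauC tau_star tau1 e_star inv.
apply: (eight_possibilities (Z := Zpart L) (N := Npart starB L) (K := Kpart starB L)).
- rewrite EId; exact: (iff_trans (identityP _ _ _ _ _ admf) s0).
- rewrite ECen; apply: (iff_trans (central_polyP _ _ _ _ _ admf)).
  exact: (iff_trans (and_iff_compat_r _ (not_iff_compat s0)) (and_iff_compat_l _ sZ)).
- rewrite ESkew EId.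
  exact: (iff_trans (skew_identityP _ csi flip_starK idx str _ aD aZ aB admf) sK).
- rewrite ESkew ECen.
  apply: (iff_trans (skew_centralP _ csi flip_starK idx str _ aD aZ aB admf)).
  exact: (iff_trans (and_iff_compat_r _ sN) (and_iff_compat_l _ (not_iff_compat sK))).
- rewrite ESym EId.
  exact: (iff_trans (sym_identityP _ csi flip_starK idx str _ aD aZ aB admf) sS).
- move=> hK; rewrite /cyc EId; apply: (iff_trans _ sT).
  exact: (cyclic_identityP csi flip_starK idx str Y0 YD Yspan tauE tauC tau_star tau1
    a1 aD aZ aB admf (sS.2 hK)).
- rewrite /cyc EId (poly_star_bar sigma_id); apply: (iff_trans _ sT).
  exact: (cyclic_sum_identityP kappa csi flip_starK idx str Y0 YD Yspan tauE tauC tau_star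
    tau1 a1 f).
- rewrite EL; exact: (value_zero csi not_low not16 coord lamE tauE tauC tau_star tau1 e_star inv).
- rewrite EL EZ; exact: (value_scalar csi not_low not16 coord lamE tauE tauC tau_star tau1 e_star inv).
- rewrite EL EK; exact: (value_skew csi not_low not16 coord lamE tauE tauC tau_star tau1 e_star inv).
- rewrite EL EZ EK; exact: (value_scalar_skew csi not_low not16 coord lamE tauE tauC tau_star tau1 e_star inv).
- rewrite EL ES EK; exact: (value_SK csi not_low not16 coord lamE tauE tauC tau_star tau1 e_star inv).
- rewrite EL ES; exact: (value_sym csi not_low not16 coord lamE tauE tauC tau_star tau1 e_star inv).
- rewrite EL; exact: (value_commutators csi not_low not16 coord lamE tauE tauC tau_star tau1 e_star inv).
rewrite EL.
exact: (value_everything csi not_low coord lamE tauE tauC tau_star tau1 inv).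
Qed.
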